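(* Let $d\ge 2$ and let $(\gamma_n)_{n\ge 0}$ be a sequence of independent and identically distributed random invertible real $d\times d$ matrices. Write $\overline\gamma_n:=\gamma_0\cdots\gamma_{n-1}$. Assume: (i) $\mathbb{E}(\log^+\|\gamma_0\|)<+\infty$ and $\mathbb{E}(\log^+\|\gamma_0^{-1}\|)<+\infty$; (ii) for all $N\ge 1$ and all subspaces $\{0\}\subsetneq V_1,\dots,V_N\subsetneq\mathbb{R}^d$, one has $\mathbb{P}\big(\gamma_0(\bigcup_i V_i)\subset\bigcup_i V_i\big)<1$; (iii) there exists $n\ge 1$ such that $\mathbb{P}(\rho_1(\overline\gamma_n)>\rho_2(\overline\gamma_n))>0$. Then there exists a non-random constant $\lambda_1$ such that for all $1\le i,j\le d$, almost surely $$\lim_{n\to+\infty}\frac{\log|{}^te_i\,\overline\gamma_n\, e_j|}{n}=\lim_{n\to+\infty}\frac{\log\rho_1(\overline\gamma_n)}{n}=\lambda_1 .$$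
   Context: $\|\cdot\|$ is the Euclidean operator norm. $(e_1,\dots,e_d)$ is the canonical basis of $\mathbb{R}^d$, so ${}^te_i\,g\,e_j$ is the $(i,j)$ entry of $g$. For a matrix $g$, $\rho_1(g)\ge\rho_2(g)\ge\dots\ge\rho_d(g)$ are the moduli of its (complex) eigenvalues counted with multiplicity. $\log^+ x=\max(\log x,0)$. *)

(* Defs.v *)
From HB Require Import structures.
From mathcomp Require Import all_boot all_order all_algebra.
From mathcomp Require Import all_classical all_reals all_analysis.
From mathcomp.real_closed Require Import complex.
Set Implicit Arguments. Unset Strict Implicit. Unset Printing Implicit Defensive.
Import Order.TTheory GRing.Theory Num.Theory.
Import numFieldNormedType.Exports.
Local Open Scope ring_scope.
Local Open Scope classical_set_scope.

Definition logp (R : realType) (x : R) : R := Num.max (ln x) 0.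

Definition vnorm (R : realType) (d : nat) (x : 'cV[R]_d) : R :=
  Num.sqrt (\sum_(i < d) (x i 0) ^+ 2).

Definition opnorm (R : realType) (d : nat) (A : 'M[R]_d) : R :=
  sup [set y : R | exists2 x : 'cV[R]_d, vnorm x = 1 & y = vnorm (A *m x)].

(* the complex eigenvalues of A, with multiplicity: the roots of the
   characteristic polynomial of A viewed in C = R[i] *)
Definition eigenvalues (R : realType) (d : nat) (A : 'M[R]_d) : seq R[i] :=
  sval (closed_field_poly_normal (map_poly (real_complex R) (char_poly A))).

Definition eig_moduli (R : realType) (d : nat) (A : 'M[R]_d) : seq R :=
  sort (fun x y : R => y <= x) [seq Normc.normc z | z <- eigenvalues A].

(* rho A k = rho_{k+1}(A)  (0-indexed) *)
Definition rho (R : realType) (d : nat) (A : 'M[R]_d) (k : nat) : R :=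
  nth 0 (eig_moduli A) k.

Definition mprod (R : realType) (d : nat) (g : nat -> 'M[R]_d) (n : nat)
  : 'M[R]_d := \big[mulmx/1%:M]_(i < n) g i.

Definition mat_event (R : realType) (d : nat) (T : Type) (X : T -> 'M[R]_d)
  (A : 'I_d -> 'I_d -> set R) : set T :=
  [set w | forall i j, A i j (X w i j)].

(* (g n)_n is a sequence of independent, identically distributed random
   d x d matrices: entries are measurable, mutual independence (product rule
   over every finite subfamily, on the generating pi-system of measurable
   rectangles), and all g n have the law of g 0 (equality on rectangles). *)
Definition iid_matrices (R : realType) (d : nat) (dT : measure_display)
  (T : measurableType dT) (P : probability T R) (g : nat -> T -> 'M[R]_d)
  : Prop :=
  [/\ (forall n i j, measurable_fun setT (fun w => g n w i j)),
      (forall (s : seq nat) (A : nat -> 'I_d -> 'I_d -> set R),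
          uniq s -> (forall n i j, measurable (A n i j)) ->
          P (\bigcap_(n in [set` s]) mat_event (g n) (A n))
          = (\prod_(n <- s) P (mat_event (g n) (A n)))%E) &
      (forall n (A : 'I_d -> 'I_d -> set R), (forall i j, measurable (A i j)) ->
          P (mat_event (g n) A) = P (mat_event (g 0%N) A))].

(* Main.v *)
From HB Require Import structures.
From mathcomp Require Import all_boot all_order all_algebra.
Require Import Defs.
From mathcomp Require Import all_classical all_reals all_analysis.
From mathcomp Require Import measurable_realfun.
From mathcomp.real_closed Require Import complex.
From mathcomp Require Import ring lra zify.
Import Order.TTheory GRing.Theory Num.Theory.
Import numFieldNormedType.Exports.
Set Implicit Arguments. Unset Strict Implicit. Unset Printing Implicit Defensive.
Local Open Scope ring_scope.
Local Open Scope classical_set_scope.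

(** Let [nu] be the law of the trajectory on the space of matrix sequences and
    [lam] its Lyapunov exponent.  Subadditivity of the logarithm of the norm
    gives the upper bound |gamma_0 ... gamma_(n-1)| <= e^(n (lam + e) + C).

    For the lower bounds, a proximal product [h] given by (iii) has powers that
    are asymptotically multiples of a rank-one matrix [u *m v].  By (ii) the
    orbits of [u] and of [v] under words in the support of the law lie in no
    finite union of proper subspaces, so padding with powers of [h] produces
    finitely many words of one common length, each close to a multiple of some
    [x i *m (y i)^T], with the [x i] and the [y i] in general position.  Given any
    matrix [B], all but at most d - 1 of these words [S] satisfy
    |B S| >= eta |B| |S|, and symmetrically on the left.  Each of these words
    occurs with positive probability, so the exponential Markov inequality shows
    that, outside an event of probability O(K r^K), a window of O(K) factors
    contains two such words whose four junctions in the cyclic product inside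
    [\tr (B *m mprod z (2 K l))] involve no cancellation; then the trace is
    at least c |B| e^(- cost of the window).

    Inserting short windows periodically shows that |B gamma_0 ... gamma_(n-1)|
    grows at rate [lam]; a last window of length proportional to a small multiple
    of n and Borel-Cantelli give the same rate for the trace of
    B gamma_0 ... gamma_(n-1).  For B = e_j e_i^T this trace is the (i, j) entry, for
    B = 1 it is at most d rho_1. *)

(** * The entrywise norm *)

(** Only a first moment is assumed, so the costs of the factors need not have exponential moments.
    Exponential estimates are therefore applied to bounded quantities only, block weights in [0, 1]
    and indicators of failure. The costs are controlled almost surely and linearly, by the one-sided
    law of large numbers and a truncation; this is why a window is charged its actual random cost.

    Traces are the natural target because a cyclic product has no ends: a fixed matrix B is just one
    more factor, and a suitable B yields entries, norms or the spectral radius. Closing the cycle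
    takes two rank-one blocks, hence four junctions, and a block is independent only of the factors
    outside it. So each junction is counted with one position fixed while the block on the other
    side runs over its half of the window, and a weighted pigeonhole over pairs finds one pair good
    for all four. The proportions fit this count: 80 d models keep the misaligned weight below a/80,
    and the thresholds a/20 and a/4 have ratio 5, more than the number of junctions. *)

Section MatrixNorm.
Variable K : numDomainType.
Implicit Types m n p : nat.

(** The l1 norm of the entries. It is submultiplicative for rectangular matrices, invariant under
    transposition and exactly multiplicative on products column times row, and its measurability is
    immediate. Its comparison constants with the operator norm do not affect exponential rates. *)
Definition mxn m n (A : 'M[K]_(m, n)) : K := \sum_i \sum_j `|A i j|.

Lemma mxn_ge0 m n (A : 'M[K]_(m, n)) : 0 <= mxn A.
Proof. by apply: sumr_ge0 => i _; apply: sumr_ge0. Qed.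

Lemma le_mxn m n (A : 'M[K]_(m, n)) i j : `|A i j| <= mxn A.
Proof.
rewrite /mxn (bigD1 i)//= (bigD1 j)//= -addrA lerDl addr_ge0 ?sumr_ge0// => k _.
exact: sumr_ge0.
Qed.

Lemma mxn0 m n : mxn (0 : 'M[K]_(m, n)) = 0.
Proof. by rewrite /mxn !big1// => i _; rewrite big1// => j _; rewrite mxE normr0. Qed.

Lemma mxn_eq0 m n (A : 'M[K]_(m, n)) : (mxn A == 0) = (A == 0).
Proof.
apply/eqP/eqP => [A0|->]; last exact: mxn0.
apply/matrixP => i j; rewrite mxE; apply/eqP; rewrite -normr_le0 -A0.
exact: le_mxn.
Qed.

Lemma mxn_gt0 m n (A : 'M[K]_(m, n)) : (0 < mxn A) = (A != 0).
Proof. by rewrite lt_def mxn_ge0 andbT mxn_eq0. Qed.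

Lemma mxnD m n (A B : 'M[K]_(m, n)) : mxn (A + B) <= mxn A + mxn B.
Proof.
rewrite /mxn -big_split/=; apply: ler_sum => i _.
by rewrite -big_split/=; apply: ler_sum => j _; rewrite mxE ler_normD.
Qed.

Lemma mxnN m n (A : 'M[K]_(m, n)) : mxn (- A) = mxn A.
Proof. by apply: eq_bigr => i _; apply: eq_bigr => j _; rewrite mxE normrN. Qed.

Lemma mxnB m n (A B : 'M[K]_(m, n)) : mxn (A - B) = mxn (B - A).
Proof. by rewrite -mxnN opprB. Qed.

Lemma mxnZ m n a (A : 'M[K]_(m, n)) : mxn (a *: A) = `|a| * mxn A.
Proof.
rewrite /mxn mulr_sumr; apply: eq_bigr => i _.
by rewrite mulr_sumr; apply: eq_bigr => j _; rewrite mxE normrM.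
Qed.

Lemma mxn_tr m n (A : 'M[K]_(m, n)) : mxn A^T = mxn A.
Proof.
by rewrite /mxn exchange_big; apply: eq_bigr => i _; apply: eq_bigr => j _; rewrite mxE.
Qed.

Lemma mxnM m n p (A : 'M[K]_(m, n)) (B : 'M[K]_(n, p)) : mxn (A *m B) <= mxn A * mxn B.
Proof.
rewrite {2}/mxn mulr_suml; apply: ler_sum => i _.
apply: (@le_trans _ _ (\sum_j \sum_k `|A i k| * `|B k j|)).
  apply: ler_sum => j _; rewrite mxE; apply: le_trans (ler_norm_sum _ _ _) _.
  by apply: ler_sum => k _; rewrite normrM.
rewrite exchange_big/= mulr_suml; apply: ler_sum => k _.
rewrite -mulr_sumr ler_wpM2l// /mxn (bigD1 k)//= lerDl sumr_ge0// => l _.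
exact: sumr_ge0.
Qed.

Lemma mxn_trace n (A : 'M[K]_n) : `|\tr A| <= mxn A.
Proof.
apply: le_trans (ler_norm_sum _ _ _) _; apply: ler_sum => i _.
by rewrite (bigD1 i)//= lerDl sumr_ge0.
Qed.

Lemma mxn1_ge1 n : (0 < n)%N -> 1 <= mxn (1%:M : 'M[K]_n).
Proof.
by case: n => // n _; apply: le_trans (le_mxn _ ord0 ord0); rewrite mxE eqxx normr1.
Qed.

Lemma mxn_map (aT : numDomainType) (f : {rmorphism aT -> K}) m n
    (A : 'M[aT]_(m, n)) :
  (forall x, `|f x| = f `|x|) ->
  mxn (map_mx f A) = f (\sum_i \sum_j `|A i j|).
Proof.
move=> fn; rewrite rmorph_sum; apply: eq_bigr => i _.
by rewrite rmorph_sum; apply: eq_bigr => j _; rewrite mxE.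
Qed.

End MatrixNorm.

Lemma exists_ge_mean (K : realDomainType) (n : nat) (F : 'I_n -> K) :
  (0 < n)%N -> exists i, \sum_j F j <= n%:R * F i.
Proof.
move=> n0; apply: contrapT => /forallNP H.
suff : \sum_j (n%:R * F j) < \sum_(j < n) \sum_i F i.
  by rewrite -mulr_sumr sumr_const card_ord -[in X in _ < X]mulr_natl ltxx.
have i0 : 'I_n by exact: Ordinal n0.
apply: ltr_sum; last by move=> i _; have := H i; move/negP; rewrite -ltNge.
by apply/hasP; exists i0; rewrite ?mem_index_enum.
Qed.

Section MatrixNormReal.
Variable K : realDomainType.

Lemma mxn_row_ge m n (A : 'M[K]_(m, n)) : (0 < m)%N ->
  exists i, mxn A <= m%:R * mxn (row i A).
Proof.
move=> m0; have [i Hi] := exists_ge_mean (fun i => \sum_j `|A i j|) m0.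
exists i; apply: le_trans Hi _; rewrite ler_wpM2l// /mxn big_ord1.
by apply: ler_sum => j _; rewrite mxE.
Qed.

Lemma mxn_col_ge m n (A : 'M[K]_(m, n)) : (0 < n)%N ->
  exists j, mxn A <= n%:R * mxn (col j A).
Proof.
move=> n0; have [j] := mxn_row_ge A^T n0.
by rewrite mxn_tr => h; exists j; rewrite -tr_col mxn_tr in h.
Qed.

Lemma mxn_row_le m n (A : 'M[K]_(m, n)) i : mxn (row i A) <= mxn A.
Proof.
rewrite /mxn big_ord1 [leRHS](bigD1 i)//= (eq_bigr (fun j => `|A i j|)) => [|j _].
  by rewrite lerDl sumr_ge0// => k _; apply: sumr_ge0.
by rewrite mxE.
Qed.

End MatrixNormReal.

(** * Spectral gaps and powers *)

Lemma char_poly_conj (F : fieldType) n (P A : 'M[F]_n) :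
  P \in unitmx -> char_poly (P *m A *m invmx P) = char_poly A.
Proof.
move=> uP; rewrite /char_poly.
have -> : char_poly_mx (P *m A *m invmx P) =
    map_mx polyC P *m char_poly_mx A *m map_mx polyC (invmx P).
  rewrite /char_poly_mx mulmxBr mulmxBl !map_mxM; congr (_ - _).
  by rewrite scalar_mxC -mulmxA -map_mxM mulmxV// map_mx1 mulmx1.
by rewrite !det_mulmx mulrAC -det_mulmx -map_mxM mulmxV// map_mx1 det1 mul1r.
Qed.

(** Gaussian elimination completes a left eigenvector [v] to a basis: [v] is a nonzero multiple of
    the first row of [row_ebase v]. *)
Lemma eigen_basis (F : fieldType) n (A : 'M[F]_(1 + n)) z :
  root (char_poly A) z -> exists2 P : 'M[F]_(1 + n), P \in unitmx &
    usubmx P *m A = z *: usubmx P.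
Proof.
rewrite -eigenvalue_root_char => /eigenvalueP[v vA v0].
exists (row_ebase v); first exact: row_ebase_unit.
have rv : \rank v = 1%N by apply/eqP; rewrite rank_rV v0.
have c0 : col_ebase v 0 0 != 0.
  have := col_ebase_unit v; rewrite unitmxE unitfE [X in \det X]mx11_scalar.
  by rewrite det_scalar1.
have ve : v = col_ebase v 0 0 *: usubmx (row_ebase v).
  rewrite -[LHS]mulmx_ebase rv [X in X *m _ *m _]mx11_scalar -mulmxA mul_scalar_mx.
  congr (_ *: _).
  rewrite -[X in _ *m X]vsubmxK.
  have -> : pid_mx 1 = row_mx 1%:M 0 :> 'M[F]_(1, 1 + n).
    by apply/matrixP => i j; rewrite !mxE ord1; case: splitP => k ->; rewrite !mxE ?ord1.
  by rewrite mul_row_col mul1mx mul0mx addr0.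
by apply: (scalerI c0); rewrite scalemxAl -ve vA scalerA mulrC -scalerA -ve.
Qed.

(** Deflation: in a basis starting with a left eigenvector the matrix is block triangular, and the
    remaining eigenvalues, with multiplicity, are those of the lower right block. *)
Lemma eigen_block (F : fieldType) n (A : 'M[F]_(1 + n)) z :
  root (char_poly A) z -> exists P B C,
    [/\ P \in unitmx, P *m A = block_mx z%:M 0 C B *m P &
     char_poly A = ('X - z%:P) * char_poly B].
Proof.
move=> /eigen_basis[P uP Pz].
pose M := P *m A *m invmx P.
have Mu : usubmx M = row_mx z%:M 0.
  rewrite /M -mul_usub_mx -mul_usub_mx Pz -scalemxAl mul_usub_mx mulmxV//.
  by rewrite scalar_mx_block block_mxEv col_mxKu scale_row_mx scaler0 scalemx1.
have Me : M = block_mx z%:M 0 (dlsubmx M) (drsubmx M).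
  rewrite -[LHS]submxK; congr block_mx.
    by rewrite -[ulsubmx M]/(lsubmx (usubmx M)) Mu row_mxKl.
  by rewrite -[ursubmx M]/(rsubmx (usubmx M)) Mu row_mxKr.
exists P, (drsubmx M), (dlsubmx M); split=> //.
  by rewrite -Me /M mulmxKV.
rewrite -(char_poly_conj A uP) -/M {1}Me /char_poly.
have -> : char_poly_mx (block_mx z%:M 0 (dlsubmx M) (drsubmx M)) =
   block_mx ('X - z%:P)%:M 0 (- map_mx polyC (dlsubmx M)) (char_poly_mx (drsubmx M)).
  rewrite /char_poly_mx map_block_mx map_scalar_mx map_mx0 scalar_mx_block.
  by rewrite opp_block_mx add_block_mx subr0 add0r -raddfB.
by rewrite det_lblock det_scalar1.
Qed.

(** Induction on the annihilating factors instead of a Jordan form. If the powers applied to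
    [(A - z) Y] decay like [r ^+ m], the powers applied to [Y] satisfy a first-order recurrence with
    ratio [z] and such a forcing term, which [|z| < r] absorbs. *)
Lemma recurrence_decay (K : numFieldType) n (A : 'M[K]_n.+1) p (Y : 'M[K]_(n.+1, p))
    (s : seq K) (r : K) : 0 < r -> (forall z, z \in s -> `|z| < r) ->
  (\prod_(z <- s) (A - z%:M)) *m Y = 0 ->
  exists2 k, 0 <= k & forall m, mxn (A ^+ m *m Y) <= k * r ^+ m.
Proof.
move=> r0; elim/last_ind: s Y => [Y _|s z IHs Y Hs].
  rewrite big_nil mul1mx => ->; exists 0 => // m.
  by rewrite mulmx0 mxn0 mul0r.
rewrite -cats1 big_cat big_seq1 -mulmxA => H0.
have [|k k0 Hk] := IHs ((A - z%:M) *m Y) _ H0.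
  by move=> w ws; apply: Hs; rewrite mem_rcons inE ws orbT.
have zr : `|z| < r by apply: Hs; rewrite mem_rcons mem_head.
have rz0 : 0 < r - `|z| by rewrite subr_gt0.
(* The second summand solves [|z| k' + k = r k'], the induction step; the first takes care of
   [m = 0]. *)
pose k' := mxn Y + k / (r - `|z|).
have kk : 0 <= k / (r - `|z|) by rewrite divr_ge0// ltW.
exists k' => [|m]; first by rewrite addr_ge0// mxn_ge0.
elim: m => [|m IHm]; first by rewrite expr0 mul1mx mulr1 lerDl.
have -> : A ^+ m.+1 *m Y = z *: (A ^+ m *m Y) + A ^+ m *m ((A - z%:M) *m Y).
  rewrite mulmxA mulmxBr mulmxBl mul_mx_scalar -scalemxAl addrC subrK.
  by rewrite exprSr.
apply: le_trans (mxnD _ _) _; rewrite mxnZ.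
apply: le_trans (lerD (ler_wpM2l _ IHm) (Hk m)) _ => //.
rewrite mulrA -mulrDl exprS mulrA ler_wpM2r ?exprn_ge0 ?(ltW r0)//.
rewrite -lerBrDl [k' * r]mulrC -mulrBl /k' mulrDr.
rewrite [X in _ <= _ + X]mulrC divfK ?gt_eqF// lerDr.
exact: mulr_ge0 (ltW rz0) (mxn_ge0 _).
Qed.

Section Spectrum.
Variable R : realType.
Local Notation C := R[i].
Local Notation toC := (map_mx (real_complex R)).

Lemma normcP (z : C) : `|z| = (Normc.normc z)%:C%C.
Proof. by []. Qed.

Lemma normc_nonneg (z : C) : 0 <= Normc.normc z.
Proof. by case: z => a b; exact: sqrtr_ge0. Qed.

Lemma mxn_toC m n (A : 'M[R]_(m, n)) : mxn (toC A) = (mxn A)%:C%C.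
Proof. by rewrite mxn_map // => x; rewrite normc_def/= expr0n addr0 sqrtr_sqr. Qed.

Lemma eigenvaluesE d (A : 'M[R]_d) :
  char_poly (toC A) = \prod_(z <- eigenvalues A) ('X - z%:P).
Proof.
rewrite /eigenvalues; case: closed_field_poly_normal => s /= Hs.
by rewrite -map_char_poly [LHS]Hs (monicP _) ?scale1r// map_char_poly char_poly_monic.
Qed.

Lemma size_eigenvalues d (A : 'M[R]_d) : size (eigenvalues A) = d.
Proof.
by have := size_char_poly (toC A); rewrite eigenvaluesE size_prod_XsubC => -[].
Qed.

Lemma eig_moduli_sorted d (A : 'M[R]_d) : exists2 t, perm_eq (eigenvalues A) t &
  eig_moduli A = map (@Normc.normc R) t /\ sorted (fun x y : R => y <= x) (eig_moduli A).
Proof.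
rewrite /eig_moduli sort_map.
exists (sort (relpre (@Normc.normc R) (fun x y : R => y <= x)) (eigenvalues A)); first by rewrite perm_sym perm_sort.
by split=> //; rewrite -sort_map; apply: sort_sorted => x y; exact: le_total.
Qed.

Lemma rho_split d (A : 'M[R]_d.+1) : exists z t,
  [/\ char_poly (toC A) = \prod_(w <- z :: t) ('X - w%:P), size t = d,
      Normc.normc z = rho A 0, forall w, w \in z :: t -> Normc.normc w <= rho A 0
     & forall w, w \in t -> Normc.normc w <= rho A 1].
Proof.
have [t pt [te ts]] := eig_moduli_sorted A.
have st := perm_size pt; rewrite size_eigenvalues in st.
case: t => [//|z t] in pt te st *; move: st => [st].
exists z, t; rewrite -st; split => //.
- by rewrite eigenvaluesE; exact: perm_big.
- by rewrite /rho te.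
- move=> w; rewrite /rho te/= inE => /orP[/eqP->//|wt].
  have := ts; rewrite te/= => /(order_path_min (fun x y z a b => le_trans b a)) /allP.
  by apply; apply: map_f.
- move=> w wt; rewrite /rho te/=; case: t => [//|z1 t] in te wt ts st pt *.
  move: wt; rewrite inE => /orP[/eqP->//|wt].
  move: ts; rewrite te/= => /andP[_].
  move=> /(order_path_min (fun x y z a b => le_trans b a)) /allP; apply.
  exact: map_f.
Qed.

Lemma root_toC d (A : 'M[R]_d) (a : R) :
  root (char_poly (toC A)) a%:C%C = root (char_poly A) a.
Proof. by rewrite -map_char_poly fmorph_root. Qed.

(** Cayley-Hamilton over the complex numbers supplies the annihilating product. The constant found
    there is a nonnegative complex number, hence real. *)
Lemma real_power_decay n (B : 'M[R]_n.+1) (r : R) : 0 < r ->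
  (forall z, root (char_poly (toC B)) z -> Normc.normc z < r) ->
  exists2 k, 0 <= k & forall m, mxn (B ^+ m) <= k * r ^+ m.
Proof.
move=> r0 Hr.
have CH : \prod_(z <- eigenvalues B) (toC B - z%:M) *m 1%:M = 0.
  rewrite mulmx1 -[RHS](Cayley_Hamilton (toC B)) eigenvaluesE rmorph_prod/=.
  by apply: eq_bigr => z _; rewrite rmorphB/= horner_mx_X horner_mx_C.
have [|z zs|k k0 Hk] := recurrence_decay (r := r%:C%C) _ _ CH; first by rewrite ltcR.
  by rewrite normcP ltcR; apply: Hr; rewrite eigenvaluesE root_prod_XsubC.
exists (complex.Re k); first by move: k0; rewrite lecE => /andP[].
move=> m; have := Hk m; rewrite mulmx1 -rmorphXn/= mxn_toC lecE => /andP[_].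
by rewrite -rmorphXn/=; case: (k) => a b /=; rewrite mulr0 subr0.
Qed.

Lemma conj_eigen n (A : 'M[R]_n) z :
  root (char_poly (toC A)) z -> root (char_poly (toC A)) z^*%C.
Proof.
move=> rz; rewrite -complex_root_conj; suff -> : map_poly conjc (char_poly (toC A)) = char_poly (toC A) by [].
rewrite -map_char_poly -map_poly_comp; apply: eq_map_poly => x /=.
exact: conjc_real.
Qed.

(** The dominant eigenvalue is simple, and it is real because its conjugate is an eigenvalue of the
    same modulus. After deflation the complementary block has spectral radius at most [rho A 1], so
    its powers are negligible against those of [lam]; [u] and [v] are the right and left
    eigenvectors. *)
Theorem proximal_power_limit n (A : 'M[R]_n.+2) : rho A 1 < rho A 0 ->
  exists lam (u : 'cV[R]_n.+2) (v : 'rV[R]_n.+2), [/\ lam != 0, v *m u = 1%:M &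
    exists k c, [/\ 0 <= k, 0 <= c < 1 &
      forall m, mxn (lam ^- m *: A ^+ m - u *m v) <= k * c ^+ m]].
Proof.
move=> prox; have [z [t [Ht st nz _ Hrho]]] := rho_split A.
have rz : root (char_poly (toC A)) z by rewrite Ht root_prod_XsubC mem_head.
have zt : z \notin t by apply/negP => /Hrho; rewrite nz leNgt prox.
have rho1 : 0 <= rho A 1.
  case: t st {zt Ht} Hrho => // w t _ /(_ w (mem_head _ _)).
  exact: le_trans (normc_nonneg _).
have zreal : z = (complex.Re z)%:C%C.
  have := conj_eigen rz; rewrite Ht root_prod_XsubC inE => /orP[/eqP|/Hrho].
    by case: (z) => a b [/eqP]; rewrite eqNr => /eqP ->.
  suff -> : Normc.normc z^*%C = Normc.normc z by rewrite nz leNgt prox.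
  by case: (z) => a b /=; rewrite sqrrN.
set lam := complex.Re z in zreal; have nlam : `|lam| = rho A 0.
  by rewrite -nz zreal/= expr0n addr0 sqrtr_sqr.
have lam0 : lam != 0 by rewrite -normr_gt0 nlam (le_lt_trans rho1).
have [|P [B0 [D [uP PA chA]]]] := @eigen_block R n.+1 A lam _.
  by rewrite -root_toC -zreal.
pose B : 'M[R]_n.+1 := B0; pose D' : 'cV[R]_n.+1 := D.
have rB w : root (char_poly (toC B)) w -> Normc.normc w <= rho A 1.
  move=> rw; apply: Hrho; rewrite -root_prod_XsubC.
  suff -> : \prod_(w <- t) ('X - w%:P) = char_poly (toC B) by [].
  have zX : 'X - z%:P != 0 :> {poly C} by rewrite polyXsubC_eq0.
  apply: (mulfI zX); rewrite -[LHS](big_cons _ _ z t xpredT) -Ht -map_char_poly.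
  by rewrite chA rmorphM/= rmorphB/= map_polyX map_polyC/= -zreal map_char_poly.
pose r := (rho A 1 + rho A 0) / 2.
have r1 : rho A 1 < r by rewrite /r; lra.
have r2 : r < `|lam| by rewrite nlam /r; lra.
have r0 : 0 < r by rewrite (le_lt_trans rho1).
have [k k0 Hk] := real_power_decay r0 (fun w rw => le_lt_trans (rB w rw) r1).
have uB : lam%:M - B \in unitmx.
  rewrite -opprB -scaleN1r unitmxZ ?unitrN1// -row_free_unit -kermx_eq0.
  apply: contraTT isT => nB; have : eigenvalue B lam by [].
  rewrite eigenvalue_root_char -root_toC => /rB; rewrite -zreal nz => h.
  by rewrite leNgt prox in h.
(* The column [col_mx 1 X] is a right eigenvector of the block matrix; its equation
   [D' + B X = lam X] is solvable because [lam] is not an eigenvalue of [B]. *)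
pose X := invmx (lam%:M - B) *m D'.
have BX : D' + B *m X = lam *: X.
  have : (lam%:M - B) *m X = D' by rewrite /X mulKVmx.
  by rewrite mulmxBl mul_scalar_mx => /eqP; rewrite subr_eq => /eqP ->; rewrite addrC.
pose M : 'M[R]_(1 + n.+1) := block_mx lam%:M 0 D' B.
pose u0 : 'cV[R]_(1 + n.+1) := col_mx 1%:M X.
pose v0 : 'rV[R]_(1 + n.+1) := row_mx 1%:M 0.
(* The [m]-th power of the block matrix composed with the projection along [u0]: for [m = 0] it is
   [1 - u0 v0]. *)
pose E m : 'M[R]_(1 + n.+1) := col_mx 0 1%:M *m B ^+ m *m row_mx (- X) 1%:M.
have Mu : M *m u0 = lam *: u0.
  rewrite /M /u0 mul_block_col mul0mx addr0 !mulmx1 BX scale_col_mx.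
  by rewrite scalemx1.
have ME m : M *m E m = E m.+1.
  rewrite /E exprS !mulmxA; congr (_ *m _ *m _).
  by rewrite /M mul_block_col mul_col_mx !mulmx0 !mul0mx !add0r mul1mx mulmx1.
have PAm m : P *m A ^+ m = (lam ^+ m *: (u0 *m v0) + E m) *m P.
  elim: m => [|m IHm].
    rewrite /E !expr0 mulmx1 scale1r -[LHS]mul1mx; congr (_ *m _).
    rewrite mulmx1 /u0 /v0 !mul_col_row !mul1mx !mulmx1 !mulmx0 !mul0mx.
    by rewrite add_block_mx !addr0 !add0r subrr -scalar_mx_block.
  rewrite exprS mulmxA PA -mulmxA IHm mulmxA; congr (_ *m _).
  rewrite -/D' -/B -/M mulmxDr ME -scalemxAr mulmxA Mu -scalemxAl scalerA exprSr.
  by [].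
exists lam, (invmx P *m u0), (v0 *m P); split => //.
  rewrite mulmxA mulmxK// /v0 /u0 mul_row_col mul0mx addr0 mulmx1//.
exists (mxn (invmx P) * mxn (col_mx 0 1%:M : 'M[R]_(1 + n.+1, n.+1)) * k *
   mxn (row_mx (- X) 1%:M) * mxn P), (r / `|lam|).
split; first by rewrite !mulr_ge0// mxn_ge0.
  rewrite divr_ge0 ?(ltW r0)//= ltr_pdivrMr ?mul1r//.
  by rewrite normr_gt0.
move=> m.
have -> : lam ^- m *: A ^+ m - invmx P *m u0 *m (v0 *m P) =
    lam ^- m *: (invmx P *m E m *m P).
  rewrite -[A ^+ m](mulKmx uP) PAm mulmxDl -scalemxAl mulmxDr -scalemxAr scalerDr.
  rewrite scalerA mulVf ?expf_neq0// scale1r !mulmxA.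
  by rewrite addrAC subrr add0r.
rewrite mxnZ expr_div_n normrV ?unitfE ?expf_neq0// normrX.
rewrite mulrA [leRHS]mulrC ler_wpM2l ?invr_ge0 ?exprn_ge0//.
have -> : forall a b e f : R, a * b * k * e * f * r ^+ m = a * (b * (k * r ^+ m) * e) * f.
  by move=> a b e f; ring.
apply: le_trans (mxnM _ _) _; rewrite ler_wpM2r ?mxn_ge0//.
apply: le_trans (mxnM _ _) _; rewrite ler_wpM2l ?mxn_ge0//.
apply: le_trans (mxnM _ _) _; rewrite ler_wpM2r ?mxn_ge0//.
by apply: le_trans (mxnM _ _) _; rewrite ler_wpM2l ?mxn_ge0.
Qed.
End Spectrum.

Lemma geometric_lt (R : realType) (k c e : R) : 0 <= c < 1 -> 0 < e ->
  exists m0, forall m, (m0 <= m)%N -> k * c ^+ m < e.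
Proof.
move=> /andP[c0 c1] e0.
have /cvgrPdist_lt : (k * c ^+ m) @[m --> \oo] --> (0 : R).
  by rewrite -[X in _ --> X](mulr0 k); apply: cvgMr; apply: cvg_expr; rewrite ger0_norm.
move=> /(_ e e0)[m0 _ H]; exists m0 => m mm; have := H m mm.
by rewrite /= sub0r normrN; exact: le_lt_trans (ler_norm _).
Qed.

Section SpectralRadius.
Variable R : realType.
Local Notation C := R[i].
Local Notation toC := (map_mx (real_complex R)).

Lemma normc_root_le d (A : 'M[R]_d) z :
  root (char_poly (toC A)) z -> Normc.normc z <= mxn A.
Proof.
rewrite -eigenvalue_root_char => /eigenvalueP[v vA v0].
rewrite -lecR -normcP -mxn_toC -(ler_pM2r (x := mxn v)) ?mxn_gt0//.
by rewrite -mxnZ -vA mulrC mxnM.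
Qed.

Lemma rho0_root d (A : 'M[R]_d.+1) : exists2 z, root (char_poly (toC A)) z & rho A 0 = Normc.normc z.
Proof.
have [z [t [Ht _ nz _ _]]] := rho_split A.
by exists z; rewrite // Ht root_prod_XsubC mem_head.
Qed.

Lemma normc_root_le_rho d (A : 'M[R]_d.+1) z :
  root (char_poly (toC A)) z -> Normc.normc z <= rho A 0.
Proof.
have [z0 [t [Ht _ nz H _]]] := rho_split A.
by rewrite Ht root_prod_XsubC => /H.
Qed.

Lemma rho0_ge0 d (A : 'M[R]_d.+1) : 0 <= rho A 0.
Proof. by have [z _ ->] := rho0_root A; exact: normc_nonneg. Qed.

Lemma rho0_le_mxn d (A : 'M[R]_d.+1) : rho A 0 <= mxn A.
Proof. by have [z /normc_root_le rz ->] := rho0_root A. Qed.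

Lemma trace_le_rho0 d (A : 'M[R]_d.+1) : `|\tr A| <= d.+1%:R * rho A 0.
Proof.
have := coefPn_prod_XsubC (ps := eigenvalues A).
rewrite size_eigenvalues -eigenvaluesE char_poly_trace// => /(_ isT)/oppr_inj trE.
rewrite -lecR; have -> : (`|\tr A|%:C)%C = `|\sum_(z <- eigenvalues A) z|.
  rewrite -trE trace_map_mx normcP/= expr0n addr0 sqrtr_sqr//.
apply: le_trans (ler_norm_sum _ _ _) _.
apply: (@le_trans _ _ (\sum_(z <- eigenvalues A) (rho A 0)%:C%C)).
  rewrite big_seq [leRHS]big_seq; apply: ler_sum => z zA.
  by rewrite normcP lecR; apply: normc_root_le_rho; rewrite eigenvaluesE root_prod_XsubC.
by rewrite big_const_seq count_predT size_eigenvalues iter_addr_0 -rmorphMn/= mulr_natl.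
Qed.

(** Half of the spectral mapping theorem: [A ^+ m - w] is the product of the [A - z] over the [m]-th
    roots [z] of [w], so if it is singular, one of these factors is. *)
Lemma rho0_exp n (A : 'M[R]_n.+1) m : (0 < m)%N -> rho (A ^+ m) 0 <= rho A 0 ^+ m.
Proof.
move=> m0; have [w rw ->] := rho0_root (A ^+ m).
have [s Hs] := closed_field_poly_normal ('X^m - w%:P : {poly C}).
rewrite (monicP _) ?scale1r ?monicXnsubC// in Hs.
have : root (char_poly (toC (A ^+ m))) w by [].
rewrite -eigenvalue_root_char /eigenvalue/eigenspace kermx_eq0 row_free_unit => nu.
have : exists2 z, z \in s & root (char_poly (toC A)) z.
  apply: contrapT => H; move/negP: nu; apply.
  have -> : toC (A ^+ m) - w%:M = horner_mx (toC A) ('X^m - w%:P).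
    by rewrite [RHS]rmorphB/= [horner_mx _ _]rmorphXn/= horner_mx_X horner_mx_C -rmorphXn.
  rewrite Hs rmorph_prod big_seq; elim/big_rec: _ => [|z X zs uX]; first exact: unitmx1.
  rewrite [X in X \in _]/(_ *m _) unitmx_mul uX andbT rmorphB/= horner_mx_X horner_mx_C.
  apply: contrapT => nz; apply: H; exists z => //.
  by rewrite -eigenvalue_root_char /eigenvalue/eigenspace kermx_eq0 row_free_unit; apply/negP.
move=> [z zs rz]; have : root ('X^m - w%:P) z by rewrite Hs root_prod_XsubC.
rewrite /root !hornerE subr_eq0 => /eqP <-.
have -> : Normc.normc (z ^+ m) = Normc.normc z ^+ m.
  elim: {m0 rw Hs nu} m => [|m IHm]; first by rewrite !expr0 -[RHS](@Normc.normc1 R).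
  by rewrite !exprS Normc.normcM IHm.
by rewrite lerXn2r ?nnegrE ?normc_nonneg ?rho0_ge0// normc_root_le_rho.
Qed.

Lemma trace_exp_le n (A : 'M[R]_n.+1) m : (0 < m)%N ->
  `|\tr (A ^+ m)| <= n.+1%:R * rho A 0 ^+ m.
Proof.
move=> m0; apply: le_trans (trace_le_rho0 _) _.
by rewrite ler_wpM2l// rho0_exp.
Qed.

End SpectralRadius.

(** * Spectral gaps expressed by two-by-two minors *)

Section Minors.

Definition minor2 (K : pzRingType) n p (A : 'M[K]_(n, p)) a b k l : K :=
  A a k * A b l - A a l * A b k.

Definition wedge2 (K : pzRingType) n (u v : 'rV[K]_n) k l : K :=
  u 0 k * v 0 l - u 0 l * v 0 k.

Lemma wedge2_mulmx (K : comPzRingType) n p (u v : 'rV[K]_n) (A : 'M[K]_(n, p)) k l :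
  wedge2 (u *m A) (v *m A) k l =
  \sum_a \sum_b u 0 a * v 0 b * minor2 A a b k l.
Proof.
rewrite /wedge2 !mxE !big_distrlr/= -sumrB; apply: eq_bigr => a _.
by rewrite -sumrB; apply: eq_bigr => b _; rewrite /minor2; ring.
Qed.

End Minors.

Section ProximalCriterion.
Variable R : realType.
Local Notation C := R[i].
Local Notation toC := (map_mx (real_complex R)).

(* Equivalent to [rho A 1 < rho A 0], but built from countably many polynomial
   inequalities in the entries: this makes the event in (iii) measurable. *)
Definition minors_negligible n (A : 'M[R]_n.+2) := forall p, exists m0, forall m,
  (m0 <= m)%N -> forall a b k l,
  `|minor2 (A ^+ m) a b k l| * p.+1%:R < (\tr (A ^+ m)) ^+ 2.

(** The minors of a rank-one matrix vanish, so only terms containing [E] survive, and [mxn E <= 1]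
    makes the quadratic ones linear. *)
Lemma minor2_rank1D n (u : 'cV[R]_n) (v : 'rV[R]_n) (E : 'M[R]_n) a b k l :
  mxn E <= 1 ->
  `|minor2 (u *m v + E) a b k l| <= 2 * (2 * mxn (u *m v) + 1) * mxn E.
Proof.
move=> E1; set U := u *m v.
have UU x y : `|U x y| <= mxn U := le_mxn U x y.
have EE x y : `|E x y| <= mxn E := le_mxn E x y.
have U0 : U a k * U b l = U a l * U b k by rewrite /U !mxE !big_ord1; ring.
have -> : minor2 (U + E) a b k l =
  U a k * E b l + E a k * U b l + E a k * E b l - (U a l * E b k + E a l * U b k + E a l * E b k).
  rewrite /minor2 ![(U + E) _ _]mxE.
  transitivity (U a k * U b l - U a l * U b k + (U a k * E b l + E a k * U b l + E a k * E b l - (U a l * E b k + E a l * U b k + E a l * E b k))).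
    by ring.
  by rewrite U0 subrr add0r.
have H x y z t : `|U x y * E z t + E x y * U z t + E x y * E z t| <= (2 * mxn U + 1) * mxn E.
  rewrite (le_trans (ler_normD _ _))//.
  rewrite (le_trans (lerD (ler_normD _ _) (lexx _)))// !normrM.
  have : `|U x y| * `|E z t| <= mxn U * mxn E by rewrite ler_pM.
  have : `|E x y| * `|U z t| <= mxn E * mxn U by rewrite ler_pM.
  have : `|E x y| * `|E z t| <= 1 * mxn E by rewrite ler_pM// (le_trans (EE _ _)).
  lra.
have := ler_normB (U a k * E b l + E a k * U b l + E a k * E b l) (U a l * E b k + E a l * U b k + E a l * E b k).
have := H a k b l; have := H a l b k; have := H a k b l.
set X := _ + _ + _; set Y := U a l * _ + _ + _.
lra.
Qed.

(** After division by [lam ^+ m], the powers tend to the rank-one matrix [u *m v], whose minors are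
    0 and whose trace is [v *m u], that is 1. *)
Lemma proximal_minors n (A : 'M[R]_n.+2) : rho A 1 < rho A 0 -> minors_negligible A.
Proof.
move=> /proximal_power_limit[lam [u [v [lam0 vu [K [c [K0 c01 HE]]]]]]] p.
pose W := mxn (u *m v).
have W0 : 0 <= W by exact: mxn_ge0.
(* After rescaling, the factor 16 brings the left-hand side down to at most 1/16, while [e <= 1/2]
   keeps the squared trace at least 1/4. *)
pose e := (16 * (2 * W + 1) * p.+1%:R)^-1 / 2.
have p0 : 0 < p.+1%:R :> R by rewrite ltr0n.
have e0 : 0 < e by rewrite divr_gt0// invr_gt0 !mulr_gt0//; lra.
have e1 : e <= 2^-1.
  rewrite /e ler_piMl// invf_le1 ?mulr_gt0//; last lra.
  have p1 : 1 <= p.+1%:R :> R by rewrite ler1n.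
  rewrite -[leLHS]mulr1 ler_pM//; lra.
have [m0 Hm0] := geometric_lt K c01 e0.
exists m0 => m mm a b k l.
set E := lam ^- m *: A ^+ m - u *m v.
have Ee : mxn E < e by apply: le_lt_trans (HE m) (Hm0 m mm).
have Am : A ^+ m = lam ^+ m *: (u *m v + E).
  by rewrite /E addrC subrK scalerA mulfV ?scale1r// expf_neq0.
have -> : minor2 (A ^+ m) a b k l = (lam ^+ m) ^+ 2 * minor2 (u *m v + E) a b k l.
  have AmE i j : (A ^+ m) i j = lam ^+ m * (u *m v + E) i j by rewrite Am mxE.
  by rewrite /minor2 !AmE; ring.
have -> : (\tr (A ^+ m)) ^+ 2 = (lam ^+ m) ^+ 2 * (1 + \tr E) ^+ 2.
  rewrite Am linearZ/= exprMn mxtraceD; congr (_ * (_ + _) ^+ 2).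
  by rewrite mxtrace_mulC vu mxtrace1.
have l2 : 0 < (lam ^+ m) ^+ 2 by rewrite exprn_even_gt0//= expf_neq0.
rewrite normrM (ger0_norm (ltW l2)) -mulrA ltr_pM2l//.
have E0 := mxn_ge0 E.
have := minor2_rank1D (E := E) u v a b k l.
move=> /(_ ltac:(lra)) Hm.
have Ht : - e < \tr E by have := le_lt_trans (mxn_trace E) Ee; rewrite ltr_norml => /andP[].
have T : 1 / 4 <= (1 + \tr E) ^+ 2.
  have : 1 / 2 <= 1 + \tr E by lra.
  move=> h; have : (1 / 2) ^+ 2 <= (1 + \tr E) ^+ 2 by rewrite lerXn2r ?nnegrE//; lra.
  by apply: le_trans; rewrite expr2; lra.
apply: lt_le_trans T; apply: le_lt_trans (ler_wpM2r (ltW p0) Hm) _.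
have X : 0 < 2 * (2 * W + 1) * p.+1%:R by rewrite !mulr_gt0//; lra.
have -> : 2 * (2 * mxn (u *m v) + 1) * mxn E * p.+1%:R = 2 * (2 * W + 1) * p.+1%:R * mxn E.
  by rewrite /W; ring.
apply: lt_le_trans (_ : 2 * (2 * W + 1) * p.+1%:R * e <= _); first by rewrite ltr_pM2l.
rewrite /e -!(mulrA _ (2 * W + 1)); set y := (2 * W + 1) * p.+1%:R.
have y0 : y != 0 by rewrite gt_eqF// mulr_gt0//; lra.
have -> : 2 * y * ((16 * y)^-1 / 2) = 16^-1 by field.
lra.
Qed.

(** Two successive deflations. The vector [v2] is an eigenvector only modulo [v1], so that a Jordan
    block with [z1 = z2] is covered too. *)
Lemma left_flag (F : fieldType) n (A : 'M[F]_n.+1) z1 z2 t :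
  char_poly A = \prod_(w <- [:: z1, z2 & t]) ('X - w%:P) ->
  exists (v1 v2 : 'rV[F]_n.+1) c, [/\ v1 *m A = z1 *: v1,
    v2 *m A = z2 *: v2 + c *: v1 &
    exists k l, wedge2 v1 v2 k l != 0].
Proof.
move=> chA; have [|P [B [D [uP PA]]]] := @eigen_block F n A z1 _.
  by rewrite chA root_prod_XsubC mem_head.
rewrite chA big_cons => /mulfI; rewrite polyXsubC_eq0 => /(_ isT) chB.
have : root (char_poly B) z2 by rewrite -chB root_prod_XsubC mem_head.
rewrite -eigenvalue_root_char => /eigenvalueP[w wB w0].
pose e1 : 'rV[F]_(1 + n) := row_mx 1%:M 0; pose e2 : 'rV[F]_(1 + n) := row_mx 0 w.
exists (e1 *m P), (e2 *m P), ((w *m D) 0 0); split.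
- rewrite -mulmxA PA mulmxA /e1 mul_row_block mul1mx !mul0mx mul1mx !addr0.
  by rewrite scalemxAl scale_row_mx scaler0 scalemx1.
- rewrite -mulmxA PA mulmxA /e1 /e2 mul_row_block !mul0mx !add0r wB.
  rewrite !scalemxAl -mulmxDl !scale_row_mx !scaler0 add_row_mx addr0 add0r.
  by rewrite scalemx1 -mx11_scalar.
- apply: contrapT => H; move/eqP: w0; apply.
  have H0 k l : (e1 *m P) 0 k * (e2 *m P) 0 l = (e1 *m P) 0 l * (e2 *m P) 0 k.
    apply/eqP; rewrite -subr_eq0; apply/negPn/negP => N; apply: H; exists k, l.
    exact: N.
  have : e1 *m P != 0.
    apply/eqP => eP; have : e1 = 0 by rewrite -(mulmxK uP e1) eP mul0mx.
    move/rowP/(_ (lshift n 0)); rewrite row_mxEl !mxE => /eqP; apply/negP.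
    exact: oner_neq0.
  move=> /rV0Pn[l el]; pose c := (e2 *m P) 0 l / (e1 *m P) 0 l.
  have E : e2 *m P = c *: (e1 *m P).
    apply/rowP => k; rewrite [RHS]mxE /c; apply: (mulIf el).
    rewrite mulrAC divfK// [RHS]mulrC H0.
    by rewrite mulrC.
  have : e2 = c *: e1 by rewrite -(mulmxK uP e2) E -scalemxAl mulmxK.
  move=> e21; apply/rowP => k; have /rowP/(_ (rshift 1 k)) := e21.
  by rewrite /e2 /e1 scale_row_mx scaler0 !row_mxEr !mxE.
Qed.

(** If the two largest moduli both equal [r], the exterior product of [v1] and [v2] is multiplied by
    [(z1 * z2) ^+ m], of modulus [r ^+ (2 * m)]. Some minors of [A ^+ m] are then at least of the
    order of the largest possible squared trace. When [r = 0] the trace of a power is 0 and the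
    strict inequality fails outright. *)
Lemma minors_proximal n (A : 'M[R]_n.+2) : minors_negligible A -> rho A 1 < rho A 0.
Proof.
move=> HA; rewrite ltNge; apply/negP => r01.
have [t pt [te _]] := eig_moduli_sorted A.
have := perm_size pt; rewrite size_eigenvalues.
case: t => [//|z1 [//|z2 t]] in pt te * => _.
have n1 : Normc.normc z1 = rho A 0 by rewrite /rho te.
have n2 : Normc.normc z2 = rho A 0.
  apply/eqP; rewrite eq_le normc_root_le_rho/=; first by move: r01; rewrite {2}/rho te.
  by rewrite eigenvaluesE (perm_big _ pt)/= root_prod_XsubC !inE eqxx orbT.
have [|v1 [v2 [c [v1A v2A [k [l kl]]]]]] := @left_flag _ n.+1 (toC A) z1 z2 t.
  by rewrite eigenvaluesE; exact: perm_big.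
have v1Am m : v1 *m toC A ^+ m = z1 ^+ m *: v1.
  elim: m => [|m IHm]; first by rewrite !expr0 mulmx1 scale1r.
  by rewrite exprSr mulmxA IHm -scalemxAl v1A scalerA exprSr.
have v2Am m : exists c, v2 *m toC A ^+ m = z2 ^+ m *: v2 + c *: v1.
  elim: m => [|m [cm IHm]]; first by exists 0; rewrite !expr0 mulmx1 scale1r scale0r addr0.
  exists (z2 ^+ m * c + cm * z1); rewrite exprSr mulmxA IHm mulmxDl -!scalemxAl v1A v2A.
  by rewrite scalerDr !scalerA exprSr scalerDl addrA.
pose r := rho A 0; have r0 : 0 <= r by exact: rho0_ge0.
pose N := mxn v1 * mxn v2.
pose mu := wedge2 v1 v2 k l.
have key p m : (forall a b k l,
    `|minor2 (A ^+ m) a b k l| * p.+1%:R < (\tr (A ^+ m)) ^+ 2) -> (0 < m)%N ->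
    ((r ^+ 2) ^+ m)%:C%C * `|mu| * p.+1%:R <= N * ((n.+2%:R * r ^+ m) ^+ 2)%:C%C.
  move=> Hm m0.
  have tm : (\tr (A ^+ m)) ^+ 2 <= (n.+2%:R * r ^+ m) ^+ 2.
    rewrite -[leLHS]real_normK ?num_real// lerXn2r ?nnegrE//.
      by rewrite mulr_ge0// exprn_ge0.
    exact: trace_exp_le.
  have [cm Ecm] := v2Am m.
  have E0 : wedge2 (v1 *m toC A ^+ m) (v2 *m toC A ^+ m) k l = (z1 * z2) ^+ m * mu.
    by rewrite v1Am Ecm /mu /wedge2 !mxE exprMn; ring.
  have -> : ((r ^+ 2) ^+ m)%:C%C * `|mu| = `|(z1 * z2) ^+ m * mu|.
    by rewrite normrM normrX normrM !normcP n1 n2 -/r -expr2 !rmorphXn.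
  rewrite -E0 wedge2_mulmx.
  have p0 : 0 <= p.+1%:R :> C by rewrite ler0n.
  apply: le_trans (ler_wpM2r p0 (ler_norm_sum _ _ _)) _.
  rewrite mulr_suml /N /mxn !big_ord1 mulr_suml mulr_suml; apply: ler_sum => a _.
  apply: le_trans (ler_wpM2r p0 (ler_norm_sum _ _ _)) _.
  rewrite mulr_suml mulr_sumr mulr_suml; apply: ler_sum => b _.
  rewrite !normrM -!mulrA ler_wpM2l// ler_wpM2l//.
  have -> : minor2 (toC A ^+ m) a b k l = (minor2 (A ^+ m) a b k l)%:C%C.
    by rewrite -rmorphXn/= /minor2 !mxE !rmorphB/= !rmorphM.
  rewrite normcP/= expr0n addr0 sqrtr_sqr -(rmorph_nat (real_complex R)) -rmorphM lecR.
  exact: le_trans (ltW (Hm _ _ _ _)) tm.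
have [r_eq0|r_neq0] := eqVneq r 0.
  have [m0 /(_ m0.+1 (leqnSn _) 0 0 0 0) H0] := HA 0%N.
  have := trace_exp_le A (ltn0Sn m0); rewrite -/r r_eq0 expr0n/= mulr0 normr_le0.
  move=> /eqP tr0; move: H0; rewrite tr0 expr0n/= ltNge mulr_ge0//.
have r_gt0 : 0 < r by rewrite lt_def r_neq0.
have N0 : 0 <= N by rewrite mulr_ge0// mxn_ge0.
have Nre : N = (complex.Re N)%:C%C by rewrite RRe_real// ger0_real.
have mu0 : 0 < Normc.normc mu.
  by rewrite lt_def normc_nonneg andbT; apply: contra kl => /eqP/Normc.eq0_normc h; rewrite -/mu h.
pose x := complex.Re N * n.+2%:R ^+ 2 / Normc.normc mu.
have [m0 Hm0] := HA (Num.truncn x).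
have := key (Num.truncn x) (maxn m0 1) (Hm0 _ (leq_maxl _ _)) (leq_maxr _ _).
rewrite Nre normcP -(rmorph_nat (real_complex R)) -!rmorphM lecR.
rewrite -!exprM mulnC exprM; set q := r ^+ _.
have q0 : 0 < q ^+ 2 by rewrite !exprn_gt0.
rewrite exprMn mulrA -mulrA [leRHS]mulrC ler_pM2l// mulrC -ler_pdivlMr// -/x.
by rewrite leNgt truncnS_gt.
Qed.

End ProximalCriterion.

(** * The space of matrix sequences *)

Section MeasurableQuantifiers.
Context (dT : measure_display) (T : measurableType dT).

Lemma measurable_exists (I : countType) (Q : I -> T -> Prop) :
  (forall i, measurable [set x | Q i x]) -> measurable [set x | exists i, Q i x].
Proof.
move=> mQ; have -> : [set x | exists i, Q i x] = \bigcup_i [set x | Q i x].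
  by apply/seteqP; split=> [x [i Qx]|x [i _ Qx]]; exists i.
exact: countable_bigcupT_measurable.
Qed.

Lemma measurable_not (Q : T -> Prop) :
  measurable [set x | Q x] -> measurable [set x | ~ Q x].
Proof. exact: measurableC. Qed.

Lemma measurable_forall (I : countType) (Q : I -> T -> Prop) :
  (forall i, measurable [set x | Q i x]) -> measurable [set x | forall i, Q i x].
Proof.
move=> mQ; have -> : [set x | forall i, Q i x] = ~` [set x | exists i, ~ Q i x].
  apply/seteqP; split=> [x Qx [k nk] | x nQ i]; first exact: nk (Qx k).
  by apply: contrapT => nQi; apply: nQ; exists i.
by apply: measurableC; apply: measurable_exists => i; exact: measurable_not.
Qed.

Lemma measurable_imply (Q0 : Prop) (Q : T -> Prop) :
  (Q0 -> measurable [set x | Q x]) -> measurable [set x | Q0 -> Q x].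
Proof.
have [q|nq] := pselect Q0.
  move=> /(_ q) mQ; suff -> : [set x | Q0 -> Q x] = [set x | Q x] by [].
  by apply/seteqP; split=> x; [exact|move=> ? ?].
move=> _; suff -> : [set x | Q0 -> Q x] = setT by exact: measurableT.
by apply/seteqP; split=> // x _ /nq.
Qed.

End MeasurableQuantifiers.

Section SequenceSpace.
Variables (R : realType) (d : nat).
Local Notation mat := 'M[R]_d.

Definition rect (m : nat) (A : nat -> 'I_d -> 'I_d -> set R) : set (nat -> mat) :=
  [set x | forall n, (n < m)%N -> forall i j, A n i j (x n i j)].

(** The pi-system of cylinders, on which independence and equality of laws are assumed; a measure on
    [mseq] is determined by its values there. *)
Definition rects : set (set (nat -> mat)) :=
  [set S | exists m A, (forall n i j, measurable (A n i j)) /\ S = rect m A].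

Definition mseq := g_sigma_algebraType rects.

HB.instance Definition _ := Measurable.copy mseq (g_sigma_algebraType rects).

Lemma rects_setI : setI_closed rects.
Proof.
move=> _ _ [m [A [mA ->]]] [p [B [mB ->]]].
exists (maxn m p), (fun n i j => (if (n < m)%N then A n i j else setT) `&`
   (if (n < p)%N then B n i j else setT)); split.
  by move=> n i j; apply: measurableI; case: ifP.
apply/seteqP; split=> [x [Ax Bx] n nmp i j|x H].
  split; case: ifP => // h; [exact: Ax|exact: Bx].
split=> n nlt i j.
  by have := H n; rewrite leq_max nlt => /(_ isT i j) [].
by have := H n; rewrite leq_max nlt orbT => /(_ isT i j) [].
Qed.

Lemma rects_setT : rects setT.
Proof. by exists 0%N, (fun _ _ _ => setT); split=> //; apply/seteqP; split. Qed.

Lemma measurable_rect m A : (forall n i j, measurable (A n i j)) ->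
  measurable (rect m A : set mseq).
Proof. by move=> mA; apply: sub_sigma_algebra; exists m, A. Qed.

Lemma measurable_coord n i j : measurable_fun setT (fun x : mseq => x n i j).
Proof.
move=> _ B mB; rewrite setTI.
pose A k a b := if [&& k == n, a == i & b == j] then B else setT.
have -> : (fun x : mseq => x n i j) @^-1` B = rect n.+1 A.
  apply/seteqP; split=> [x Bx k kn a b|x H].
    by rewrite /A; case: ifP => // /and3P[/eqP-> /eqP-> /eqP->].
  by have := H n (ltnSn n) i j; rewrite /A !eqxx.
by apply: measurable_rect => k a b; rewrite /A; case: ifP.
Qed.

Lemma measurable_mseq (dT : measure_display) (T : measurableType dT) (X : T -> mseq) :
  (forall n i j, measurable_fun setT (fun w => X w n i j)) -> measurable_fun setT X.
Proof.
move=> mX; apply: (@measurability _ _ T mseq setT X rects) => // _ [_ [m [A [mA ->]]] <-].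
rewrite setTI.
apply: measurable_forall => n; apply: measurable_imply => nm.
apply: measurable_forall => i; apply: measurable_forall => j.
by rewrite -[[set x | _]]setTI; exact: mX.
Qed.

Definition catn n (x y : mseq) : mseq := fun k => if (k < n)%N then x k else y (k - n)%N.

Lemma measurable_catn n : measurable_fun setT (fun p : mseq * mseq => catn n p.1 p.2).
Proof.
apply: measurable_mseq => k i j; rewrite /catn; case: (k < n)%N.
  exact: (measurableT_comp (measurable_coord k i j) (@measurable_fst _ _ mseq mseq)).
exact: (measurableT_comp (measurable_coord (k - n) i j) (@measurable_snd _ _ mseq mseq)).
Qed.

Lemma catn_rect n m A : (fun p : mseq * mseq => catn n p.1 p.2) @^-1` rect m A =
  rect (minn n m) A `*` rect (m - n) (fun k => A (n + k)%N).
Proof.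
apply/seteqP; split=> [[x y]/= H|[x y]/= [Hx Hy] k km i j].
  split=> k.
    rewrite leq_min => /andP[kn km] i j; have := H k km i j.
    by rewrite /catn kn.
  rewrite ltn_subRL => km i j; have := H (n + k)%N km i j.
  by rewrite /catn ltnNge leq_addr/= addKn.
rewrite /catn; case: ifP => kn; first by apply: Hx; rewrite leq_min kn.
have nk : (n <= k)%N by rewrite leqNgt kn.
have := Hy (k - n)%N _ i j; rewrite subnKC//; apply.
by rewrite ltn_sub2r// (leq_ltn_trans nk).
Qed.

Section Law.
Context (dT : measure_display) (T : measurableType dT) (P : probability T R).
Variable g : nat -> T -> mat.
Hypothesis Hiid : iid_matrices P g.

Definition traj (w : T) : mseq := fun n => g n w.

Lemma measurable_traj : measurable_fun setT traj.
Proof. by case: Hiid => mg _ _; apply: measurable_mseq. Qed.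

HB.instance Definition _ := isMeasurableFun.Build _ _ _ _ traj measurable_traj.

Definition law : probability mseq R := distribution P traj.

Lemma law_rect m A : (forall n i j, measurable (A n i j)) ->
  law (rect m A) = (\prod_(0 <= n < m) P (mat_event (g 0%N) (A n)))%E.
Proof.
case: Hiid => mg indep idd mA.
have -> : law (rect m A) = P (\bigcap_(n in [set` index_iota 0 m]) mat_event (g n) (A n)).
  congr (P _); apply/seteqP; split=> [w H n /=|w H n nm].
    by rewrite mem_index_iota/= => nm i j; exact: H.
  by move=> i j; apply: H; rewrite /= mem_index_iota.
rewrite indep ?iota_uniq//.
by apply: eq_bigr => n _; exact: idd.
Qed.

(** Both sides agree on cylinders by the product rule, hence everywhere. This identity, an
    independent trajectory grafted after [n] factors again has the same law, carries all the
    independence and stationarity used later. *)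
Lemma law_catn n A : measurable A ->
  law A = (law \x law)%E ((fun p : mseq * mseq => catn n p.1 p.2) @^-1` A).
Proof.
move=> mA.
have mc : measurable_fun setT (fun p : mseq * mseq => catn n p.1 p.2) := measurable_catn n.
pose q : {measure set mseq -> \bar R} := pushforward (law \x law)%E (fun p : mseq * mseq => catn n p.1 p.2).
rewrite -[RHS]/(q mc A).
apply: (@measure_unique _ R mseq rects (fun=> setT) _ _ _ _ law (q mc)) => //.
- exact: rects_setI.
- by move=> _; exact: rects_setT.
- by rewrite bigcup_const//; exists 0%N.
- move=> _ [m [B [mB ->]]]; rewrite /q/= /pushforward catn_rect.
  have -> : (law \x law)%E (rect (minn n m) B `*` rect (m - n) (fun k => B (n + k)%N)) =
      (law (rect (minn n m) B) * law (rect (m - n) (fun k => B (n + k)%N)))%E.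
    by rewrite product_measure1E; [|exact: measurable_rect|exact: measurable_rect].
  rewrite !law_rect//.
  have [nm|mn] := leqP n m.
    rewrite (@big_cat_nat _ _ _ n)//=; congr (_ * _)%E.
    rewrite -[in LHS](add0n n) big_addn.
    by apply: eq_bigr => k _; rewrite addnC.
  have -> : (m - n = 0)%N by apply/eqP; rewrite subn_eq0 ltnW.
  by rewrite [X in (_ * X)%E]big_geq// mule1.
- by move=> _; apply: (@le_lt_trans _ _ 1%E); rewrite ?ltry//; exact: (@probability_le1 _ _ _ law).
Qed.

End Law.
End SequenceSpace.

(** * Measurability of matrix-valued maps *)

Section RealMeasurability.
Context (dT : measure_display) (T : measurableType dT) (R : realType).
Implicit Types f g : T -> R.

Lemma measurable_set_ltr f g : measurable_fun setT f -> measurable_fun setT g ->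
  measurable [set x | f x < g x].
Proof.
move=> mf mg; have := measurable_fun_ltr mf mg.
by move=> /(_ measurableT [set true]); rewrite setTI; apply.
Qed.

Lemma measurable_set_ler f g : measurable_fun setT f -> measurable_fun setT g ->
  measurable [set x | f x <= g x].
Proof.
move=> mf mg; have := measurable_fun_ler mf mg.
by move=> /(_ measurableT [set true]); rewrite setTI; apply.
Qed.

Lemma measurable_set_eqr f g : measurable_fun setT f -> measurable_fun setT g ->
  measurable [set x | f x = g x].
Proof.
move=> mf mg.
have -> : [set x | f x = g x] = [set x | f x <= g x] `&` [set x | g x <= f x].
  apply/seteqP; split=> x /=; first by move=> ->.
  by move=> [h1 h2]; apply/eqP; rewrite eq_le h1.
by apply: measurableI; exact: measurable_set_ler.
Qed.

Lemma measurable_natr_bool (b : T -> bool) : measurable_fun setT b ->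
  measurable_fun setT (fun x => (b x)%:R : R).
Proof.
move=> mb; have -> : (fun x => (b x)%:R : R) = (fun x => if b x then 1 else 0).
  by apply/funext => x; case: (b x).
by apply: measurable_fun_ifT.
Qed.

Definition mxmeasurable m n (F : T -> 'M[R]_(m, n)) :=
  forall i j, measurable_fun setT (fun x => F x i j).

Lemma mxmeasurable_cst m n (A : 'M[R]_(m, n)) : mxmeasurable (fun=> A).
Proof. by move=> i j; exact: measurable_cst. Qed.

Lemma mxmeasurableM m n p (F : T -> 'M[R]_(m, n)) (G : T -> 'M[R]_(n, p)) :
  mxmeasurable F -> mxmeasurable G -> mxmeasurable (fun x => F x *m G x).
Proof.
move=> mF mG i j.
have -> : (fun x => (F x *m G x) i j) = (fun x => \sum_k F x i k * G x k j).
  by apply/funext => x; rewrite mxE.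
by apply: measurable_sum => k; exact: measurable_funM.
Qed.

Lemma mxmeasurableD m n (F G : T -> 'M[R]_(m, n)) :
  mxmeasurable F -> mxmeasurable G -> mxmeasurable (fun x => F x + G x).
Proof.
move=> mF mG i j.
have -> : (fun x => (F x + G x) i j) = (fun x => F x i j + G x i j).
  by apply/funext => x; rewrite mxE.
exact: measurable_funD.
Qed.

Lemma mxmeasurableZ m n (f : T -> R) (F : T -> 'M[R]_(m, n)) :
  measurable_fun setT f -> mxmeasurable F -> mxmeasurable (fun x => f x *: F x).
Proof.
move=> mf mF i j.
have -> : (fun x => (f x *: F x) i j) = (fun x => f x * F x i j).
  by apply/funext => x; rewrite mxE.
exact: measurable_funM.
Qed.

Lemma measurable_mxn m n (F : T -> 'M[R]_(m, n)) :
  mxmeasurable F -> measurable_fun setT (fun x => mxn (F x)).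
Proof.
move=> mF; apply: measurable_sum => i; apply: measurable_sum => j.
exact: measurableT_comp.
Qed.

Lemma measurable_mxtrace n (F : T -> 'M[R]_n) :
  mxmeasurable F -> measurable_fun setT (fun x => \tr (F x)).
Proof. by move=> mF; apply: measurable_sum. Qed.

Lemma measurable_det n (F : T -> 'M[R]_n) :
  mxmeasurable F -> measurable_fun setT (fun x => \det (F x)).
Proof.
move=> mF; apply: measurable_sum => s.
by apply: measurable_funM; [exact: measurable_cst|apply: measurable_prod].
Qed.

(** Power functions invert nonnegative numbers measurably, so the inverse of [f] is written as [f]
    times the inverse of its square, which also gives the conventional value 0 at 0. *)
Lemma measurable_invr f : measurable_fun setT f -> measurable_fun setT (fun x => (f x)^-1).
Proof.
move=> mf.
have -> : (fun x => (f x)^-1) = (fun x => f x * (f x ^+ 2) `^ (-1)).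
  apply/funext => x; have [->|fx] := eqVneq (f x) 0; first by rewrite invr0 mul0r.
  by rewrite powR_inv1 ?sqr_ge0// expr2 invfM mulrA mulfV// mul1r.
apply: measurable_funM => //.
apply: (@measurableT_comp _ _ _ _ _ _ (fun y : R => y `^ (-1)) setT (fun x => f x ^+ 2)).
  exact: measurable_powR.
exact: measurable_funX.
Qed.

Lemma measurable_unitmx n (F : T -> 'M[R]_n) : mxmeasurable F ->
  measurable_fun setT (fun x => F x \in unitmx).
Proof.
move=> mF.
have -> : (fun x => F x \in unitmx) = (fun x => ~~ (\det (F x) == 0)).
  by apply/funext => x; rewrite unitmxE unitfE.
apply: measurable_neg.
apply: (@measurable_fun_eqr _ _ _ setT (fun x => \det (F x)) (fun=> 0)).
  exact: measurable_det.
exact: measurable_cst.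
Qed.

(** Cramer's rule on invertible matrices; on singular ones [invmx] returns its argument by
    convention. *)
Lemma mxmeasurable_invmx n (F : T -> 'M[R]_n) :
  mxmeasurable F -> mxmeasurable (fun x => invmx (F x)).
Proof.
move=> mF i j.
have -> : (fun x => invmx (F x) i j) =
   (fun x => if F x \in unitmx then (\det (F x))^-1 * cofactor (F x) j i else F x i j).
  by apply/funext => x; rewrite /invmx; case: ifP => // _; rewrite !mxE.
apply: measurable_fun_ifT => //; first exact: measurable_unitmx.
apply: measurable_funM; first exact/measurable_invr/measurable_det.
apply: measurable_funM; first exact: measurable_cst.
apply: measurable_det => k l.
have -> : (fun x => row' j (col' i (F x)) k l) = (fun x => F x (lift j k) (lift i l)).
  by apply/funext => x; rewrite !mxE.
exact: mF.
Qed.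

End RealMeasurability.

(** Makes the lemmas on iterated monoid laws, such as splitting off the last factor, available for
    [mprod]. *)
HB.instance Definition _ (K : pzRingType) n :=
  Monoid.isLaw.Build 'M[K]_n 1%:M mulmx (@mulmxA K n n n n) (@mul1mx K n n) (@mulmx1 K n n).

Section ProductMeasurability.
Variables (R : realType) (d : nat).

Lemma mprod_recr n (x : nat -> 'M[R]_d) : mprod x n.+1 = mprod x n *m x n.
Proof. by rewrite /mprod big_ord_recr. Qed.

Lemma mprod0 (x : nat -> 'M[R]_d) : mprod x 0 = 1%:M.
Proof. by rewrite /mprod big_ord0. Qed.

Definition shiftn n (x : mseq R d) : mseq R d := fun k => x (n + k)%N.

Lemma mprodD n m (x : mseq R d) : mprod x (n + m) = mprod x n *m mprod (shiftn n x) m.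
Proof.
elim: m => [|m IHm]; first by rewrite addn0 mprod0 mulmx1.
by rewrite addnS !mprod_recr IHm mulmxA.
Qed.

Lemma eq_mprod n (x y : nat -> 'M[R]_d) : (forall k, (k < n)%N -> x k = y k) ->
  mprod x n = mprod y n.
Proof. by move=> H; apply: eq_bigr => i _; exact: H. Qed.

Lemma mprod_catn n m (x y : mseq R d) : (m <= n)%N -> mprod (catn n x y) m = mprod x m.
Proof.
by move=> mn; apply: eq_mprod => k km; rewrite /catn (leq_trans km mn).
Qed.

Lemma shiftn_catn n (x y : mseq R d) : shiftn n (catn n x y) = y.
Proof.
by apply/funext => k; rewrite /shiftn /catn ltnNge leq_addr/= addKn.
Qed.

Lemma shiftnD n m (x : mseq R d) : shiftn (n + m) x = shiftn m (shiftn n x).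
Proof. by apply/funext => k; rewrite /shiftn addnA. Qed.

Lemma mxmeasurable_coord n : mxmeasurable (fun x : mseq R d => x n).
Proof. by move=> i j; exact: measurable_coord. Qed.

Lemma mxmeasurable_mprod n : mxmeasurable (fun x : mseq R d => mprod x n).
Proof.
elim: n => [|n IHn].
  have -> : (fun x : mseq R d => mprod x 0) = (fun=> 1%:M) by apply/funext => x; exact: mprod0.
  exact: mxmeasurable_cst.
have -> : (fun x : mseq R d => mprod x n.+1) = (fun x => mprod x n *m x n).
  by apply/funext => x; exact: mprod_recr.
by apply: mxmeasurableM => //; exact: mxmeasurable_coord.
Qed.

Lemma measurable_shiftn n : measurable_fun setT (@shiftn n).
Proof. by apply: measurable_mseq => k i j; exact: measurable_coord. Qed.

Lemma measurable_catn1 n (y : mseq R d) : measurable_fun setT (fun x => catn n x y).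
Proof.
apply: measurable_mseq => k i j; rewrite /catn; case: (k < n)%N.
  exact: measurable_coord.
exact: measurable_cst.
Qed.

Lemma measurable_catn2 n (x : mseq R d) : measurable_fun setT (catn n x).
Proof.
apply: measurable_mseq => k i j; rewrite /catn; case: (k < n)%N.
  exact: measurable_cst.
exact: measurable_coord.
Qed.

End ProductMeasurability.

Lemma integral_cst_prob (dT : measure_display) (T : measurableType dT) (R : realType)
  (P : probability T R) (c : \bar R) : (\int[P]_x c = c)%E.
Proof. by rewrite integral_cst//= probability_setT mule1. Qed.

(** * Conditioning on the first factors or on the later ones *)

Section Concatenation.
Variables (R : realType) (d : nat) (nu : probability (mseq R d) R).
Hypothesis nu_catn : forall n A, measurable A ->
  nu A = (nu \x nu)%E ((fun p : mseq R d * mseq R d => catn n p.1 p.2) @^-1` A).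
Local Open Scope ereal_scope.

Lemma integral_catn1 n (f : mseq R d -> \bar R) : measurable_fun setT f ->
  (forall x, 0 <= f x) ->
  \int[nu]_z f z = \int[nu]_x \int[nu]_y f (catn n x y).
Proof.
move=> mf f0; have mc : measurable_fun setT (fun p : mseq R d * mseq R d => catn n p.1 p.2) := measurable_catn n.
rewrite -(fubini_tonelli1 (fun p => f (catn n p.1 p.2)))//; last exact: measurableT_comp.
rewrite -(@ge0_integral_pushforward _ _ _ _ _ _ mc _ setT f)//.
by apply: eq_measure_integral => A mA _; exact: nu_catn.
Qed.

Lemma integral_catn2 n (f : mseq R d -> \bar R) : measurable_fun setT f ->
  (forall x, 0 <= f x) ->
  \int[nu]_z f z = \int[nu]_y \int[nu]_x f (catn n x y).
Proof.
move=> mf f0; rewrite (integral_catn1 n)//.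
rewrite (fubini_tonelli (fun p => f (catn n p.1 p.2)))//.
by apply: measurableT_comp => //; exact: measurable_catn.
Qed.

Lemma measurable_integral_catn1 n (f : mseq R d -> \bar R) : measurable_fun setT f ->
  (forall x, 0 <= f x) -> measurable_fun setT (fun x => \int[nu]_y f (catn n x y)).
Proof.
move=> mf f0; apply: (measurable_fun_fubini_tonelli_F (fun p => f (catn n p.1 p.2))) => //.
by apply: measurableT_comp => //; exact: measurable_catn.
Qed.

Lemma measurable_integral_catn2 n (f : mseq R d -> \bar R) : measurable_fun setT f ->
  (forall x, 0 <= f x) -> measurable_fun setT (fun y => \int[nu]_x f (catn n x y)).
Proof.
move=> mf f0; apply: (measurable_fun_fubini_tonelli_G (fun p => f (catn n p.1 p.2))) => //.
by apply: measurableT_comp => //; exact: measurable_catn.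
Qed.

(** A conditional expectation given the first [n] factors, written as an inner integral;
    [integral_catn2_le] conditions on all later factors instead. The exponential moment estimates
    proceed by these two. *)
Lemma integral_catn1_le n (f : mseq R d -> \bar R) (c : \bar R) h :
  measurable_fun setT f -> (forall x, 0 <= f x) -> 0 <= c ->
  measurable_fun setT h -> (forall x, 0 <= h x) ->
  (forall x, \int[nu]_y f (catn n x y) <= c * h x) ->
  \int[nu]_z f z <= c * \int[nu]_x h x.
Proof.
move=> mf f0 c0 mh h0 H; rewrite (integral_catn1 n)// -ge0_integralZl//; last first.
apply: ge0_le_integral => //.
- by move=> x _; exact: integral_ge0.
- exact: measurable_integral_catn1.
- by apply: emeasurable_funM => //; exact: measurable_cst.
Qed.

Lemma integral_catn2_le n (f : mseq R d -> \bar R) (c : \bar R) h :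
  measurable_fun setT f -> (forall x, 0 <= f x) -> 0 <= c ->
  measurable_fun setT h -> (forall x, 0 <= h x) ->
  (forall y, \int[nu]_x f (catn n x y) <= c * h y) ->
  \int[nu]_z f z <= c * \int[nu]_y h y.
Proof.
move=> mf f0 c0 mh h0 H; rewrite (integral_catn2 n)// -ge0_integralZl//; last first.
apply: ge0_le_integral => //.
- by move=> x _; exact: integral_ge0.
- exact: measurable_integral_catn2.
- by apply: emeasurable_funM => //; exact: measurable_cst.
Qed.

Lemma integral_shiftn n (f : mseq R d -> \bar R) : measurable_fun setT f ->
  (forall x, 0 <= f x) -> \int[nu]_x f (shiftn n x) = \int[nu]_x f x.
Proof.
move=> mf f0; rewrite (integral_catn1 n)//; last first.
  by apply: measurableT_comp => //; exact: measurable_shiftn.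
under eq_integral do under eq_integral do rewrite shiftn_catn.
exact: integral_cst_prob.
Qed.

Lemma prob_catn1_le n (A : set (mseq R d)) c : measurable A -> 0 <= c ->
  (forall x, nu [set y | A (catn n x y)] <= c) -> nu A <= c.
Proof.
move=> mA c0 H.
rewrite (_ : nu A = \int[nu]_x (\1_A x)%:E); last by rewrite integral_indic// setIT.
rewrite -[leRHS]mule1 -(integral_cst_prob nu 1).
apply: (@integral_catn1_le n) => //.
- by apply/measurable_EFinP; exact: measurable_indic.
- move=> x; rewrite mule1; apply: le_trans (H x).
  rewrite -[X in nu X]setIT -integral_indic//.
  by rewrite -[X in measurable X]setTI; apply: measurable_catn2.
Qed.

Lemma prob_catn2_le n (A : set (mseq R d)) c : measurable A -> 0 <= c ->
  (forall y, nu [set x | A (catn n x y)] <= c) -> nu A <= c.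
Proof.
move=> mA c0 H.
rewrite (_ : nu A = \int[nu]_x (\1_A x)%:E); last by rewrite integral_indic// setIT.
rewrite -[leRHS]mule1 -(integral_cst_prob nu 1).
apply: (@integral_catn2_le n) => //.
- by apply/measurable_EFinP; exact: measurable_indic.
- move=> x; rewrite mule1; apply: le_trans (H x).
  rewrite -[X in nu X]setIT -integral_indic//.
  by rewrite -[X in measurable X]setTI; apply: measurable_catn1.
Qed.

Lemma prob_shiftn n (A : set (mseq R d)) : measurable A ->
  nu [set x | A (shiftn n x)] = nu A.
Proof.
move=> mA.
have mA' : measurable [set x | A (shiftn n x)].
  by rewrite -[X in measurable X]setTI; apply: measurable_shiftn.
rewrite [RHS](_ : nu A = \int[nu]_x (\1_A x)%:E); last by rewrite integral_indic// setIT.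
rewrite -[RHS](integral_shiftn n)//; last by apply/measurable_EFinP; exact: measurable_indic.
by rewrite -[X in nu X]setIT -integral_indic.
Qed.

End Concatenation.

(** * A one-sided strong law of large numbers *)

Section OneSidedLaw.
Variables (R : realType) (d : nat) (nu : probability (mseq R d) R).
Hypothesis nu_catn : forall n A, measurable A ->
  nu A = (nu \x nu)%E ((fun p : mseq R d * mseq R d => catn n p.1 p.2) @^-1` A).
Variables (L : nat).
Local Notation E := (mseq R d).
Local Notation theta := (@shiftn R d L).

Lemma measurable_comp_shiftn (h : E -> R) : measurable_fun setT h ->
  measurable_fun setT (fun x => h (theta x)).
Proof.
by move=> mh; apply: (@measurableT_comp _ _ _ _ _ _ h setT theta) => //; exact: measurable_shiftn.
Qed.

(** Dependence on the first [L] factors only is encoded as invariance of [p] under replacement of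
    the tail; such a function is independent of events read after the shift. *)
Lemma integral_indep (p : E -> R) (A : set E) : measurable_fun setT p ->
  (forall x, 0 <= p x) -> (forall x y, p (catn L x y) = p x) -> measurable A ->
  (\int[nu]_x (p x * \1_A (theta x))%:E = nu A * \int[nu]_x (p x)%:E)%E.
Proof.
move=> mp p0 pL mA.
have mi : measurable_fun setT (fun x : E => \1_A (theta x) : R).
  by apply: measurable_comp_shiftn; exact: measurable_indic.
have mpi : measurable_fun setT (fun x => (p x * \1_A (theta x))%:E).
  by apply/measurable_EFinP; exact: measurable_funM.
rewrite (integral_catn1 nu_catn L mpi); last first.
  by move=> x; rewrite lee_fin mulr_ge0.
rewrite -ge0_integralZl//; last first.
- by move=> x _; rewrite lee_fin.
- exact/measurable_EFinP.
apply: eq_integral => x _.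
transitivity (\int[nu]_y ((p x)%:E * (\1_A y)%:E))%E.
  by apply: eq_integral => y _; rewrite pL shiftn_catn EFinM.
rewrite ge0_integralZl//; last 2 first.
- by apply/measurable_EFinP; exact: measurable_indic.
- by rewrite lee_fin.
by rewrite integral_indic// setIT muleC.
Qed.

Variable f : E -> R.
Hypotheses (mf : measurable_fun setT f) (fL : forall x y, f (catn L x y) = f x)
  (intf : nu.-integrable setT (EFin \o f)).

(** The maximum of 0 and the first [n] partial sums of [f] along [theta], given by its first-step
    recursion. *)
Fixpoint max_sum (n : nat) (x : E) : R :=
  if n is n'.+1 then Num.max 0 (f x + max_sum n' (theta x)) else 0.

Lemma max_sum_ge0 n x : 0 <= max_sum n x.
Proof. by case: n => [|n]//=; rewrite le_max lexx. Qed.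

Lemma max_sumS n x : max_sum n x <= max_sum n.+1 x.
Proof.
elim: n x => [|n IHn] x; first exact: max_sum_ge0.
rewrite [leLHS]/= ge_max max_sum_ge0 andTb [leRHS]/= le_max.
by apply/orP; right; rewrite lerD2l; exact: IHn.
Qed.

Lemma sum_le_max_sum n x : \sum_(k < n) f (shiftn (k * L) x) <= max_sum n x.
Proof.
elim: n x => [|n IHn] x; first by rewrite big_ord0.
rewrite big_ord_recl/= le_max; apply/orP; right; apply: lerD.
  by rewrite mul0n; have -> : shiftn 0 x = x by apply/funext.
apply: le_trans (IHn _); apply: ler_sum => k _.
by rewrite -shiftnD mulSn.
Qed.

Lemma measurable_max_sum n : measurable_fun setT (max_sum n).
Proof.
elim: n => [|n IHn]; first exact: measurable_cst.
apply: measurable_maxr; first exact: measurable_cst.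
by apply: measurable_funD => //; exact: measurable_comp_shiftn.
Qed.

Let p x := Num.max (f x) 0.
Let q x := Num.max (- f x) 0.

Let fpq x : f x = p x - q x.
Proof.
rewrite /p /q; have [h|h] := leP (f x) 0.
  by rewrite max_l ?oppr_ge0// opprK add0r.
by rewrite max_r ?subr0// oppr_le0 ltW.
Qed.

Let mp : measurable_fun setT p.
Proof. by apply: measurable_maxr => //; exact: measurable_cst. Qed.

Let mq : measurable_fun setT q.
Proof. by apply: measurable_maxr; [exact: measurable_funN|exact: measurable_cst]. Qed.

Let p0 x : 0 <= p x. Proof. by rewrite /p le_max lexx orbT. Qed.
Let q0 x : 0 <= q x. Proof. by rewrite /q le_max lexx orbT. Qed.

Let ip : nu.-integrable setT (EFin \o p).
Proof.
apply: (le_integrable measurableT) intf; first exact/measurable_EFinP.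
move=> x _; rewrite /= lee_fin /p ger0_norm ?p0//.
by rewrite ge_max ler_norm normr_ge0.
Qed.

Let iq : nu.-integrable setT (EFin \o q).
Proof.
apply: (le_integrable measurableT) intf; first exact/measurable_EFinP.
move=> x _; rewrite /= lee_fin /q ger0_norm ?q0//.
by rewrite ge_max normr_ge0 -normrN ler_norm.
Qed.

Let integrable_mul_indic (h : E -> R) (A : set E) : measurable A ->
  nu.-integrable setT (EFin \o h) ->
  nu.-integrable setT (fun x => (h x * \1_A (theta x))%:E).
Proof.
move=> mA ih; have mh := measurable_int _ ih.
apply: (le_integrable measurableT _ _ ih).
  apply/measurable_EFinP; apply: measurable_funM; first exact/measurable_EFinP.
  by apply: measurable_comp_shiftn; exact: measurable_indic.
move=> x _; rewrite /= lee_fin normrM ler_piMr//.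
by rewrite indicE; case: (_ \in _); rewrite ?normr0 ?normr1.
Qed.

Lemma integral_indep_signed (A : set E) : measurable A ->
  (\int[nu]_x (f x * \1_A (theta x))%:E = nu A * \int[nu]_x (f x)%:E)%E.
Proof.
move=> mA.
have -> : (\int[nu]_x (f x)%:E = \int[nu]_x (p x)%:E - \int[nu]_x (q x)%:E)%E.
  rewrite -integralB_EFin//; apply: eq_integral => x _.
  by rewrite fpq EFinB.
transitivity (\int[nu]_x ((p x * \1_A (theta x))%:E - (q x * \1_A (theta x))%:E))%E.
  by apply: eq_integral => x _; rewrite fpq mulrBl EFinB.
rewrite (integralB_EFin measurableT (integrable_mul_indic mA ip) (integrable_mul_indic mA iq)).
rewrite !integral_indep//; last 2 first.
- by move=> x y; rewrite /q fL.
- by move=> x y; rewrite /p fL.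
have pf := integrable_fin_num measurableT ip.
have qf := integrable_fin_num measurableT iq.
move: pf qf; rewrite /comp; move: (integral _ _ _) (integral _ _ _) => a b fa fb.
rewrite muleBr//; first exact: fin_num_measure.
exact: fin_num_adde_defr.
Qed.

Lemma integrable_max_sum n : nu.-integrable setT (EFin \o max_sum n).
Proof.
elim: n => [|n IHn]; first exact: integrable0.
have ishift : nu.-integrable setT (fun x => (max_sum n (theta x))%:E).
  apply/integrableP; split.
    by apply/measurable_EFinP; exact: measurable_comp_shiftn (measurable_max_sum n).
  rewrite (integral_shiftn nu_catn L (f := fun x => `|(max_sum n x)%:E|%E)).
  - by case/integrableP: IHn.
  - by apply: measurableT_comp => //; apply/measurable_EFinP; exact: measurable_max_sum.
  - by [].
have := integrableD measurableT (integrable_abse intf) ishift.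
apply: (le_integrable measurableT).
  by apply/measurable_EFinP; exact: measurable_max_sum.
move=> x _ /=; rewrite lee_fin.
have h := max_sum_ge0 n (theta x).
rewrite [leLHS]ger0_norm ?le_max ?lexx// ger0_norm ?addr_ge0// ge_max addr_ge0//=.
by rewrite lerD2r ler_norm.
Qed.

Definition sup_infinite : set E := [set x | forall c : nat, exists n, c%:R < max_sum n x].

Lemma measurable_sup_infinite : measurable sup_infinite.
Proof.
apply: measurable_forall => c; apply: measurable_exists => n.
by apply: measurable_set_ltr; [exact: measurable_cst|exact: measurable_max_sum].
Qed.

Lemma max_sum_mono n m x : (n <= m)%N -> max_sum n x <= max_sum m x.
Proof.
move=> /subnKC <-; elim: (m - n)%N => [|k IHk]; first by rewrite addn0.
by rewrite addnS (le_trans IHk)// max_sumS.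
Qed.

(** Removing the first block changes the maximal sums by at most [|f x|], which cannot decide
    whether they are bounded. *)
Lemma sup_infinite_shiftn x : sup_infinite (theta x) <-> sup_infinite x.
Proof.
split=> H c.
  have [n Hn] := H (Num.truncn (c%:R + `|f x|)).+1; exists n.+1.
  rewrite /= lt_max; apply/orP; right.
  have h1 := truncnS_gt (c%:R + `|f x|).
  have h2 := ler_norm (- f x); rewrite normrN in h2.
  have h3 := lt_trans h1 Hn; lra.
have [n Hn] := H (Num.truncn (c%:R + `|f x|)).+1; exists n.
have : (Num.truncn (c%:R + `|f x|)).+1%:R < max_sum n.+1 x.
  exact: lt_le_trans Hn (max_sumS _ _).
have h0 : 0 < (Num.truncn (c%:R + `|f x|)).+1%:R :> R by [].
rewrite /= lt_max ltNge ltW//= => h4.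
have h1 := truncnS_gt (c%:R + `|f x|).
have h2 := ler_norm (f x); lra.
Qed.

Lemma sup_infinite_indic x : \1_sup_infinite (theta x) = \1_sup_infinite x :> R.
Proof.
rewrite !indicE; congr (_%:R); congr nat_of_bool.
by apply/idP/idP; rewrite !inE => h; apply/sup_infinite_shiftn.
Qed.

Let A := sup_infinite.
Let i x : R := \1_A x.
Let i0 x : 0 <= i x. Proof. by []. Qed.
Let itheta x : i (theta x) = i x. Proof. exact: sup_infinite_indic. Qed.
Let mi : measurable_fun setT i.
Proof. by apply: measurable_indic; exact: measurable_sup_infinite. Qed.

(* Garsia's argument: where the maximal sums are unbounded, [D n] is eventually [f],
   while its integral over that shift-invariant event is nonnegative. *)
Let D n x := max_sum n.+1 x - max_sum n (theta x).

Let DE n x : D n x = Num.max (- max_sum n (theta x)) (f x).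
Proof. by rewrite /D /= addr_maxl addrK add0r. Qed.

Let D_bound n x : `|D n x| <= `|f x|.
Proof.
rewrite DE; have h := max_sum_ge0 n (theta x).
rewrite ler_norml; apply/andP; split.
  by rewrite le_max; apply/orP; right; rewrite lerNl -normrN ler_norm.
by rewrite ge_max ler_norm andbT (le_trans _ (normr_ge0 _))// oppr_le0.
Qed.

(** As the law and the event are shift-invariant, the integral equals that of
    [max_sum n.+1 - max_sum n], a nonnegative function. *)
Let integral_D_ge0 n : (0 <= \int[nu]_x (D n x * i x)%:E)%E.
Proof.
have mM := measurable_max_sum.
have ishift m : (\int[nu]_x (max_sum m (theta x) * i x)%:E = \int[nu]_x (max_sum m x * i x)%:E)%E.
  rewrite -[RHS](integral_shiftn nu_catn L).
  - by apply: eq_integral => x _; rewrite itheta.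
  - by apply/measurable_EFinP; exact: measurable_funM.
  - by move=> x; rewrite lee_fin mulr_ge0// max_sum_ge0.
have iM m : nu.-integrable setT (EFin \o (fun x => max_sum m x * i x)).
  apply: eq_integrable (integrable_mul_indic measurable_sup_infinite (integrable_max_sum m)) => // x _.
  by rewrite /= -/A -/(i _) itheta.
have iMt m : nu.-integrable setT (EFin \o (fun x => max_sum m (theta x) * i x)).
  apply/integrableP; split.
    apply/measurable_EFinP; apply: measurable_funM => //.
    exact: measurable_comp_shiftn (mM m).
  have -> : (\int[nu]_x `|(EFin \o (fun x0 => (max_sum m (theta x0) * i x0)%R)) x| = \int[nu]_x (max_sum m x * i x)%:E)%E.
    rewrite -ishift; apply: eq_integral => x _.
    by rewrite /= ger0_norm// mulr_ge0// max_sum_ge0.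
  by have := integrable_fin_num measurableT (iM m); rewrite fin_numElt => /andP[].
have -> : (\int[nu]_x (D n x * i x)%:E =
    \int[nu]_x ((max_sum n.+1 x * i x)%:E - (max_sum n (theta x) * i x)%:E))%E.
  by apply: eq_integral => x _; rewrite /D mulrBl EFinB.
rewrite (integralB_EFin measurableT (iM _) (iMt _)) ishift sube_ge0; last first.
  by rewrite (integrable_fin_num measurableT (iM n)).
apply: ge0_le_integral => //.
- by move=> x _; rewrite lee_fin mulr_ge0// max_sum_ge0.
- by apply/measurable_EFinP; exact: measurable_funM.
- by apply/measurable_EFinP; exact: measurable_funM.
- by move=> x _; rewrite lee_fin ler_wpM2r// max_sumS.
Qed.

Let integral_f_ge0 : (0 <= \int[nu]_x (f x * i x)%:E)%E.
Proof.
have H : (\int[nu]_x (D n x * i x)%:E)%E @[n --> \oo] --> (\int[nu]_x (f x * i x)%:E)%E.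
  apply: (@dominated_cvg _ _ _ nu setT measurableT
    (fun n x => (D n x * i x)%:E) (fun x => (f x * i x)%:E) (fun x => `|f x|%:E)) => //.
  - move=> n; apply/measurable_EFinP; apply: measurable_funM => //.
    apply: measurable_funB; first exact: measurable_max_sum.
    exact: measurable_comp_shiftn (measurable_max_sum n).
  - move=> x _; apply: cvg_near_cst.
    have [Ax|nAx] := pselect (A x); last first.
      by near=> n; rewrite /i indicE memNset// !mulr0.
    have [n Hn] := (sup_infinite_shiftn x).2 Ax (Num.truncn `|f x|).+1.
    exists n => // m /= nm; congr ((_ * _)%:E).
    rewrite DE; apply/eqP; rewrite eq_maxr//.
    have h1 := truncnS_gt `|f x|; have h2 := ler_norm (- f x); rewrite normrN in h2.
    have h3 := lt_le_trans (lt_trans h1 Hn) (max_sum_mono (theta x) nm); lra.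
  - exact: integrable_norm.
  - move=> n x _; rewrite lee_fin normrM.
    by rewrite -[leRHS]mulr1 ler_pM// /i indicE; case: (_ \in _); rewrite ?normr0 ?normr1.
by rewrite -(cvg_lim _ H)//; apply: lime_ge; [apply/cvg_ex; eexists; exact: H|exact: nearW].
Unshelve. all: by end_near. Qed.

(** The event is invariant, hence may be read after the shift, where it is independent of [f]. The
    integral of [f] over it is thus its probability times a negative mean, yet it is nonnegative. *)
Lemma negative_drift_bounded : (\int[nu]_x (f x)%:E < 0)%E -> nu sup_infinite = 0%E.
Proof.
move=> fneg; have mA : measurable A := measurable_sup_infinite.
have := integral_f_ge0.
have -> : (\int[nu]_x (f x * i x)%:E = \int[nu]_x (f x * \1_A (theta x))%:E)%E.
  by apply: eq_integral => x _; rewrite -[\1_A _]/(i _) itheta.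
rewrite integral_indep_signed// => h.
apply/eqP; rewrite eq_le measure_ge0 andbT leNgt; apply/negP => nuA.
have : (nu A * \int[nu]_x (f x)%:E < 0)%E by rewrite mule_gt0_lt0.
by rewrite ltNge h.
Qed.

End OneSidedLaw.

Section OneSidedLawStatement.
Variables (R : realType) (d : nat) (nu : probability (mseq R d) R).
Hypothesis nu_catn : forall n A, measurable A ->
  nu A = (nu \x nu)%E ((fun p : mseq R d * mseq R d => catn n p.1 p.2) @^-1` A).

(** Negative drift of [f - b] bounds its partial sums almost surely. Two-sided control comes from
    applying this to [f] and to [- f]. *)
Lemma one_sided_law L (f : mseq R d -> R) (b : R) : measurable_fun setT f ->
  (forall x y, f (catn L x y) = f x) -> nu.-integrable setT (EFin \o f) ->
  (\int[nu]_x (f x)%:E < b%:E)%E ->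
  {ae nu, forall x, exists C : R, forall n,
    \sum_(k < n) f (shiftn (k * L) x) <= C + n%:R * b}.
Proof.
move=> mf fL intf fb.
pose h x := f x - b.
have mh : measurable_fun setT h by apply: measurable_funB => //; exact: measurable_cst.
have hL x y : h (catn L x y) = h x by rewrite /h fL.
have icst : nu.-integrable setT (EFin \o cst b) by exact: finite_measure_integrable_cst.
have inth : nu.-integrable setT (EFin \o h) by exact: (integrableB measurableT intf icst).
have hneg : (\int[nu]_x (h x)%:E < 0)%E.
  have -> : (\int[nu]_x (h x)%:E = \int[nu]_x (f x)%:E - b%:E)%E.
    by rewrite -[X in (_ - X)%E](integral_cst_prob nu b%:E) -integralB_EFin.
  by rewrite suber_lt0.
have N0 := negative_drift_bounded nu_catn mh hL inth hneg.
exists (sup_infinite L h); split => //; first exact: measurable_sup_infinite.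
move=> x /= nB; apply: contrapT => nS; apply: nB.
have [c Hc] : exists c : nat, forall n, max_sum L h n x <= c%:R.
  apply: contrapT => H; apply: nS => c; apply: contrapT => H2; apply: H; exists c => n.
  by rewrite leNgt; apply/negP => H3; apply: H2; exists n.
exists c%:R => n; have := le_trans (sum_le_max_sum L h n x) (Hc n).
by rewrite /h sumrB sumr_const card_ord -[b *+ n]mulr_natl lerBlDr.
Qed.

End OneSidedLawStatement.

(** * Exponential moments of bounded variables *)

Section ExponentialMarkov.
Context (dT : measure_display) (T : measurableType dT) (R : realType).
Variable P : probability T R.

(** With the exponent halved, the exponential of a variable in [0, 1] has an affine bound, so that
    only the mean of each term enters the recursions. *)
Lemma expR_half_le (z : R) : 0 <= z <= 1 -> expR (z / 2) <= 1 + z.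
Proof.
move=> /andP[z0 z1]; rewrite -[leLHS]invrK -expRN.
have h : 1 - z / 2 <= expR (- (z / 2)) by exact: expR_ge1Dx.
have p : 0 < 1 - z / 2 by lra.
apply: (@le_trans _ _ (1 - z / 2)^-1); first by rewrite lef_pV2 ?posrE ?expR_gt0.
by rewrite -[leLHS]mul1r ler_pdivrMr//; nra.
Qed.

Lemma expR_Nhalf_le (z : R) : 0 <= z <= 1 -> expR (- (z / 2)) <= 1 - z / 4.
Proof.
move=> /andP[z0 z1]; rewrite expRN.
have h : 1 + z / 2 <= expR (z / 2) by exact: expR_ge1Dx.
have p : 0 < 1 + z / 2 by lra.
apply: (@le_trans _ _ (1 + z / 2)^-1); first by rewrite lef_pV2 ?posrE ?expR_gt0.
by rewrite -[leLHS]mul1r ler_pdivrMr//; nra.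
Qed.

Lemma markov_exp (Z : T -> R) (t c : R) : measurable_fun setT Z ->
  (\int[P]_x (expR (Z x / 2))%:E <= c%:E)%E ->
  (P [set x | (t <= Z x)%R] <= (c * expR (- (t / 2)))%:E)%E.
Proof.
move=> mZ Hc.
have mS : measurable [set x | t <= Z x] by apply: measurable_set_ler => //; exact: measurable_cst.
have mE (s : R) : measurable_fun setT (fun x => (expR ((Z x - s) / 2))%:E).
  apply/measurable_EFinP; apply: (measurableT_comp (@measurable_expR R)).
  apply: measurable_funM; last exact: measurable_cst.
  by apply: measurable_funB => //; exact: measurable_cst.
rewrite -[X in P X]setIT -integral_indic//.
apply: (@le_trans _ _ (\int[P]_x (expR ((Z x - t) / 2))%:E)%E).
  apply: ge0_le_integral => //.
  - by apply/measurable_EFinP; exact: measurable_indic.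
  - move=> x _; rewrite lee_fin indicE; have [|_] := boolP (x \in _); last exact: expR_ge0.
    rewrite inE/= => h; rewrite mulr1n -[leLHS]expR0 ler_expR; lra.
have -> : (\int[P]_x (expR ((Z x - t) / 2))%:E = (expR (- (t / 2)))%:E * \int[P]_x (expR (Z x / 2))%:E)%E.
  rewrite -ge0_integralZl//.
    apply: eq_integral => x _; rewrite -EFinM -expRD; congr (expR _)%:E; lra.
  apply/measurable_EFinP; apply: (measurableT_comp (@measurable_expR R)).
  by apply: measurable_funM => //; exact: measurable_cst.
by rewrite [(c * _)%R]mulrC EFinM lee_wpmul2l// lee_fin expR_ge0.
Qed.

End ExponentialMarkov.

(** * Cost of multiplying by invertible matrices *)

Section Cost.
Variables (R : realType) (d : nat).
Hypothesis d0 : (0 < d)%N.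
Implicit Types (x : nat -> 'M[R]_d).

(* Multiplication by an invertible [M] changes norms by a factor between
   [expR (- cost M)] and [expR (cost M)]. *)
Definition cost (M : 'M[R]_d) : R := ln (1 + mxn M + mxn (invmx M)).

Lemma cost_ge0 M : 0 <= cost M.
Proof. by rewrite ln_ge0// -addrA lerDl addr_ge0// mxn_ge0. Qed.

Lemma expR_cost M : expR (cost M) = 1 + mxn M + mxn (invmx M).
Proof. by rewrite lnK// posrE -addrA ltr_pwDl// addr_ge0// mxn_ge0. Qed.

Definition total_cost n x : R := \sum_(k < n) cost (x k).

Lemma total_costD n m (x : mseq R d) :
  total_cost (n + m) x = total_cost n x + total_cost m (shiftn n x).
Proof. by rewrite /total_cost big_split_ord. Qed.

Lemma total_cost_ge0 n x : 0 <= total_cost n x.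
Proof. by apply: sumr_ge0 => k _; exact: cost_ge0. Qed.

Lemma mxn_mulmx_unit m (A : 'M[R]_(m, d)) M : M \in unitmx ->
  expR (- cost M) * mxn A <= mxn (A *m M).
Proof.
move=> uM; rewrite expRN mulrC ler_pdivrMr ?expR_gt0//.
apply: (@le_trans _ _ (mxn (A *m M) * mxn (invmx M))).
  by rewrite -{1}(mulmxK uM A) mxnM.
by rewrite ler_wpM2l ?mxn_ge0// expR_cost lerDr addr_ge0// mxn_ge0.
Qed.

Lemma mxn_mulmx_unitl m (A : 'M[R]_(d, m)) M : M \in unitmx ->
  expR (- cost M) * mxn A <= mxn (M *m A).
Proof.
move=> uM; rewrite expRN mulrC ler_pdivrMr ?expR_gt0// mulrC.
apply: (@le_trans _ _ (mxn (invmx M) * mxn (M *m A))).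
  by rewrite -{1}(mulKmx uM A) mxnM.
by rewrite ler_wpM2r ?mxn_ge0// expR_cost lerDr addr_ge0// mxn_ge0.
Qed.

Lemma mxn_mulmx_mprod m n (A : 'M[R]_(m, d)) x : (forall k, x k \in unitmx) ->
  expR (- total_cost n x) * mxn A <= mxn (A *m mprod x n).
Proof.
move=> ux; elim: n => [|n IHn].
  by rewrite /total_cost big_ord0 oppr0 expR0 mul1r mprod0 mulmx1.
rewrite /total_cost big_ord_recr/= opprD addrC expRD -mulrA mprod_recr mulmxA.
apply: le_trans (mxn_mulmx_unit _ (ux n)).
by rewrite ler_wpM2l// expR_ge0.
Qed.

Lemma mprod_mxn_mulmx m n (A : 'M[R]_(d, m)) x : (forall k, x k \in unitmx) ->
  expR (- total_cost n x) * mxn A <= mxn (mprod x n *m A).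
Proof.
move=> ux; elim: n m A => [|n IHn] m A.
  by rewrite /total_cost big_ord0 oppr0 expR0 mul1r mprod0 mul1mx.
rewrite /total_cost big_ord_recr/= opprD expRD -mulrA mprod_recr -mulmxA.
apply: le_trans (IHn _ _).
by rewrite ler_wpM2l ?expR_ge0// mxn_mulmx_unitl.
Qed.

Lemma mxn_mprod_le m n (A : 'M[R]_(m, d)) x :
  mxn (A *m mprod x n) <= expR (total_cost n x) * mxn A.
Proof.
elim: n => [|n IHn].
  by rewrite /total_cost big_ord0 expR0 mul1r mprod0 mulmx1.
rewrite /total_cost big_ord_recr/= addrC expRD -mulrA mprod_recr mulmxA.
apply: le_trans (mxnM _ _) _; rewrite mulrC; apply: ler_pM; rewrite ?mxn_ge0//.
by rewrite expR_cost addrAC lerDr addr_ge0// mxn_ge0.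
Qed.

Lemma mprod_mxn_ge n x : (forall k, x k \in unitmx) ->
  expR (- total_cost n x) <= mxn (mprod x n).
Proof.
move=> ux; have := mxn_mulmx_mprod n 1%:M ux; rewrite mul1mx; apply: le_trans.
by rewrite ler_peMr ?expR_ge0// mxn1_ge1.
Qed.

Lemma measurable_cost k : measurable_fun setT (fun x : mseq R d => cost (x k)).
Proof.
apply: (measurableT_comp (@measurable_ln R)).
apply: measurable_funD.
  apply: measurable_funD; first exact: measurable_cst.
  by apply: measurable_mxn; exact: mxmeasurable_coord.
by apply: measurable_mxn; apply: mxmeasurable_invmx; exact: mxmeasurable_coord.
Qed.

Lemma measurable_total_cost n : measurable_fun setT (fun x : mseq R d => total_cost n x).
Proof. by apply: measurable_sum => k; exact: measurable_cost. Qed.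

End Cost.

(** * Alignment of random blocks *)

Definition aligned (R : realType) (eta : R) m n p (A : 'M[R]_(m, n)) (B : 'M[R]_(n, p)) : bool :=
  eta * mxn A * mxn B <= mxn (A *m B).

Section Counting.
Variables (R : realType) (d : nat) (nu : probability (mseq R d) R).
Hypothesis nu_catn : forall n A, measurable A ->
  nu A = (nu \x nu)%E ((fun p : mseq R d * mseq R d => catn n p.1 p.2) @^-1` A).
(** The weight [w] is meant to mark words close to prescribed rank-one matrices; [a] is its mean,
    and next to any fixed matrix, on either side, the misaligned part of the weight has mean at most
    [a / 80]. *)
Variables (l : nat) (w : 'M[R]_d -> R) (eta a : R).
Hypothesis mw : forall F : mseq R d -> 'M[R]_d, mxmeasurable F ->
  measurable_fun setT (fun x => w (F x)).
Hypothesis w01 : forall M, 0 <= w M <= 1.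
Hypothesis int_w : (\int[nu]_x (w (mprod x l))%:E = a%:E)%E.
Hypothesis a0 : 0 < a.
Hypothesis w_right : forall B : 'M[R]_d,
  (\int[nu]_x (w (mprod x l) * (~~ aligned eta B (mprod x l))%:R)%:E <= (a / 80)%:E)%E.
Hypothesis w_left : forall B : 'M[R]_d,
  (\int[nu]_x (w (mprod x l) * (~~ aligned eta (mprod x l) B)%:R)%:E <= (a / 80)%:E)%E.
Local Notation E := (mseq R d).

Definition block k (x : E) := mprod (shiftn (k * l) x) l.

Definition count_weight K (x : E) : R := \sum_(k < K) w (block k x).

(** In [count_right] the block is the right factor of the tested junction and [B] with the past is
    the left one; in [count_left] the roles are exchanged and the block is tested against the
    future. *)
Definition count_right K (B : 'M[R]_d) (x : E) : R :=
  \sum_(k < K) w (block k x) * (~~ aligned eta (B *m mprod x (k * l)) (block k x))%:R.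

Definition count_left K (B : 'M[R]_d) (x : E) : R :=
  \sum_(k < K) w (block k x) *
    (~~ aligned eta (block k x) (mprod (shiftn (k.+1 * l) x) ((K - k.+1) * l) *m B))%:R.

Lemma measurable_aligned m n p (F : E -> 'M[R]_(m, n)) (G : E -> 'M[R]_(n, p)) :
  mxmeasurable F -> mxmeasurable G ->
  measurable_fun setT (fun x => (~~ aligned eta (F x) (G x))%:R : R).
Proof.
move=> mF mG; apply: measurable_natr_bool; apply: measurable_neg.
apply: measurable_fun_ler.
  apply: measurable_funM; last exact: measurable_mxn.
  by apply: measurable_funM; [exact: measurable_cst|exact: measurable_mxn].
by apply: measurable_mxn; exact: mxmeasurableM.
Qed.

Lemma mxmeasurable_shift_mprod k n : mxmeasurable (fun x : E => mprod (shiftn k x) n).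
Proof.
move=> i j; apply: (@measurableT_comp _ _ _ _ _ _ (fun x : E => mprod x n i j) setT (@shiftn R d k)).
  exact: mxmeasurable_mprod.
exact: measurable_shiftn.
Qed.

Lemma measurable_count_weight K : measurable_fun setT (count_weight K).
Proof.
by apply: measurable_sum => k; apply: mw; exact: mxmeasurable_shift_mprod.
Qed.

Lemma measurable_count_right K (F : E -> 'M[R]_d) (t : E -> E) :
  mxmeasurable F -> measurable_fun setT t ->
  measurable_fun setT (fun x => count_right K (F x) (t x)).
Proof.
move=> mF mt; apply: measurable_sum => k.
have mS n m : mxmeasurable (fun x : E => mprod (shiftn n (t x)) m).
  move=> i j; apply: (@measurableT_comp _ _ _ _ _ _ (fun x : E => mprod (shiftn n x) m i j) setT t) => //.
  exact: mxmeasurable_shift_mprod.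
apply: measurable_funM; first by apply: mw; exact: mS.
apply: measurable_aligned; last exact: mS.
apply: mxmeasurableM => // i j.
apply: (@measurableT_comp _ _ _ _ _ _ (fun x : E => mprod x (k * l) i j) setT t) => //.
exact: mxmeasurable_mprod.
Qed.

Lemma measurable_count_left K (F : E -> 'M[R]_d) (t : E -> E) :
  mxmeasurable F -> measurable_fun setT t ->
  measurable_fun setT (fun x => count_left K (F x) (t x)).
Proof.
move=> mF mt; apply: measurable_sum => k.
have mS n m : mxmeasurable (fun x : E => mprod (shiftn n (t x)) m).
  move=> i j; apply: (@measurableT_comp _ _ _ _ _ _ (fun x : E => mprod (shiftn n x) m i j) setT t) => //.
  exact: mxmeasurable_shift_mprod.
apply: measurable_funM; first by apply: mw; exact: mS.
by apply: measurable_aligned; [exact: mS|apply: mxmeasurableM => //; exact: mS].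
Qed.

Lemma block0 x : block 0 x = mprod x l.
Proof. by rewrite /block mul0n; congr mprod. Qed.

Lemma blockS k x : block k.+1 x = block k (shiftn l x).
Proof. by rewrite /block mulSn shiftnD. Qed.

Lemma count_weightS K x : count_weight K.+1 x = w (mprod x l) + count_weight K (shiftn l x).
Proof.
rewrite /count_weight big_ord_recl block0; congr (_ + _).
by apply: eq_bigr => k _; rewrite -blockS.
Qed.

Lemma count_rightS K B x : count_right K.+1 B x =
  w (mprod x l) * (~~ aligned eta B (mprod x l))%:R + count_right K (B *m mprod x l) (shiftn l x).
Proof.
rewrite /count_right big_ord_recl block0 mul0n mprod0 mulmx1; congr (_ + _).
by apply: eq_bigr => k _; rewrite /= -blockS /bump/= mulSn mprodD mulmxA.
Qed.

Lemma count_leftS K B x : count_left K.+1 B x =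
  w (mprod x l) * (~~ aligned eta (mprod x l) (mprod (shiftn l x) (K * l) *m B))%:R
   + count_left K B (shiftn l x).
Proof.
rewrite /count_left big_ord_recl block0 mul1n subSS subn0; congr (_ + _).
apply: eq_bigr => k _; rewrite /= -blockS /bump/= subSS.
by rewrite mulSn shiftnD.
Qed.

Let weight_exp (z : R) (b : bool) : 0 <= z <= 1 -> expR (z * b%:R / 2) <= 1 + z * b%:R.
Proof. by move=> h; apply: expR_half_le; case: b; rewrite ?mulr1 ?mulr0// lexx ler01. Qed.

Let r := 1 + a / 80.
Let r0 : 0 <= r. Proof. by rewrite /r addr_ge0// divr_ge0// ltW. Qed.

Let measurable_expR_half (Z : E -> R) : measurable_fun setT Z ->
  measurable_fun setT (fun x => (expR (Z x / 2))%:E).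
Proof.
move=> mZ; apply/measurable_EFinP; apply: (measurableT_comp (@measurable_expR R)).
by apply: measurable_funM => //; exact: measurable_cst.
Qed.

(* Conditionally on the past, the new term of the count has mean at most a / 80. *)
Lemma exp_count_right K B : (\int[nu]_x (expR (count_right K B x / 2))%:E <= (r ^+ K)%:E)%E.
Proof.
elim: K B => [|K IHK] B.
  under eq_integral do rewrite /count_right big_ord0 mul0r expR0.
  by rewrite integral_cst_prob.
have mZ k C : measurable_fun setT (count_right k C).
  by apply: (@measurable_count_right k (fun=> C) id) => //; exact: mxmeasurable_cst.
pose h (x : E) : R := 1 + w (mprod x l) * (~~ aligned eta B (mprod x l))%:R.
have mterm : measurable_fun setT (fun x : E => w (mprod x l) * (~~ aligned eta B (mprod x l))%:R).
  apply: measurable_funM; first by apply: mw; exact: mxmeasurable_mprod.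
  by apply: measurable_aligned; [exact: mxmeasurable_cst|exact: mxmeasurable_mprod].
have t0 (x : E) : 0 <= w (mprod x l) * (~~ aligned eta B (mprod x l))%:R.
  by rewrite mulr_ge0//; have /andP[] := w01 (mprod x l).
have mh : measurable_fun setT h by apply: measurable_funD => //; exact: measurable_cst.
apply: le_trans (_ : (r ^+ K)%:E * \int[nu]_x (h x)%:E <= _)%E.
  apply: (integral_catn1_le nu_catn (n := l)) => //.
  - exact: measurable_expR_half.
  - by rewrite lee_fin exprn_ge0.
  - exact/measurable_EFinP.
  - by move=> x; rewrite lee_fin addr_ge0.
  - move=> x; rewrite -EFinM mulrC EFinM.
    apply: le_trans (_ : (h x)%:E * \int[nu]_y (expR (count_right K (B *m mprod x l) y / 2))%:E <= _)%E; last first.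
      by rewrite lee_wpmul2l// lee_fin addr_ge0.
    rewrite -ge0_integralZl//; last 2 first.
    + exact: measurable_expR_half.
    + by rewrite lee_fin addr_ge0.
    apply: ge0_le_integral => //.
    + apply: (@measurable_expR_half (fun y => count_right K.+1 B (catn l x y))).
      apply: (@measurable_count_right K.+1 (fun=> B) (catn l x)); first exact: mxmeasurable_cst.
      exact: measurable_catn2.
    + by apply: emeasurable_funM; [exact: measurable_cst|exact: measurable_expR_half].
    + move=> y _; rewrite -EFinM lee_fin count_rightS shiftn_catn mprod_catn// mulrDl expRD.
      by rewrite ler_wpM2r ?expR_ge0// weight_exp.
rewrite exprSr EFinM lee_wpmul2l ?lee_fin ?exprn_ge0//.
rewrite /h; under eq_integral do rewrite EFinD.
rewrite ge0_integralD//; last exact/measurable_EFinP.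
  by rewrite integral_cst_prob /r EFinD leeD2l// w_right.
by move=> x _; rewrite lee_fin.
Qed.

(* Here the recursion removes the first block and freezes everything to its right. *)
Lemma exp_count_left K B : (\int[nu]_x (expR (count_left K B x / 2))%:E <= (r ^+ K)%:E)%E.
Proof.
elim: K => [|K IHK].
  under eq_integral do rewrite /count_left big_ord0 mul0r expR0.
  by rewrite integral_cst_prob.
have mZ k : measurable_fun setT (count_left k B).
  by apply: (@measurable_count_left k (fun=> B) id) => //; exact: mxmeasurable_cst.
apply: le_trans (_ : r%:E * \int[nu]_y (expR (count_left K B y / 2))%:E <= _)%E.
  apply: (integral_catn2_le nu_catn (n := l)) => //.
  - exact: measurable_expR_half.
  - exact: measurable_expR_half.
  - move=> y; set M := mprod y (K * l) *m B.
    have mterm : measurable_fun setT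
        (fun x : E => w (mprod x l) * (~~ aligned eta (mprod x l) M)%:R).
      apply: measurable_funM; first by apply: mw; exact: mxmeasurable_mprod.
      by apply: measurable_aligned; [exact: mxmeasurable_mprod|exact: mxmeasurable_cst].
    have t0 (x : E) : 0 <= w (mprod x l) * (~~ aligned eta (mprod x l) M)%:R.
      by rewrite mulr_ge0//; have /andP[] := w01 (mprod x l).
    pose h (x : E) : R := 1 + w (mprod x l) * (~~ aligned eta (mprod x l) M)%:R.
    have mh : measurable_fun setT h by apply: measurable_funD => //; exact: measurable_cst.
    have h0 x : 0 <= h x by rewrite addr_ge0.
    apply: le_trans (_ : (expR (count_left K B y / 2))%:E * \int[nu]_x (h x)%:E <= _)%E.
      rewrite -ge0_integralZl//; last 2 first.
      + exact/measurable_EFinP.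
      + by move=> x _; rewrite lee_fin.
      apply: ge0_le_integral => //.
      + apply: (@measurable_expR_half (fun x => count_left K.+1 B (catn l x y))).
        apply: (@measurable_count_left K.+1 (fun=> B) (fun x => catn l x y)).
          exact: mxmeasurable_cst.
        exact: measurable_catn1.
      + by apply: emeasurable_funM; [exact: measurable_cst|exact/measurable_EFinP].
      + move=> x _; rewrite -EFinM lee_fin count_leftS shiftn_catn mprod_catn// mulrDl expRD.
        by rewrite mulrC ler_wpM2l ?expR_ge0// weight_exp.
    rewrite muleC lee_wpmul2r ?lee_fin ?expR_ge0//.
    rewrite /h; under eq_integral do rewrite EFinD.
    rewrite ge0_integralD//; last exact/measurable_EFinP.
      by rewrite integral_cst_prob /r EFinD leeD2l// w_left.
    by move=> x _; rewrite lee_fin.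
by rewrite exprS EFinM lee_wpmul2l// lee_fin.
Qed.

Lemma exp_count_weight K :
  (\int[nu]_x (expR (- count_weight K x / 2))%:E <= ((1 - a / 4) ^+ K)%:E)%E.
Proof.
have a1 : a <= 1.
  rewrite -lee_fin -int_w -(integral_cst_prob nu 1%E).
  apply: ge0_le_integral => //.
  - by move=> x _; rewrite lee_fin; have /andP[] := w01 (mprod x l).
  - by apply/measurable_EFinP; apply: mw; exact: mxmeasurable_mprod.
  - by move=> x _; rewrite lee_fin; have /andP[] := w01 (mprod x l).
elim: K => [|K IHK].
  under eq_integral do rewrite /count_weight big_ord0 oppr0 mul0r expR0.
  by rewrite integral_cst_prob.
have mZ k : measurable_fun setT (fun x => - count_weight k x).
  by apply: measurable_funN; exact: measurable_count_weight.
have mwl : measurable_fun setT (fun x : E => w (mprod x l)).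
  by apply: mw; exact: mxmeasurable_mprod.
have h0 (x : E) : 0 <= 1 - w (mprod x l) / 4 by have /andP[] := w01 (mprod x l); lra.
have mh : measurable_fun setT (fun x : E => 1 - w (mprod x l) / 4).
  by apply: measurable_funB => //; exact: measurable_funM.
apply: le_trans (_ : ((1 - a / 4) ^+ K)%:E * \int[nu]_x (1 - w (mprod x l) / 4)%:E <= _)%E.
  apply: (integral_catn1_le nu_catn (n := l)) => //.
  - exact: measurable_expR_half.
  - by rewrite lee_fin exprn_ge0//; lra.
  - exact/measurable_EFinP.
  - move=> x; rewrite muleC.
    apply: le_trans (_ : (1 - w (mprod x l) / 4)%:E * \int[nu]_y (expR (- count_weight K y / 2))%:E <= _)%E; last first.
      by rewrite lee_wpmul2l// lee_fin.
    rewrite -ge0_integralZl//; last 2 first.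
    + exact: measurable_expR_half.
    + by rewrite lee_fin.
    apply: ge0_le_integral => //.
    + apply: (@measurable_expR_half (fun y => - count_weight K.+1 (catn l x y))).
      apply: measurable_funN.
      apply: (@measurableT_comp _ _ _ _ _ _ (count_weight K.+1) setT (catn l x)).
        exact: measurable_count_weight.
      exact: measurable_catn2.
    + by apply: emeasurable_funM; [exact: measurable_cst|exact: measurable_expR_half].
    + move=> y _; rewrite -EFinM lee_fin count_weightS shiftn_catn mprod_catn//.
      rewrite opprD mulrDl expRD ler_wpM2r ?expR_ge0// mulNr.
      exact: expR_Nhalf_le.
rewrite exprSr EFinM lee_wpmul2l ?lee_fin ?exprn_ge0//; first by lra.
have i1 : nu.-integrable setT (EFin \o cst (1 : R)) by exact: finite_measure_integrable_cst.
have iw : nu.-integrable setT (EFin \o (fun x : E => w (mprod x l) / 4)).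
  apply: (le_integrable measurableT) i1.
    by apply/measurable_EFinP; exact: measurable_funM.
  move=> x _ /=; rewrite lee_fin; have /andP[h1 h2] := w01 (mprod x l).
  by rewrite normr1 ger0_norm; lra.
under eq_integral do rewrite EFinB.
rewrite (integralB_EFin measurableT i1 iw).
rewrite [X in (X - _ <= _)%E](_ : _ = 1%:E); last exact: (integral_cst_prob nu 1%:E).
rewrite EFinB leeB//.
have -> : (\int[nu]_x (w (mprod x l) / 4)%:E = 4^-1%:E * \int[nu]_x (w (mprod x l))%:E)%E.
  rewrite -ge0_integralZl//.
  - by apply: eq_integral => x _; rewrite -EFinM mulrC.
  - exact/measurable_EFinP.
  - by move=> x _; rewrite lee_fin; have /andP[] := w01 (mprod x l).
by rewrite int_w -EFinM lee_fin mulrC.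
Qed.

(** At the threshold [a / 20] per block, Markov's inequality gains [expR (- (a / 40))] against a
    moment of at most [expR (a / 80)]. The lower tail of the weight decays faster still. *)
Definition decay_rate := expR (- (a / 80)).

Let r_le : r <= expR (a / 80). Proof. exact: expR_ge1Dx. Qed.

Let exp_bound K : r ^+ K * expR (- (a / 20 * K%:R / 2)) <= decay_rate ^+ K.
Proof.
apply: le_trans (_ : expR (a / 80) ^+ K * expR (- (a / 20 * K%:R / 2)) <= _).
  by rewrite ler_wpM2r ?expR_ge0// lerXn2r ?nnegrE ?expR_ge0.
rewrite /decay_rate -!expRM_natl -expRD ler_expR; lra.
Qed.

Lemma prob_count_right K B :
  (nu [set x | (a / 20 * K%:R <= count_right K B x)%R] <= (decay_rate ^+ K)%:E)%E.
Proof.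
have mZ : measurable_fun setT (count_right K B).
  by apply: (@measurable_count_right K (fun=> B) id) => //; exact: mxmeasurable_cst.
apply: le_trans (markov_exp _ mZ (exp_count_right K B)) _.
by rewrite lee_fin.
Qed.

Lemma prob_count_left K B :
  (nu [set x | (a / 20 * K%:R <= count_left K B x)%R] <= (decay_rate ^+ K)%:E)%E.
Proof.
have mZ : measurable_fun setT (count_left K B).
  by apply: (@measurable_count_left K (fun=> B) id) => //; exact: mxmeasurable_cst.
apply: le_trans (markov_exp _ mZ (exp_count_left K B)) _.
by rewrite lee_fin.
Qed.

Lemma prob_count_weight K :
  (nu [set x | (count_weight K x <= a / 4 * K%:R)%R] <= (decay_rate ^+ K)%:E)%E.
Proof.
have mZ : measurable_fun setT (fun x => - count_weight K x).
  by apply: measurable_funN; exact: measurable_count_weight.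
have -> : [set x | (count_weight K x <= a / 4 * K%:R)%R] =
    [set x | (- (a / 4 * K%:R) <= - count_weight K x)%R].
  by apply/seteqP; split=> x /=; rewrite lerN2.
apply: le_trans (markov_exp _ mZ (exp_count_weight K)) _.
rewrite lee_fin mulNr opprK.
have a1 : 0 <= 1 - a / 4.
  have := exp_count_weight 1; rewrite expr1 => h.
  have : (0 <= \int[nu]_x (expR (- count_weight 1 x / 2))%:E)%E.
    by apply: integral_ge0 => x _; rewrite lee_fin expR_ge0.
  by move=> h'; have := le_trans h' h; rewrite lee_fin.
apply: le_trans (_ : expR (- (a / 4)) ^+ K * expR (a / 4 * K%:R / 2) <= _).
  by rewrite ler_wpM2r ?expR_ge0// lerXn2r ?nnegrE ?expR_ge0// expR_ge1Dx.
rewrite /decay_rate -!expRM_natl -expRD ler_expR.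
have : 0 <= a * K%:R by rewrite mulr_ge0// ltW.
lra.
Qed.

End Counting.

(** Weighted pigeonhole: give the pair [(k, j)] the mass [u k * v j]. Each of the four families of
    bad pairs carries at most a fifth of the total mass, so some pair of positive mass belongs to
    none. *)
Lemma good_pair (R : realType) K (u v : 'I_K -> R) (F1 F2 F3 F4 : 'I_K -> 'I_K -> bool) t :
  (forall k, 0 <= u k) -> (forall k, 0 <= v k) ->
  0 < \sum_k u k -> 0 < \sum_k v k ->
  t * 5 <= \sum_k u k -> t * 5 <= \sum_k v k ->
  (forall j, \sum_k u k * (F1 k j)%:R <= t) -> (forall k, \sum_j v j * (F2 k j)%:R <= t) ->
  (forall k, \sum_j v j * (F3 k j)%:R <= t) -> (forall j, \sum_k u k * (F4 k j)%:R <= t) ->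
  exists k j, [/\ 0 < u k, 0 < v j & [/\ ~~ F1 k j, ~~ F2 k j, ~~ F3 k j & ~~ F4 k j]].
Proof.
move=> u0 v0; set U := \sum_k u k; set V := \sum_k v k => U0 V0 tU tV H1 H2 H3 H4.
apply: contrapT => no.
have key k j : u k * v j <= v j * (u k * (F1 k j)%:R) + u k * (v j * (F2 k j)%:R)
   + u k * (v j * (F3 k j)%:R) + v j * (u k * (F4 k j)%:R).
  have uv : 0 <= u k * v j by rewrite mulr_ge0.
  have -> : v j * (u k * (F1 k j)%:R) + u k * (v j * (F2 k j)%:R)
   + u k * (v j * (F3 k j)%:R) + v j * (u k * (F4 k j)%:R) =
   u k * v j * ((F1 k j)%:R + (F2 k j)%:R + (F3 k j)%:R + (F4 k j)%:R) by ring.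
  have [uk|uk] := ltP 0 (u k); last first.
    have -> : u k = 0 by apply/eqP; rewrite eq_le uk u0.
    by rewrite !mul0r.
  have [vj|vj] := ltP 0 (v j); last first.
    have -> : v j = 0 by apply/eqP; rewrite eq_le vj v0.
    by rewrite mulr0 mul0r.
  apply: ler_peMr => //.
  have : [|| F1 k j, F2 k j, F3 k j | F4 k j].
    apply: contrapT => /negP; rewrite !negb_or => /and4P[h1 h2 h3 h4].
    by apply: no; exists k, j.
  case: (F1 k j); case: (F2 k j); case: (F3 k j); case: (F4 k j) => //= _; lra.
have : \sum_k \sum_j u k * v j <= V * t + U * t + U * t + V * t.
  apply: le_trans (ler_sum _ (fun k _ => ler_sum _ (fun j _ => key k j))) _.
  under eq_bigr do rewrite !big_split/=.
  rewrite !big_split/=.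
  have L (F : 'I_K -> 'I_K -> bool) : (forall j, \sum_k u k * (F k j)%:R <= t) ->
      \sum_k \sum_j v j * (u k * (F k j)%:R) <= V * t.
    move=> HF; rewrite exchange_big/= /V mulr_suml; apply: ler_sum => j _.
    by rewrite -mulr_sumr ler_wpM2l.
  have L' (F : 'I_K -> 'I_K -> bool) : (forall k, \sum_j v j * (F k j)%:R <= t) ->
      \sum_k \sum_j u k * (v j * (F k j)%:R) <= U * t.
    move=> HF; rewrite /U mulr_suml; apply: ler_sum => j _.
    by rewrite -mulr_sumr ler_wpM2l.
  by rewrite !lerD// ?L ?L'.
under eq_bigr do rewrite -mulr_sumr; rewrite -mulr_suml -/U -/V => h.
have h1 : V * (t * 5) <= V * U by rewrite ler_pM2l.
have h2 : U * (t * 5) <= U * V by rewrite ler_pM2l.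
have h3 : 0 < U * V by rewrite mulr_gt0.
nra.
Qed.

Section UnionBounds.
Context (dT : measure_display) (T : measurableType dT) (R : realType) (P : probability T R).
Local Open Scope ereal_scope.

Lemma measurable_or_set (A B : T -> Prop) : measurable [set x | A x] ->
  measurable [set x | B x] -> measurable [set x | A x \/ B x].
Proof. exact: measurableU. Qed.

Lemma prob_or_le (A B : set T) a b : measurable A -> measurable B ->
  P A <= a -> P B <= b -> P [set x | A x \/ B x] <= a + b.
Proof.
by move=> mA mB Pa Pb; apply: le_trans (measureU2 _ mA mB) _; exact: leeD.
Qed.

Lemma prob_exists_le K (F : 'I_K -> set T) (b : R) : (forall k, measurable (F k)) ->
  (forall k, P (F k) <= b%:E) -> P [set x | exists k, F k x] <= (K%:R * b)%:E.
Proof.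
elim: K F => [|K IHK] F mF HF.
  rewrite (_ : [set x | _] = set0) ?measure0 ?mul0r//.
  by apply/seteqP; split=> // x [[]].
have -> : [set x | exists k, F k x] =
    [set x | F ord0 x \/ [set x | exists k, F (lift ord0 k) x] x].
  apply/seteqP; split=> [x [k]|x [h|[k h]]]; last 2 first.
  - by exists ord0.
  - by exists (lift ord0 k).
  by case: (unliftP ord0 k) => [j ->|->] ?; [right; exists j|left].
apply: le_trans (prob_or_le _ _ (HF ord0) (IHK (fun k => F (lift ord0 k)) _ _)) _ => //.
- by apply: (@measurable_exists _ _ 'I_K (fun k x => F (lift ord0 k) x)) => k; exact: mF.
- by rewrite -EFinD lee_fin -[X in (_ <= X * _)%R]natr1 mulrDl mul1r addrC.
Qed.

End UnionBounds.

(** * Realignment inside a random window *)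

Section Core.
Variables (R : realType) (d : nat) (nu : probability (mseq R d) R).
Hypothesis nu_catn : forall n A, measurable A ->
  nu A = (nu \x nu)%E ((fun p : mseq R d * mseq R d => catn n p.1 p.2) @^-1` A).
Hypothesis d0 : (0 < d)%N.
Variables (l : nat) (w : 'M[R]_d -> R) (eta a c : R).
Hypothesis mw : forall F : mseq R d -> 'M[R]_d, mxmeasurable F ->
  measurable_fun setT (fun x => w (F x)).
Hypothesis w01 : forall M, 0 <= w M <= 1.
Hypothesis int_w : (\int[nu]_x (w (mprod x l))%:E = a%:E)%E.
Hypothesis a0 : 0 < a.
Hypothesis w_right : forall B : 'M[R]_d,
  (\int[nu]_x (w (mprod x l) * (~~ aligned eta B (mprod x l))%:R)%:E <= (a / 80)%:E)%E.
Hypothesis w_left : forall B : 'M[R]_d,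
  (\int[nu]_x (w (mprod x l) * (~~ aligned eta (mprod x l) B)%:R)%:E <= (a / 80)%:E)%E.
Hypothesis c0 : 0 < c.
Hypothesis aligned_trace : forall S S' D Q : 'M[R]_d, 0 < w S -> 0 < w S' ->
  aligned eta S D -> aligned eta (S *m D) S' ->
  aligned eta S' Q -> aligned eta (S' *m Q) S ->
  c * (mxn S * mxn D * mxn S' * mxn Q) <= `|\tr (S *m D *m S' *m Q)|.
Local Notation E := (mseq R d).
Local Notation block := (@block R d l).
Local Notation tail K k x := (mprod (shiftn (k.+1 * l) x) ((K - k.+1) * l)).

Lemma mprod_block K k (x : E) : (k < K)%N ->
  mprod x (K * l) = mprod x (k * l) *m block k x *m tail K k x.
Proof.
move=> kK; have -> : (K * l = k * l + (l + (K - k.+1) * l))%N.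
  by rewrite addnA -mulSnr -mulnDl subnKC.
rewrite mprodD mprodD mulmxA; congr (_ *m mprod _ _).
by rewrite mulSnr shiftnD.
Qed.

Lemma total_cost_block K k (x : E) : (k < K)%N ->
  total_cost (K * l) x = total_cost (k * l) x + total_cost l (shiftn (k * l) x)
    + total_cost ((K - k.+1) * l) (shiftn (k.+1 * l) x).
Proof.
move=> kK; have -> : (K * l = k * l + (l + (K - k.+1) * l))%N.
  by rewrite addnA -mulSnr -mulnDl subnKC.
by rewrite !total_costD addrA -shiftnD mulSnr.
Qed.

Definition few_weights K : set E := [set z | count_weight l w K z <= a / 4 * K%:R].
Definition many_left K (F : E -> 'M[R]_d) (t : E -> E) : set E :=
  [set z | a / 20 * K%:R <= count_left l w eta K (F z) (t z)].
Definition many_right K (F : E -> 'M[R]_d) (t : E -> E) : set E :=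
  [set z | a / 20 * K%:R <= count_right l w eta K (F z) (t z)].

(* The four families of junctions around a block [k] of the first half and a block
   [j] of the second half, each read from the block that is random given the rest. *)
Definition bad1 K (j : 'I_K) := many_left K (fun z => mprod (shiftn (K * l) z) (j * l)) id.
Definition bad2 K (k : 'I_K) :=
  many_right K (fun z => block k z *m tail K k z) (@shiftn R d (K * l)).
Definition bad3 K B (k : 'I_K) :=
  many_left K (fun z => B *m mprod z (k * l)) (@shiftn R d (K * l)).
Definition bad4 K B (j : 'I_K) :=
  many_right K (fun z => block j (shiftn (K * l) z) *m tail K j (shiftn (K * l) z) *m B) id.

Definition bad K B : set E := [set z |
  (few_weights K z \/ few_weights K (shiftn (K * l) z)) \/
  (((exists j, bad1 (K := K) j z) \/ (exists k, bad2 (K := K) k z)) \/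
  ((exists k, bad3 (K := K) B k z) \/ (exists j, bad4 (K := K) B j z)))].

(* The trace is cyclic, so the two aligned blocks [S], [S'] cut the product into
   [S *m D *m S' *m Q], where [B] sits inside [Q]. *)
Lemma trace_lower_bound K B (z : E) : (forall k, z k \in unitmx) -> ~ bad K B z ->
  c * (expR (- total_cost (K * l + K * l) z) * mxn B)
    <= `|\tr (B *m mprod z (K * l + K * l))|.
Proof.
move=> uz nbad; set z2 := shiftn (K * l) z.
have uz2 n : forall k, shiftn n z k \in unitmx by move=> k; exact: uz.
have uz2' n : forall k, shiftn n z2 k \in unitmx by move=> k; exact: uz.
have K0 : 0 <= a / 4 * K%:R by rewrite mulr_ge0// divr_ge0// ltW.
have [Wu Wv] : a / 4 * K%:R < count_weight l w K z /\ a / 4 * K%:R < count_weight l w K z2.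
  by split; rewrite ltNge; apply/negP => h; apply: nbad; left; [left|right].
(* The factor 5 is the ratio between the guaranteed weight [a / 4 * K] and the tolerated misaligned
   weight [a / 20 * K]. *)
have [] := @good_pair R K (fun k => w (block k z)) (fun j => w (block j z2))
  (fun k j => ~~ aligned eta (block k z) (tail K k z *m mprod z2 (j * l)))
  (fun k j => ~~ aligned eta (block k z *m tail K k z *m mprod z2 (j * l)) (block j z2))
  (fun k j => ~~ aligned eta (block j z2) (tail K j z2 *m (B *m mprod z (k * l))))
  (fun k j => ~~ aligned eta (block j z2 *m tail K j z2 *m B *m mprod z (k * l)) (block k z))
  (a / 20 * K%:R).
- by move=> k; have /andP[] := w01 (block k z).
- by move=> k; have /andP[] := w01 (block k z2).
- exact: le_lt_trans Wu.
- exact: le_lt_trans Wv.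
- apply: le_trans (ltW Wu); lra.
- apply: le_trans (ltW Wv); lra.
- move=> j; rewrite leNgt; apply/negP => /ltW h; apply: nbad; right; left; left.
  by exists j.
- move=> k; rewrite leNgt; apply/negP => /ltW h; apply: nbad; right; left; right.
  by exists k.
- move=> k; rewrite leNgt; apply/negP => /ltW h; apply: nbad; right; right; left.
  by exists k.
- move=> j; rewrite leNgt; apply/negP => /ltW h; apply: nbad; right; right; right.
  by exists j.
move=> k [j [wk wj [/negPn f1 /negPn f2 /negPn f3 /negPn f4]]].
set S := block k z in wk f1 f2 f3 f4; set R1 := tail K k z in f1 f2.
set S' := block j z2 in wj f2 f3 f4; set R2 := tail K j z2 in f3 f4.
set P1 := mprod z (k * l) in f3 f4; set P2 := mprod z2 (j * l) in f1 f2.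
have := @aligned_trace S S' (R1 *m P2) (R2 *m (B *m P1)) wk wj f1.
rewrite !mulmxA in f2 f3 f4 *; move=> /(_ f2 f3 f4) H.
have -> : \tr (B *m mprod z (K * l + K * l)) = \tr (S *m R1 *m P2 *m S' *m R2 *m B *m P1).
  rewrite mprodD (mprod_block z (ltn_ord k)) (mprod_block z2 (ltn_ord j)) -/S -/S' -/R1 -/R2 -/P1 -/P2.
  rewrite !mulmxA -!mulmxA mulmxA mxtrace_mulC; congr (\tr _).
  by rewrite !mulmxA.
apply: le_trans H; rewrite ler_wpM2l ?(ltW c0)//.
(* Each piece of the cycle is bounded below by the exponential of minus its own cost, and these
   costs add up to the cost of the window. *)
have hS : expR (- total_cost l (shiftn (k * l) z)) <= mxn S by exact: mprod_mxn_ge.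
have hS' : expR (- total_cost l (shiftn (j * l) z2)) <= mxn S' by exact: mprod_mxn_ge.
have hD : expR (- total_cost ((K - k.+1) * l) (shiftn (k.+1 * l) z)) *
    expR (- total_cost (j * l) z2) <= mxn (R1 *m P2).
  rewrite mulrC; apply: le_trans (mxn_mulmx_mprod _ _ (uz2 (K * l)%N)).
  by rewrite ler_wpM2l ?expR_ge0//; exact: mprod_mxn_ge.
have hQ : expR (- total_cost ((K - j.+1) * l) (shiftn (j.+1 * l) z2)) *
    (expR (- total_cost (k * l) z) * mxn B) <= mxn (R2 *m B *m P1).
  rewrite -mulmxA; apply: le_trans (mprod_mxn_mulmx _ _ (uz2' _)).
  by rewrite ler_wpM2l ?expR_ge0//; exact: mxn_mulmx_mprod.
rewrite total_costD -/z2 (total_cost_block z (ltn_ord k)) (total_cost_block z2 (ltn_ord j)).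
rewrite !opprD !expRD.
have e0 (x : R) : 0 <= expR x by exact: expR_ge0.
apply: le_trans (ler_pM _ _ (ler_pM _ _ (ler_pM _ _ hS hD) hS') hQ);
  rewrite ?mulr_ge0 ?mxn_ge0//.
by rewrite le_eqVlt; apply/orP; left; apply/eqP; ring.
Qed.

Let r := decay_rate a.

Let measurable_many_left K F t : mxmeasurable F -> measurable_fun setT t ->
  measurable (many_left K F t).
Proof.
move=> mF mt; apply: measurable_set_ler; first exact: measurable_cst.
exact: measurable_count_left.
Qed.

Let measurable_many_right K F t : mxmeasurable F -> measurable_fun setT t ->
  measurable (many_right K F t).
Proof.
move=> mF mt; apply: measurable_set_ler; first exact: measurable_cst.
exact: measurable_count_right.
Qed.

Let mblocktail K k : mxmeasurable (fun z : E => block k z *m tail K k z).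
Proof. by apply: mxmeasurableM; exact: mxmeasurable_shift_mprod. Qed.

Let mxmeasurable_shiftn m (F : E -> 'M[R]_d) : mxmeasurable F ->
  mxmeasurable (fun z => F (shiftn m z)).
Proof.
move=> mF i j.
apply: (@measurableT_comp _ _ _ _ _ _ (fun z : E => F z i j) setT (@shiftn R d m)) => //.
exact: measurable_shiftn.
Qed.

Let mbad1 K j : measurable (bad1 (K := K) j).
Proof. by apply: measurable_many_left => //; exact: mxmeasurable_shift_mprod. Qed.

Let mbad2 K k : measurable (bad2 (K := K) k).
Proof. by apply: measurable_many_right; [exact: mblocktail|exact: measurable_shiftn]. Qed.

Let mbad3 K B k : measurable (bad3 (K := K) B k).
Proof.
apply: measurable_many_left; last exact: measurable_shiftn.
by apply: mxmeasurableM; [exact: mxmeasurable_cst|exact: mxmeasurable_mprod].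
Qed.

Let mbad4 K B j : measurable (bad4 (K := K) B j).
Proof.
apply: measurable_many_right => //.
apply: mxmeasurableM; last exact: mxmeasurable_cst.
exact: (@mxmeasurable_shiftn (K * l) (fun z => block j z *m tail K j z)).
Qed.

Let mfew K : measurable (few_weights K).
Proof.
apply: measurable_set_ler; last exact: measurable_cst.
exact: measurable_count_weight.
Qed.

Let mfews K : measurable [set z | few_weights K (shiftn (K * l) z)].
Proof. by rewrite -[X in measurable X]setTI; apply: measurable_shiftn. Qed.

Let me1 K : measurable [set z | exists j, bad1 (K := K) j z].
Proof. by apply: measurable_exists => j; exact: mbad1. Qed.

Let me2 K : measurable [set z | exists k, bad2 (K := K) k z].
Proof. by apply: measurable_exists => j; exact: mbad2. Qed.

Let me3 K B : measurable [set z | exists k, bad3 (K := K) B k z].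
Proof. by apply: measurable_exists => j; exact: mbad3. Qed.

Let me4 K B : measurable [set z | exists j, bad4 (K := K) B j z].
Proof. by apply: measurable_exists => j; exact: mbad4. Qed.

Lemma measurable_bad K B : measurable (bad K B).
Proof.
apply: measurable_or_set; first exact: measurable_or_set (mfew K) (mfews K).
exact: measurable_or_set (measurable_or_set (me1 K) (me2 K)) (measurable_or_set (me3 K B) (me4 K B)).
Qed.

Lemma block_catn K (k : 'I_K) (x y : E) : block k (catn (K * l) x y) = block k x.
Proof.
apply: eq_mprod => i il; rewrite /shiftn /catn ifT//.
have kK := ltn_ord k; apply: (@leq_trans (k * l + l)); first by rewrite ltn_add2l.
by rewrite -mulSnr leq_mul2r kK orbT.
Qed.

Lemma tail_catn K (k : 'I_K) (x y : E) : tail K k (catn (K * l) x y) = tail K k x.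
Proof.
apply: eq_mprod => i il; rewrite /shiftn /catn ifT//.
by rewrite -{2}(subnKC (ltn_ord k)) mulnDl ltn_add2l.
Qed.

Lemma mprod_catn_lt K (k : 'I_K) (x y : E) : mprod (catn (K * l) x y) (k * l) = mprod x (k * l).
Proof. by rewrite mprod_catn// leq_mul2r ltnW ?orbT. Qed.

Lemma count_left_catn K B (x y : E) :
  count_left l w eta K B (catn (K * l) x y) = count_left l w eta K B x.
Proof. by apply: eq_bigr => k _; rewrite block_catn tail_catn. Qed.

Lemma count_right_catn K B (x y : E) :
  count_right l w eta K B (catn (K * l) x y) = count_right l w eta K B x.
Proof. by apply: eq_bigr => k _; rewrite block_catn mprod_catn_lt. Qed.

(** In each family the half window without the varying block is frozen, which makes the neighbouring
    matrix constant and brings in the counting estimates. Four families of [K] events and two events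
    of small weight give [4 K + 2]. *)
Lemma prob_bad K B : (nu (bad K B) <= ((4 * K%:R + 2) * r ^+ K)%:E)%E.
Proof.
have rK0 : 0 <= r ^+ K by rewrite exprn_ge0// expR_ge0.
have rK0' : (0 <= (r ^+ K)%:E)%E by rewrite lee_fin.
have p1 j : (nu (bad1 (K := K) j) <= (r ^+ K)%:E)%E.
  apply: (prob_catn2_le nu_catn (n := K * l)) => // y.
  rewrite (_ : [set x | _] = [set x | a / 20 * K%:R <= count_left l w eta K (mprod y (j * l)) x]).
    exact: prob_count_left.
  by apply/seteqP; split=> x; rewrite /bad1 /many_left/= shiftn_catn count_left_catn.
have p2 k : (nu (bad2 (K := K) k) <= (r ^+ K)%:E)%E.
  apply: (prob_catn1_le nu_catn (n := K * l)) => // x.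
  rewrite (_ : [set y | _] = [set y | a / 20 * K%:R <= count_right l w eta K (block k x *m tail K k x) y]).
    exact: prob_count_right.
  by apply/seteqP; split=> y; rewrite /bad2 /many_right/= shiftn_catn block_catn tail_catn.
have p3 k : (nu (bad3 (K := K) B k) <= (r ^+ K)%:E)%E.
  apply: (prob_catn1_le nu_catn (n := K * l)) => // x.
  rewrite (_ : [set y | _] = [set y | a / 20 * K%:R <= count_left l w eta K (B *m mprod x (k * l)) y]).
    exact: prob_count_left.
  by apply/seteqP; split=> y; rewrite /bad3 /many_left/= shiftn_catn mprod_catn_lt.
have p4 j : (nu (bad4 (K := K) B j) <= (r ^+ K)%:E)%E.
  apply: (prob_catn2_le nu_catn (n := K * l)) => // y.
  rewrite (_ : [set x | _] = [set x | a / 20 * K%:R <= count_right l w eta K (block j y *m tail K j y *m B) x]).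
    exact: prob_count_right.
  by apply/seteqP; split=> x; rewrite /bad4 /many_right/= shiftn_catn count_right_catn.
have p5 : (nu (few_weights K) <= (r ^+ K)%:E)%E by exact: prob_count_weight.
have p6 : (nu [set z | few_weights K (shiftn (K * l) z)] <= (r ^+ K)%:E)%E.
  by rewrite prob_shiftn.
have -> : ((4 * K%:R + 2) * r ^+ K)%:E = ((r ^+ K)%:E + (r ^+ K)%:E +
   (((K%:R * r ^+ K)%:E + (K%:R * r ^+ K)%:E) + ((K%:R * r ^+ K)%:E + (K%:R * r ^+ K)%:E)))%E.
  by rewrite -!EFinD; congr EFin; ring.
apply: prob_or_le.
- exact: measurable_or_set (mfew K) (mfews K).
- exact: measurable_or_set (measurable_or_set (me1 K) (me2 K)) (measurable_or_set (me3 K B) (me4 K B)).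
- exact: prob_or_le (mfew K) (mfews K) p5 p6.
apply: prob_or_le.
- exact: measurable_or_set (me1 K) (me2 K).
- exact: measurable_or_set (me3 K B) (me4 K B).
- by apply: prob_or_le (me1 K) (me2 K) _ _; exact: prob_exists_le.
- by apply: prob_or_le (me3 K B) (me4 K B) _ _; exact: prob_exists_le.
Qed.

End Core.

(** * Growth of the norm and of traces *)

Lemma ln_le_of_le_expR (R : realType) (x y : R) : 0 <= y -> x <= expR y -> ln x <= y.
Proof.
move=> y0 xy; have [x0|x0] := leP x 0; first by rewrite ln0.
by rewrite -(expRK y) ler_ln ?posrE ?expR_gt0.
Qed.

Section Growth.
Variables (R : realType) (d : nat) (nu : probability (mseq R d) R).
Hypothesis nu_catn : forall n A, measurable A ->
  nu A = (nu \x nu)%E ((fun p : mseq R d * mseq R d => catn n p.1 p.2) @^-1` A).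
Hypothesis d0 : (0 < d)%N.
Local Notation E := (mseq R d).
Hypothesis unit_ae : {ae nu, forall x : E, forall k, x k \in unitmx}.
Hypothesis int_cost : nu.-integrable setT (fun x : E => (cost (x 0%N))%:E).

Definition mean_cost : R := fine (\int[nu]_x (cost (x 0%N))%:E).

Lemma integral_cost : (\int[nu]_x (cost (x 0%N))%:E = mean_cost%:E)%E.
Proof. by rewrite fineK// (integrable_fin_num measurableT int_cost). Qed.

Lemma total_cost_catn n m (x y : E) : (m <= n)%N -> total_cost m (catn n x y) = total_cost m x.
Proof.
by move=> mn; apply: eq_bigr => k _; rewrite /catn (leq_trans (ltn_ord k) mn).
Qed.

Lemma total_cost_upper e : 0 < e ->
  {ae nu, forall x : E, exists C : R, forall n, total_cost n x <= C + n%:R * (mean_cost + e)}.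
Proof.
move=> e0.
have := @one_sided_law R d nu nu_catn 1 (fun x => cost (x 0%N)) (mean_cost + e)
  (measurable_cost (d := d) 0) (fun x y => erefl) int_cost.
rewrite integral_cost lte_fin ltrDl => /(_ e0).
apply: filterS => x [C H]; exists C => n; apply: le_trans (H n).
by rewrite le_eqVlt; apply/orP; left; apply/eqP; apply: eq_bigr => k _; rewrite /shiftn muln1 addn0.
Qed.

Lemma total_cost_lower e : 0 < e ->
  {ae nu, forall x : E, exists C : R, forall n, n%:R * (mean_cost - e) - C <= total_cost n x}.
Proof.
move=> e0.
have mN : measurable_fun setT (fun x : E => - cost (x 0%N)).
  by apply: measurable_funN; exact: measurable_cost.
have iN : nu.-integrable setT (EFin \o (fun x : E => - cost (x 0%N))).
  by apply: eq_integrable (integrableN int_cost).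
have := @one_sided_law R d nu nu_catn 1 (fun x => - cost (x 0%N)) (- mean_cost + e)
  mN (fun x y => erefl) iN.
have -> : (\int[nu]_x (- cost (x 0%N))%:E = (- mean_cost)%:E)%E.
  rewrite EFinN -integral_cost -integralN//.
  by apply: fin_num_adde_defr; rewrite (integrable_pos_fin_num measurableT int_cost).
rewrite lte_fin ltrDl => /(_ e0).
apply: filterS => x [C H]; exists C => n; have := H n.
have -> : \sum_(k < n) - cost (shiftn (k * 1) x 0%N) = - total_cost n x.
  by rewrite -sumrN; apply: eq_bigr => k _; rewrite /shiftn muln1 addn0.
lra.
Qed.

(* The maximum only matters for non-invertible factors; it makes the lower bound by
   [- total_cost] hold everywhere. *)
Definition log_norm n (x : E) : R := Num.max (ln (mxn (mprod x n))) (- total_cost n x).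

Lemma mean_cost_ge0 : 0 <= mean_cost.
Proof. by apply: fine_ge0; apply: integral_ge0 => x _; rewrite lee_fin cost_ge0. Qed.

Let lnd_ge0 : 0 <= ln (mxn (1%:M : 'M[R]_d)).
Proof. by rewrite ln_ge0// mxn1_ge1. Qed.

Lemma log_norm_bound n x : `|log_norm n x| <= total_cost n x + ln (mxn (1%:M : 'M[R]_d)).
Proof.
have t0 := total_cost_ge0 n x.
rewrite ler_norml; apply/andP; split.
  by rewrite le_max; apply/orP; right; rewrite lerN2 lerDl.
rewrite ge_max; apply/andP; split; last by have := lnd_ge0; lra.
apply: ln_le_of_le_expR; first by rewrite addr_ge0.
rewrite expRD lnK ?posrE; last by rewrite (lt_le_trans _ (mxn1_ge1 R d0)).
by have := mxn_mprod_le n 1%:M x; rewrite mul1mx.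
Qed.

Lemma log_norm_unit n (x : E) : (forall k, x k \in unitmx) -> log_norm n x = ln (mxn (mprod x n)).
Proof.
move=> ux; rewrite /log_norm max_l//.
have h := mprod_mxn_ge d0 n ux.
by rewrite -[leLHS]expRK ler_ln ?posrE ?expR_gt0// (lt_le_trans _ h) ?expR_gt0.
Qed.

Lemma measurable_log_norm n : measurable_fun setT (log_norm n).
Proof.
apply: measurable_maxr; last by apply: measurable_funN; exact: measurable_total_cost.
apply: (measurableT_comp (@measurable_ln R)); apply: measurable_mxn.
exact: mxmeasurable_mprod.
Qed.

Lemma integrable_total_cost n : nu.-integrable setT (EFin \o @total_cost R d n).
Proof.
elim: n => [|n IHn].
  apply: (eq_integrable measurableT (cst 0%E)) => [x _|]; last exact: integrable0.
  by rewrite /= /total_cost big_ord0.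
have ic : nu.-integrable setT (fun x : E => (cost (x n))%:E).
  apply/integrableP; split; first by apply/measurable_EFinP; exact: measurable_cost.
  have := integral_shiftn nu_catn n (f := fun x : E => `|(cost (x 0%N))%:E|%E).
  rewrite /shiftn addn0 => -> //.
    by case/integrableP: int_cost.
  by apply: measurableT_comp => //; apply/measurable_EFinP; exact: measurable_cost.
apply: eq_integrable (integrableD measurableT IHn ic) => // x _.
by rewrite /= /total_cost big_ord_recr EFinD.
Qed.

Lemma integral_total_cost n : (\int[nu]_x (total_cost n x)%:E = (n%:R * mean_cost)%:E)%E.
Proof.
elim: n => [|n IHn].
  by rewrite mul0r -[RHS](integral_cst_prob nu 0%E); apply: eq_integral => x _; rewrite /total_cost big_ord0.
transitivity (\int[nu]_x ((total_cost n x)%:E + (cost (x n))%:E))%E.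
  by apply: eq_integral => x _; rewrite /total_cost big_ord_recr EFinD.
rewrite ge0_integralD//; last 4 first.
- by move=> x _; rewrite lee_fin total_cost_ge0.
- by apply/measurable_EFinP; exact: measurable_total_cost.
- by move=> x _; rewrite lee_fin cost_ge0.
- by apply/measurable_EFinP; exact: measurable_cost.
rewrite IHn.
have -> : (\int[nu]_x (cost (x n))%:E = mean_cost%:E)%E.
  rewrite -integral_cost -(integral_shiftn nu_catn n (f := fun x : E => (cost (x 0%N))%:E))//.
  - by apply: eq_integral => x _; rewrite /shiftn addn0.
  - by apply/measurable_EFinP; exact: measurable_cost.
  - by move=> x; rewrite lee_fin cost_ge0.
by rewrite -EFinD -natr1 mulrDl mul1r.
Qed.

Lemma integrable_log_norm n : nu.-integrable setT (EFin \o log_norm n).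
Proof.
have ic : nu.-integrable setT (EFin \o cst (ln (mxn (1%:M : 'M[R]_d)))) by exact: finite_measure_integrable_cst.
apply: (le_integrable measurableT) (integrableD measurableT (integrable_total_cost n) ic).
  by apply/measurable_EFinP; exact: measurable_log_norm.
move=> x _; rewrite /= lee_fin [leRHS]ger0_norm; first exact: log_norm_bound.
by rewrite addr_ge0// total_cost_ge0.
Qed.

Definition mean_log n : R := fine (\int[nu]_x (log_norm n x)%:E).

Lemma integral_log_norm n : (\int[nu]_x (log_norm n x)%:E = (mean_log n)%:E)%E.
Proof. by rewrite fineK// (integrable_fin_num measurableT (integrable_log_norm n)). Qed.

Lemma mean_log_ge n : - (n%:R * mean_cost) <= mean_log n.
Proof.
rewrite -lee_fin -integral_log_norm EFinN -integral_total_cost -integralN; last first.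
  by apply: fin_num_adde_defr; rewrite (integrable_pos_fin_num measurableT (integrable_total_cost n)).
apply: le_integral => //; first exact: (integrableN (integrable_total_cost n)).
  exact: integrable_log_norm.
by move=> x _; rewrite lee_fin /log_norm le_max lexx orbT.
Qed.

(** Fekete's constant, taken as an infimum, finite by [mean_log_ge]. Its two sides [lyapunov_approx]
    and [lyapunov_le] serve the upper and the lower growth bounds respectively. *)
Definition lyapunov : R := inf [set mean_log n.+1 / n.+1%:R | n in [set: nat]].

Let has_inf_lyapunov : has_inf [set mean_log n.+1 / n.+1%:R | n in [set: nat]].
Proof.
split; first by exists (mean_log 1 / 1%:R), 0%N.
exists (- mean_cost) => _ [n _ <-]; rewrite ler_pdivlMr// mulNr mulrC.
exact: mean_log_ge.
Qed.

Lemma lyapunov_le n : n%:R * lyapunov <= mean_log n.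
Proof.
case: n => [|n].
  by have := mean_log_ge 0; rewrite !mul0r oppr0.
rewrite mulrC -ler_pdivlMr//; apply: (ge_inf has_inf_lyapunov.2).
by exists n.
Qed.

Lemma lyapunov_approx e : 0 < e -> exists n, (0 < n)%N /\ mean_log n < n%:R * (lyapunov + e).
Proof.
move=> e0; have [_ [n _ <-] h] := inf_adherent e0 has_inf_lyapunov.
by exists n.+1; split=> //; rewrite mulrC -ltr_pdivrMr.
Qed.

End Growth.

Section UpperGrowth.
Variables (R : realType) (d : nat) (nu : probability (mseq R d) R).
Hypothesis nu_catn : forall n A, measurable A ->
  nu A = (nu \x nu)%E ((fun p : mseq R d * mseq R d => catn n p.1 p.2) @^-1` A).
Hypothesis d0 : (0 < d)%N.
Local Notation E := (mseq R d).
Hypothesis unit_ae : {ae nu, forall x : E, forall k, x k \in unitmx}.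
Hypothesis int_cost : nu.-integrable setT (fun x : E => (cost (x 0%N))%:E).
Local Notation mu := (mean_cost nu).
Local Notation lam := (lyapunov nu).

(** Difference of the two linear bounds on [total_cost]. The error is proportional to [n], not to
    [n - m], which is affordable when the tail is an incomplete block or the final window. *)
Lemma tail_cost e : 0 < e -> {ae nu, forall x : E, exists2 C : R, 0 <= C & forall m n, (m <= n)%N ->
  total_cost (n - m) (shiftn m x) <= C + (n - m)%:R * mu + n%:R * e}.
Proof.
move=> e0; have e20 : 0 < e / 2 by lra.
apply: filterS2 (total_cost_upper nu_catn int_cost e20) (total_cost_lower nu_catn int_cost e20).
move=> x [C1 H1] [C2 H2]; exists (`|C1| + `|C2|) => [|m n mn]; first by rewrite addr_ge0.
have -> : total_cost (n - m) (shiftn m x) = total_cost n x - total_cost m x.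
  by rewrite -{2}(subnKC mn) total_costD addrAC subrr add0r.
have h1 := H1 n; have h2 := H2 m; rewrite natrB//.
have h3 : m%:R * e <= n%:R * e by rewrite ler_wpM2r ?ler_nat// ltW.
have := ler_norm C1; have := ler_norm C2; nra.
Qed.

Lemma mxn_mprod_blocks L q (x : E) : (forall k, x k \in unitmx) ->
  mxn (mprod x (q * L)) <= mxn (1%:M : 'M[R]_d) * expR (\sum_(k < q) log_norm L (shiftn (k * L) x)).
Proof.
move=> ux; elim: q => [|q IHq]; first by rewrite big_ord0 expR0 mulr1 mul0n mprod0.
rewrite mulSnr mprodD big_ord_recr/= expRD mulrA.
apply: le_trans (mxnM _ _) _; apply: ler_pM; rewrite ?mxn_ge0//.
rewrite log_norm_unit//; last by move=> k; exact: ux.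
rewrite lnK// posrE; apply: lt_le_trans (mprod_mxn_ge d0 L _); first exact: expR_gt0.
by move=> k; exact: ux.
Qed.

(** A block length [L] almost realizing the infimum is fixed; the one-sided law is applied to the
    independent blocks, and the incomplete last block is charged its cost. *)
Theorem norm_upper e : 0 < e -> {ae nu, forall x : E, exists C : R, forall n,
  mxn (mprod x n) <= expR (C + n%:R * (lam + e))}.
Proof.
move=> e0; have e40 : 0 < e / 4 by lra.
have [L [L0 HL]] := lyapunov_approx nu_catn d0 int_cost e40.
have fL (x y : E) : log_norm L (catn L x y) = log_norm L x.
  by rewrite /log_norm mprod_catn// total_cost_catn.
have HS : (\int[nu]_x (log_norm L x)%:E < (L%:R * (lam + e / 4))%:E)%E.
  by rewrite (integral_log_norm nu_catn d0 int_cost) lte_fin.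
apply: filterS3 unit_ae (tail_cost e40) (one_sided_law nu_catn (measurable_log_norm L) fL
  (integrable_log_norm nu_catn d0 int_cost L) HS) => x ux [C2 C20 H2] [C1 H1].
exists (C1 + C2 + L%:R * mu + ln (mxn (1%:M : 'M[R]_d)) + L%:R * `|lam + e / 4|) => n.
pose q := (n %/ L)%N; pose s := (n %% L)%N.
have nE : n = (q * L + s)%N by exact: divn_eq.
have sL : (s < L)%N by rewrite ltn_mod.
have qn : (q * L <= n)%N by rewrite [leqRHS]nE leq_addr.
have tailb := H2 _ _ qn.
have ns : (n - q * L = s)%N by rewrite {1}nE addKn.
rewrite ns in tailb.
rewrite {1}nE mprodD -[mprod x (q * L)]mul1mx.
apply: le_trans (mxn_mprod_le _ _ _) _; rewrite mul1mx.
apply: le_trans (ler_wpM2l (expR_ge0 _) (mxn_mprod_blocks L q ux)) _.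
rewrite -{1}(lnK (x := mxn (1%:M : 'M[R]_d))) ?posrE ?(lt_le_trans _ (mxn1_ge1 R d0))//.
rewrite -!expRD ler_expR.
have h1 := H1 q.
have mu0 : 0 <= mu := mean_cost_ge0 nu.
have sL' : s%:R <= L%:R :> R by rewrite ler_nat ltnW.
have h2 : s%:R * mu <= L%:R * mu by rewrite ler_wpM2r.
have h3 : q%:R * (L%:R * (lam + e / 4)) <= n%:R * (lam + e / 4) + L%:R * `|lam + e / 4|.
  rewrite mulrA -natrM.
  have -> : (q * L)%:R = n%:R - s%:R :> R by rewrite {1}nE natrD addrK.
  rewrite mulrBl lerD2l -mulrN.
  apply: le_trans (_ : s%:R * `|lam + e / 4| <= _); last by rewrite ler_wpM2r.
  by rewrite ler_wpM2l// -normrN ler_norm.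
have n0 : 0 <= n%:R * e by rewrite mulr_ge0// ltW.
lra.
Qed.

End UpperGrowth.

Lemma geometric_borel_cantelli (dT : measure_display) (T : measurableType dT) (R : realType)
    (P : probability T R) (F : nat -> set T) (k c : R) :
  (forall n, measurable (F n)) -> 0 <= k -> 0 <= c < 1 ->
  (forall n, (P (F n) <= (k * c ^+ n)%:E)%E) ->
  {ae P, forall x, exists n0, forall n, (n0 <= n)%N -> ~ F n x}.
Proof.
move=> mF k0 /andP[c0 c1] H.
exists (lim_sup_set F); split.
- rewrite /lim_sup_set; apply: bigcapT_measurable => n.
  by apply: bigcup_measurable => m _.
- apply: lim_sup_set_cvg0 => //.
  apply: (@le_lt_trans _ _ (k / (1 - c))%:E); last by rewrite ltry.
  apply: lime_le; first exact: is_cvg_nneseries.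
  apply: nearW => n; apply: le_trans (_ : (\sum_(0 <= i < n) (k * c ^+ i)%:E <= _)%E).
    by apply: lee_sum => i _; exact: H.
  rewrite sumEFin lee_fin -mulr_sumr ler_wpM2l// big_mkord.
  have c10 : 0 < 1 - c by rewrite subr_gt0.
  rewrite -[leRHS]mul1r ler_pdivlMr// mulrC.
  have -> : (1 - c) * \sum_(i < n) c ^+ i = 1 - c ^+ n.
    rewrite -[1 in RHS](expr1n R n) subrXX; congr (_ * _);
    by apply: eq_bigr => i _; rewrite expr1n mul1r.
  by rewrite gerBl exprn_ge0.
- move=> x /= nx; apply: contrapT => nl; apply: nx; apply: contrapT => H2.
  apply: nl => n _; apply: contrapT => H3; apply: H2; exists n => m nm Fm.
  by apply: H3; exists m.
Qed.

Lemma mxn_col_row (K : numDomainType) m n (u : 'M[K]_(m, 1)) (v : 'M[K]_(1, n)) :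
  mxn (u *m v) = mxn u * mxn v.
Proof.
rewrite /mxn mulr_suml; apply: eq_bigr => i _.
rewrite !big_ord1 mulr_sumr; apply: eq_bigr => j _.
by rewrite mxE big_ord1 normrM.
Qed.

(** * Periods with a realignment window *)

Section LowerGrowth.
Variables (R : realType) (d : nat) (nu : probability (mseq R d) R).
Hypothesis nu_catn : forall n A, measurable A ->
  nu A = (nu \x nu)%E ((fun p : mseq R d * mseq R d => catn n p.1 p.2) @^-1` A).
Hypothesis d0 : (0 < d)%N.
Local Notation E := (mseq R d).
Hypothesis unit_ae : {ae nu, forall x : E, forall k, x k \in unitmx}.
Hypothesis int_cost : nu.-integrable setT (fun x : E => (cost (x 0%N))%:E).
Local Notation mu := (mean_cost nu).
Local Notation lam := (lyapunov nu).
Variables (l : nat) (c r : R).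
Hypotheses (c01 : 0 < c <= 1) (r01 : 0 < r < 1).
(** The failure probability of a window of [2 K] blocks, in the form produced by the union bound
    over misaligned junctions. *)
Definition gap_prob K : R := (4 * K%:R + 2) * r ^+ K.
Local Notation gap K := (K * l + K * l)%N.
Hypothesis spread : forall K (B : 'M[R]_d), exists S : set E, [/\ measurable S,
  (nu S <= (gap_prob K)%:E)%E &
  forall z : E, (forall k, z k \in unitmx) -> ~ S z ->
    c * (expR (- total_cost (gap K) z) * mxn B) <= `|\tr (B *m mprod z (gap K))|].

Lemma measurable_trace_small (K m : nat) (F : E -> 'M[R]_d) : mxmeasurable F ->
  measurable [set z : E | `|\tr (F z *m mprod (shiftn m z) (gap K))| <
    c * (expR (- total_cost (gap K) (shiftn m z)) * mxn (F z))].
Proof.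
move=> mF; apply: measurable_set_ltr.
  apply: measurableT_comp => //; apply: measurable_mxtrace; apply: mxmeasurableM => //.
  move=> i j; apply: (@measurableT_comp _ _ _ _ _ _ (fun x : E => mprod x (gap K) i j) setT (@shiftn R d m)).
    exact: mxmeasurable_mprod.
  exact: measurable_shiftn.
apply: measurable_funM; first exact: measurable_cst.
apply: measurable_funM; last exact: measurable_mxn.
apply: (measurableT_comp (@measurable_expR R)); apply: measurable_funN.
apply: (@measurableT_comp _ _ _ _ _ _ (fun x : E => total_cost (gap K) x) setT (@shiftn R d m)).
  exact: measurable_total_cost.
exact: measurable_shiftn.
Qed.

Lemma prob_trace_small K (B : 'M[R]_d) (A : set E) : measurable A ->
  A `<=` [set z : E | `|\tr (B *m mprod z (gap K))| < c * (expR (- total_cost (gap K) z) * mxn B)] ->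
  (nu A <= (gap_prob K)%:E)%E.
Proof.
move=> mA AB; have [S [mS nuS HS]] := spread K B.
have [N [mN nuN HN]] := unit_ae.
apply: (@le_trans _ _ (nu (S `|` N))).
  apply: le_measure; rewrite ?inE//; first exact: measurableU.
  move=> z /AB /= Bz; have [Sz|nSz] := pselect (S z); [by left|right].
  apply: HN => /= uz; have := HS z uz nSz.
  by rewrite leNgt Bz.
apply: le_trans (measureU2 _ mS mN) _.
have nuN' : (nu N <= 0)%E by rewrite le_eqVlt; apply/orP; left; apply/eqP; exact: nuN.
by apply: le_trans (leeD nuS nuN') _; rewrite adde0.
Qed.

Variables (K0 L : nat).
Local Notation N := (gap K0).
Local Notation T := (N + L)%N.
Let cd := c / (d%:R * d%:R).

(* A period of [N + L] factors: the first [N] realign the product so that the norm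
   of the next [L] factors is gained up to a constant. *)
Definition fail (B : 'M[R]_d) (x : E) : bool :=
  mxn (B *m mprod x T) <
    cd * (expR (- total_cost N x) * mxn B * mxn (mprod (shiftn N x) L)).

Let dR0 : 0 < d%:R :> R. Proof. by rewrite ltr0n. Qed.

(** A row of [B] and a column of [G] carrying at least a fraction 1/d of the norms combine into a
    rank-one [B'] whose trace against [M] is an entry of [B *m M *m G]. The two choices account for
    the factor [d * d] in [cd]. *)
Lemma fail_trace (B G : 'M[R]_d) : exists2 B' : 'M[R]_d,
  mxn B * mxn G <= d%:R * d%:R * mxn B' &
  forall M, `|\tr (B' *m M)| <= mxn (B *m M *m G).
Proof.
have [k Hk] := mxn_row_ge B d0; have [j Hj] := mxn_col_ge G d0.
exists (col j G *m row k B).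
  by rewrite mxn_col_row [leRHS]mulrACA [leRHS]mulrC ler_pM ?mxn_ge0.
move=> M; have -> : \tr (col j G *m row k B *m M) = (B *m M *m G) k j.
  rewrite -mulmxA mxtrace_mulC /mxtrace big_ord1 -row_mul [LHS]mxE [RHS]mxE.
  by apply: eq_bigr => i _; rewrite [row _ _ _ _]mxE [col _ _ _ _]mxE.
exact: le_mxn.
Qed.

Lemma measurable_fail (F : E -> 'M[R]_d) (t : E -> E) : mxmeasurable F ->
  measurable_fun setT t -> measurable_fun setT (fun x => fail (F x) (t x)).
Proof.
move=> mF mt.
have mc (h : E -> R) : measurable_fun setT h -> measurable_fun setT (fun x => h (t x)).
  by move=> mh; apply: (@measurableT_comp _ _ _ _ _ _ h setT t).
have mm (G : E -> 'M[R]_d) : mxmeasurable G -> mxmeasurable (fun x => G (t x)).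
  by move=> mG i j; apply: (mc (fun x => G x i j)).
apply: measurable_fun_ltr.
  by apply: measurable_mxn; apply: mxmeasurableM => //; apply: (mm (fun x => mprod x T)); exact: mxmeasurable_mprod.
apply: measurable_funM; first exact: measurable_cst.
apply: measurable_funM.
  apply: measurable_funM; last exact: measurable_mxn.
  apply: (measurableT_comp (@measurable_expR R)); apply: measurable_funN.
  by apply: (mc (fun x => total_cost N x)); exact: measurable_total_cost.
apply: measurable_mxn; apply: (mm (fun x => mprod (shiftn N x) L)) => i j.
apply: (@measurableT_comp _ _ _ _ _ _ (fun x : E => mprod x L i j) setT (@shiftn R d N)).
  exact: mxmeasurable_mprod.
exact: measurable_shiftn.
Qed.

Let measurable_fail_cst (B : 'M[R]_d) : measurable_fun setT (fail B).
Proof. by apply: (@measurable_fail (fun=> B) id) => //; exact: mxmeasurable_cst. Qed.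

Let measurable_set_bool (b : E -> bool) : measurable_fun setT b -> measurable [set x | b x].
Proof. by move=> mb; have := mb measurableT [set true]; rewrite setTI; apply. Qed.

(** Given the factors after the window, the window is random between two fixed matrices, and
    [fail_trace] reduces its failure to a small trace. *)
Lemma prob_fail B : (nu [set x | fail B x] <= (gap_prob K0)%:E)%E.
Proof.
have g0 : (0 <= (gap_prob K0)%:E)%E.
  have [S [_ h _]] := spread K0 0; exact: le_trans (measure_ge0 nu S) h.
apply: (prob_catn2_le nu_catn (n := N)) => //; first exact: measurable_set_bool.
move=> y.
have [B' HB Htr] := fail_trace B (mprod y L).
apply: (@prob_trace_small _ B').
  rewrite -[X in measurable X]setTI.
  apply: (measurable_catn1 N y measurableT (Y := [set x | fail B x])).
  exact: measurable_set_bool.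
move=> x /=; rewrite /fail mprodD mprod_catn// total_cost_catn// shiftn_catn mulmxA => h.
apply: le_lt_trans (Htr _) (lt_le_trans h _).
have c0 : 0 <= c by have /andP[/ltW] := c01.
rewrite /cd -mulrA ler_wpM2l// mulrC ler_pdivrMr ?mulr_gt0// -!mulrA ler_wpM2l ?expR_ge0//.
by rewrite [leRHS]mulrC.
Qed.

Definition fails q B (x : E) : R :=
  \sum_(k < q) (fail (B *m mprod x (k * T)) (shiftn (k * T) x))%:R.

Lemma failsS q B x : fails q.+1 B x = (fail B x)%:R + fails q (B *m mprod x T) (shiftn T x).
Proof.
rewrite /fails big_ord_recl mul0n mprod0 mulmx1.
rewrite (_ : shiftn 0 x = x); last by apply/funext.
congr (_ + _).
by apply: eq_bigr => k _; rewrite /= /bump/= mulSn mprodD mulmxA !shiftnD.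
Qed.

Lemma fail_catn B (x y : E) : fail B (catn T x y) = fail B x.
Proof.
rewrite /fail mprod_catn// total_cost_catn ?leq_addr//.
suff -> : mprod (shiftn N (catn T x y)) L = mprod (shiftn N x) L by [].
by apply: eq_mprod => k kL; rewrite /shiftn /catn ltn_add2l kL.
Qed.

Lemma measurable_fails q (F : E -> 'M[R]_d) (t : E -> E) : mxmeasurable F ->
  measurable_fun setT t -> measurable_fun setT (fun x => fails q (F x) (t x)).
Proof.
move=> mF mt; apply: measurable_sum => k.
apply: measurable_natr_bool.
apply: (@measurable_fail (fun x => F x *m mprod (t x) (k * T)) (fun x => shiftn (k * T) (t x))).
  apply: mxmeasurableM => // i j.
  apply: (@measurableT_comp _ _ _ _ _ _ (fun x : E => mprod x (k * T) i j) setT t) => //.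
  exact: mxmeasurable_mprod.
apply: (@measurableT_comp _ _ _ _ _ _ (@shiftn R d (k * T)) setT t) => //.
exact: measurable_shiftn.
Qed.

(** Conditionally on the past a period fails with probability at most [gap_prob K0], whatever
    product precedes it. The exponent [2 * t * _ / 2] has the shape required by [markov_exp]. *)
Lemma exp_fails q t B : 0 <= t ->
  (\int[nu]_x (expR (2 * t * fails q B x / 2))%:E <= ((1 + expR t * gap_prob K0) ^+ q)%:E)%E.
Proof.
move=> t0; have g0 : 0 <= gap_prob K0.
  by have := prob_fail B; rewrite -lee_fin; exact: le_trans (measure_ge0 nu _).
have s0 : 0 <= 1 + expR t * gap_prob K0 by rewrite addr_ge0// mulr_ge0// expR_ge0.
have mexp (Z : E -> R) : measurable_fun setT Z ->
    measurable_fun setT (fun x => (expR (2 * t * Z x / 2))%:E).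
  move=> mZ; apply/measurable_EFinP; apply: (measurableT_comp (@measurable_expR R)).
  apply: measurable_funM => //; apply: measurable_funM => //; exact: measurable_cst.
elim: q B => [|q IHq] B.
  under eq_integral do rewrite /fails big_ord0 mulr0 mul0r expR0.
  by rewrite integral_cst_prob.
pose h (x : E) : R := 1 + expR t * (fail B x)%:R.
have h0 x : 0 <= h x by rewrite addr_ge0// mulr_ge0// expR_ge0.
have mb : measurable_fun setT (fun x => (fail B x)%:R : R) by exact: measurable_natr_bool.
have mh : measurable_fun setT h.
  by apply: measurable_funD => //; apply: measurable_funM.
have mZ k C : measurable_fun setT (fails k C).
  by apply: (@measurable_fails k (fun=> C) id) => //; exact: mxmeasurable_cst.
apply: le_trans (_ : ((1 + expR t * gap_prob K0) ^+ q)%:E * \int[nu]_x (h x)%:E <= _)%E.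
  apply: (integral_catn1_le nu_catn (n := T)) => //.
  - exact: mexp.
  - by rewrite lee_fin exprn_ge0.
  - exact/measurable_EFinP.
  - move=> x; rewrite muleC.
    apply: le_trans (_ : (h x)%:E * \int[nu]_y (expR (2 * t * fails q (B *m mprod x T) y / 2))%:E <= _)%E; last first.
      by rewrite lee_wpmul2l// lee_fin.
    rewrite -ge0_integralZl//; last 2 first.
    + exact: mexp.
    + by rewrite lee_fin.
    apply: ge0_le_integral => //.
    + apply: (@mexp (fun y => fails q.+1 B (catn T x y))).
      apply: (@measurable_fails q.+1 (fun=> B) (catn T x)); first exact: mxmeasurable_cst.
      exact: measurable_catn2.
    + by apply: emeasurable_funM; [exact: measurable_cst|exact: mexp].
    + move=> y _; rewrite -EFinM lee_fin failsS fail_catn shiftn_catn mprod_catn//.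
      rewrite mulrDr mulrDl expRD ler_wpM2r ?expR_ge0// /h.
      case: (fail B x); last by rewrite !mulr0 mul0r expR0 addr0.
      by rewrite !mulr1 mulrAC mulfV// mul1r lerDr.
rewrite exprSr EFinM lee_wpmul2l ?lee_fin ?exprn_ge0//.
rewrite /h; under eq_integral do rewrite EFinD EFinM.
rewrite ge0_integralD//; last first.
  by apply: emeasurable_funM; [exact: measurable_cst|exact/measurable_EFinP].
rewrite integral_cst_prob EFinD leeD2l// ge0_integralZl//; last first.
  exact/measurable_EFinP.
rewrite EFinM lee_wpmul2l ?lee_fin ?expR_ge0//.
apply: le_trans (prob_fail B).
rewrite -[X in (_ <= nu X)%E]setIT -integral_indic//; last exact: measurable_set_bool.
rewrite le_eqVlt; apply/orP; left; apply/eqP; apply: eq_integral => x _.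
by rewrite indicE mem_setE.
Qed.

(** With [t = eta^-1] each period multiplies the exponential moment by at most 2, while the
    threshold [eta * q] gains [expR (- q)]; the bound is summable because 2 < e. *)
Lemma prob_many_fails q eta B : 0 < eta -> gap_prob K0 <= expR (- eta^-1) ->
  (nu [set x | (eta * q%:R <= fails q B x)%R] <= ((2 * expR (- 1)) ^+ q)%:E)%E.
Proof.
move=> eta0 Hp.
have mZ : measurable_fun setT (fun x => 2 * eta^-1 * fails q B x).
  apply: measurable_funM => //.
  by apply: (@measurable_fails q (fun=> B) id) => //; exact: mxmeasurable_cst.
have h2 : (\int[nu]_x (expR (2 * eta^-1 * fails q B x / 2))%:E <= (2 ^+ q)%:E)%E.
  have e0 : 0 <= eta^-1 by rewrite invr_ge0 ltW.
  apply: le_trans (exp_fails q B e0) _; rewrite lee_fin.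
  have g0 : 0 <= gap_prob K0.
    by have := prob_fail B; rewrite -lee_fin; exact: le_trans (measure_ge0 nu _).
  rewrite lerXn2r ?nnegrE//; first by rewrite addr_ge0// mulr_ge0// expR_ge0.
  have : expR eta^-1 * gap_prob K0 <= expR eta^-1 * expR (- eta^-1) by rewrite ler_wpM2l// expR_ge0.
  rewrite -expRD subrr expR0; lra.
have -> : [set x | eta * q%:R <= fails q B x] = [set x | 2 * q%:R <= 2 * eta^-1 * fails q B x].
  by apply/seteqP; split=> x /=;
    rewrite -mulrA ler_pM2l// [eta^-1 * _]mulrC ler_pdivlMr// [q%:R * eta]mulrC.
apply: le_trans (markov_exp (2 * q%:R) mZ h2) _.
rewrite lee_fin exprMn -expRM_natl le_eqVlt; apply/orP; left; apply/eqP.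
congr (_ * expR _); lra.
Qed.

Lemma few_fails eta B : 0 < eta -> gap_prob K0 <= expR (- eta^-1) ->
  {ae nu, forall x : E, exists C, forall q, fails q B x <= C + eta * q%:R}.
Proof.
move=> eta0 Hp.
have e1 : 2 < expR (1 : R) by have := expR_gt1Dx (x := 1 : R); rewrite oner_eq0; apply.
have c1 : 0 <= 2 * expR (- 1 : R) < 1.
  by rewrite mulr_ge0 ?expR_ge0//= expRN ltr_pdivrMr ?mul1r// expR_gt0.
have mF q : measurable [set x | (eta * q%:R <= fails q B x)%R].
  apply: measurable_set_ler; first exact: measurable_cst.
  by apply: (@measurable_fails q (fun=> B) id) => //; exact: mxmeasurable_cst.
have H q : (nu [set x | (eta * q%:R <= fails q B x)%R] <= (1 * (2 * expR (- 1)) ^+ q)%:E)%E.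
  by rewrite mul1r; exact: prob_many_fails.
apply: filterS (geometric_borel_cantelli mF ler01 c1 H) => x [n0 Hn0]; exists n0%:R => q.
have eq0 : 0 <= eta * q%:R by rewrite mulr_ge0// ltW.
have [qn|qn] := leqP n0 q.
  have /negP := Hn0 q qn; rewrite -ltNge => /ltW h.
  by rewrite (le_trans h)// lerDr.
apply: (@le_trans _ _ q%:R); last first.
  by rewrite (@le_trans _ _ n0%:R) ?ler_nat ?lerDl// ltnW.
rewrite -[leRHS]mulr1 mulr_natl -[q in leRHS]card_ord -sumr_const.
by apply: ler_sum => k _; case: (fail _ _); rewrite ?lexx ?ler01.
Qed.

End LowerGrowth.

(** Half of the exponential decay absorbs the linear factor: with [al = - ln r], the constant
    [8 / al] comes from [4 K <= (8 / al) (1 + al K / 2)]. *)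
Lemma gap_prob_geometric (R : realType) (r : R) : 0 < r < 1 ->
  exists k c, [/\ 0 <= k, 0 <= c < 1 & forall K, gap_prob r K <= k * c ^+ K].
Proof.
move=> /andP[r0 r1]; pose al := - ln r.
have al0 : 0 < al by rewrite oppr_gt0 ln_lt0// r0.
have rE : r = expR (- (al / 2)) * expR (- (al / 2)).
  by rewrite -expRD /al -[LHS](lnK (x := r)) ?posrE//; congr expR; lra.
exists (8 / al + 2), (expR (- (al / 2))); split.
- by rewrite addr_ge0// divr_ge0// ltW.
- by rewrite expR_ge0/= -expR0 ltr_expR oppr_lt0 divr_gt0.
move=> K; rewrite /gap_prob rE exprMn mulrA ler_wpM2r ?exprn_ge0 ?expR_ge0//.
rewrite -expRM_natl -ler_pdivlMr ?expR_gt0// -expRN mulrDl.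
have h1 : 1 + al * K%:R / 2 <= expR (- (K%:R * - (al / 2))).
  apply: le_trans (expR_ge1Dx _); lra.
have aK : 0 <= al * K%:R by rewrite mulr_ge0// ltW.
have h2 : 8 / al * (1 + al * K%:R / 2) <= 8 / al * expR (- (K%:R * - (al / 2))).
  by rewrite ler_wpM2l// divr_ge0// ltW.
have h3 : 8 / al * (1 + al * K%:R / 2) = 8 / al + 4 * K%:R by field; rewrite gt_eqF.
have h4 : 0 <= 8 / al by rewrite divr_ge0// ltW.
lra.
Qed.

Section LowerGrowthPeriods.
Variables (R : realType) (d : nat) (nu : probability (mseq R d) R).
Hypothesis nu_catn : forall n A, measurable A ->
  nu A = (nu \x nu)%E ((fun p : mseq R d * mseq R d => catn n p.1 p.2) @^-1` A).
Hypothesis d0 : (0 < d)%N.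
Local Notation E := (mseq R d).
Hypothesis unit_ae : {ae nu, forall x : E, forall k, x k \in unitmx}.
Hypothesis int_cost : nu.-integrable setT (fun x : E => (cost (x 0%N))%:E).
Local Notation mu := (mean_cost nu).
Local Notation lam := (lyapunov nu).
Variables (l : nat) (c r : R).
Hypotheses (c01 : 0 < c <= 1) (r01 : 0 < r < 1).
Local Notation gap K := (K * l + K * l)%N.
Hypothesis spread : forall K (B : 'M[R]_d), exists S : set E, [/\ measurable S,
  (nu S <= (gap_prob r K)%:E)%E &
  forall z : E, (forall k, z k \in unitmx) -> ~ S z ->
    c * (expR (- total_cost (gap K) z) * mxn B) <= `|\tr (B *m mprod z (gap K))|].
Let cd := c / (d%:R * d%:R).
Let ln1 := ln (mxn (1%:M : 'M[R]_d)).

(** The periods that fail are rare but not independent of the costs, which are unbounded. Truncation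
    charges [M] per factor to the failing periods, and the part of the costs above [M] is summed
    over all factors. *)
Definition excess M n (x : nat -> 'M[R]_d) : R := \sum_(k < n) Num.max (cost (x k) - M) 0.

Lemma excessD M n m (x : E) : excess M (n + m) x = excess M n x + excess M m (shiftn n x).
Proof. by rewrite /excess big_split_ord. Qed.

Lemma excess_ge0 M n x : 0 <= excess M n x.
Proof. by apply: sumr_ge0 => k _; rewrite le_max lexx orbT. Qed.

Lemma total_cost_le_excess M n x : total_cost n x <= excess M n x + n%:R * M.
Proof.
have -> : n%:R * M = \sum_(k < n) M by rewrite sumr_const card_ord mulr_natl.
rewrite -big_split/=; apply: ler_sum => k _.
by rewrite -lerBlDr le_max lexx.
Qed.

(** Dominated convergence makes the mean excess smaller than [e] at a high enough level, to which
    the one-sided law applies. *)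
Lemma excess_small e : 0 < e -> exists M : nat,
  {ae nu, forall x : E, exists C : R, forall n, excess M%:R n x <= C + n%:R * e}.
Proof.
move=> e0.
pose f (M : nat) (x : E) := Num.max (cost (x 0%N) - M%:R) 0.
have mf M : measurable_fun setT (f M).
  apply: measurable_maxr; last exact: measurable_cst.
  by apply: measurable_funB; [exact: measurable_cost|exact: measurable_cst].
have f0 M x : 0 <= f M x by rewrite /f le_max lexx orbT.
have fc M x : `|f M x| <= cost (x 0%N).
  rewrite ger0_norm// /f ge_max cost_ge0 andbT lerBlDr lerDl//.
have H : (\int[nu]_x (f M x)%:E)%E @[M --> \oo] --> (\int[nu]_x (cst 0 x))%E.
  apply: (@dominated_cvg _ _ _ nu setT measurableT (fun M x => (f M x)%:E) (cst 0%E)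
    (fun x => (cost (x 0%N))%:E)) => //.
  - by move=> M; apply/measurable_EFinP.
  - move=> x _; apply: cvg_near_cst; exists (Num.truncn (cost (x 0%N))).+1 => // M /= MM.
    rewrite /f max_r// subr_le0 (le_trans (ltW (truncnS_gt _)))// ler_nat//.
  - by move=> M x _; rewrite lee_fin.
have [M HM] : exists M, (\int[nu]_x (f M x)%:E < e%:E)%E.
  apply: contrapT => /forallNP no.
  have : (e%:E <= \int[nu]_x (cst 0 x))%E.
    by apply: cvge_ge H; apply: nearW => M; rewrite leNgt; apply/negP.
  have -> : (\int[nu]_x (cst 0 x) = 0)%E by exact: (integral_cst_prob nu 0%E).
  by rewrite lee_fin leNgt e0.
exists M.
have iM : nu.-integrable setT (EFin \o f M).
  apply: (le_integrable measurableT) int_cost; first exact/measurable_EFinP.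
  by move=> x _; rewrite /= lee_fin [leRHS]ger0_norm ?cost_ge0.
apply: filterS (@one_sided_law R d nu nu_catn 1 (f M) e (mf M) (fun x y => erefl) iM HM).
move=> x [C HC]; exists C => n; apply: le_trans (HC n).
by rewrite le_eqVlt; apply/orP; left; apply/eqP; apply: eq_bigr => k _; rewrite /f /shiftn muln1 addn0.
Qed.

Section Period.
Variables (K0 L : nat).
Local Notation N := (gap K0).
Local Notation T := (N + L)%N.
Local Notation pfail := (@fail R d l c K0 L).
Local Notation pfails := (@fails R d l c K0 L).

Let cd01 : 0 < cd <= 1.
Proof.
have /andP[c0 c1] := c01.
have d1 : 1 <= d%:R :> R by rewrite ler1n.
have dd1 : 1 <= d%:R * d%:R :> R by rewrite -[leLHS]mulr1 ler_pM.
have dd0 : 0 < d%:R * d%:R :> R by rewrite (lt_le_trans _ dd1).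
by rewrite /cd divr_gt0//= ler_pdivrMr// mul1r (le_trans c1).
Qed.

(** A successful period gains the log-norm of the next [L] factors, up to the window cost and
    [ln cd]. In a failing one that gain is still credited, so the cost of these factors is paid
    twice, once for the undue credit and once for the actual loss: hence the factor 2, and [ln1]
    from [log_norm_bound]. *)
Lemma period_step M (B : 'M[R]_d) (x : E) : 0 <= M -> (forall k, x k \in unitmx) -> B != 0 ->
  ln (mxn B) + log_norm L (shiftn N x) + ln cd - total_cost N x
    - (2 * excess M T x + (2 * M * T%:R + ln1) * (pfail B x)%:R)
  <= ln (mxn (B *m mprod x T)).
Proof.
move=> M0 ux B0; have /andP[cd0 cd1] := cd01.
have us n : forall k, shiftn n x k \in unitmx by move=> k; exact: ux.
have BT : expR (- total_cost T x) * mxn B <= mxn (B *m mprod x T) by exact: mxn_mulmx_mprod.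
have pB : 0 < mxn B by rewrite mxn_gt0.
have pT : 0 < mxn (B *m mprod x T) by rewrite (lt_le_trans _ BT)// mulr_gt0// expR_gt0.
have ex0 := excess_ge0 M T x.
have lcd : ln cd <= 0 by rewrite ln_le0.
case Ef: (pfail B x).
  have h1 : ln (mxn B) - total_cost T x <= ln (mxn (B *m mprod x T)).
    have -> : ln (mxn B) - total_cost T x = ln (expR (- total_cost T x) * mxn B).
      by rewrite lnM ?posrE ?expR_gt0// expRK addrC.
    by rewrite ler_ln ?posrE ?mulr_gt0 ?expR_gt0.
  have h2 := total_cost_le_excess M T x.
  have h3 := log_norm_bound d0 L (shiftn N x).
  have h4 := ler_norm (log_norm L (shiftn N x)).
  have h5 := total_costD N L x; have h6 := total_cost_ge0 N x.
  rewrite -/ln1 in h3; rewrite mulr1 in h2 *; nra.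
have h1 : cd * (expR (- total_cost N x) * mxn B * mxn (mprod (shiftn N x) L)) <= mxn (B *m mprod x T).
  by move/negbT: Ef; rewrite /fail -leNgt.
have pG : 0 < mxn (mprod (shiftn N x) L).
  by apply: lt_le_trans (mprod_mxn_ge d0 L (us N)); exact: expR_gt0.
have h2 : ln (cd * (expR (- total_cost N x) * mxn B * mxn (mprod (shiftn N x) L))) <=
    ln (mxn (B *m mprod x T)).
  rewrite ler_ln ?posrE//; apply: mulr_gt0 => //.
  by apply: mulr_gt0 => //; apply: mulr_gt0 => //; exact: expR_gt0.
have pe := expR_gt0 (- total_cost N x).
have pB2 : 0 < expR (- total_cost N x) * mxn B by exact: mulr_gt0.
rewrite lnM ?posrE// ?(mulr_gt0 pB2)// lnM ?posrE// lnM ?posrE// expRK in h2.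
rewrite log_norm_unit// mulr0; lra.
Qed.

Lemma period_sum M (B : 'M[R]_d) (x : E) q : 0 <= M -> (forall k, x k \in unitmx) -> B != 0 ->
  ln (mxn B) + q%:R * ln cd
    - \sum_(k < q) (total_cost N (shiftn (k * T) x) - log_norm L (shiftn N (shiftn (k * T) x)))
    - 2 * excess M (q * T) x - (2 * M * T%:R + ln1) * pfails q B x
  <= ln (mxn (B *m mprod x (q * T))).
Proof.
move=> M0 ux B0; elim: q => [|q IHq].
  by rewrite !mul0n /excess /fails !big_ord0 mprod0 mulmx1 !mulr0 !mul0r !subr0 addr0.
have us n : forall k, shiftn n x k \in unitmx by move=> k; exact: ux.
have Bq : B *m mprod x (q * T) != 0.
  rewrite -mxn_gt0; apply: lt_le_trans (mxn_mulmx_mprod (q * T) B ux).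
  by rewrite mulr_gt0 ?expR_gt0// mxn_gt0.
have := period_step M0 (us (q * T)%N) Bq.
rewrite mulSnr (mprodD (q * T) T) mulmxA (excessD M (q * T) T) /fails !big_ord_recr/= -[q.+1%:R]natr1 => h.
move: IHq; rewrite /fails; lra.
Qed.

End Period.
End LowerGrowthPeriods.

(** * Almost sure lower bounds for norms and traces *)

Section LowerGrowthTraces.
Variables (R : realType) (d : nat) (nu : probability (mseq R d) R).
Hypothesis nu_catn : forall n A, measurable A ->
  nu A = (nu \x nu)%E ((fun p : mseq R d * mseq R d => catn n p.1 p.2) @^-1` A).
Hypothesis d0 : (0 < d)%N.
Local Notation E := (mseq R d).
Hypothesis unit_ae : {ae nu, forall x : E, forall k, x k \in unitmx}.
Hypothesis int_cost : nu.-integrable setT (fun x : E => (cost (x 0%N))%:E).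
Local Notation mu := (mean_cost nu).
Local Notation lam := (lyapunov nu).
Variables (l : nat) (c r : R).
Hypotheses (c01 : 0 < c <= 1) (r01 : 0 < r < 1).
Local Notation gap K := (K * l + K * l)%N.
Hypothesis spread : forall K (B : 'M[R]_d), exists S : set E, [/\ measurable S,
  (nu S <= (gap_prob r K)%:E)%E &
  forall z : E, (forall k, z k \in unitmx) -> ~ S z ->
    c * (expR (- total_cost (gap K) z) * mxn B) <= `|\tr (B *m mprod z (gap K))|].
Let cd := c / (d%:R * d%:R).
Let ln1 := ln (mxn (1%:M : 'M[R]_d)).

(** The order of the choices matters: the truncation level [M], then the tolerated proportion [eta]
    of failing periods, then the window size [K0], and last the length [L], large enough to make the
    fixed loss per period negligible. *)
Theorem norm_lower (B : 'M[R]_d) e : B != 0 -> 0 < e ->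
  {ae nu, forall x : E, exists C : R, forall n, expR (n%:R * (lam - e) - C) <= mxn (B *m mprod x n)}.
Proof.
move=> B0 e0.
have e160 : 0 < e / 16 by lra.
have [M HM] := excess_small nu_catn int_cost e160.
(* Ensures [2 * M * eta <= e / 8], the truncated loss per factor due to failing periods. *)
pose eta := e / (16 * (M%:R + 1)).
have M1 : 0 < M%:R + 1 :> R by rewrite ltr_wpDl.
have eta0 : 0 < eta by rewrite divr_gt0// mulr_gt0.
have [k [c' [k0 c'01 Hk]]] := gap_prob_geometric r01.
have [K0 HK0] := geometric_lt k c'01 (expR_gt0 (- eta^-1)).
have gK0 : gap_prob r K0 <= expR (- eta^-1).
  by rewrite (le_trans (Hk _))// ltW// HK0.
pose N := gap K0.
(* The loss per period that does not grow with [L]: mean window cost, the margin 1 left in [b],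
   growth missed during the window, alignment constant, and the [ln1] of failing periods. *)
pose Q := N%:R * mu + 1 + N%:R * `|lam| - ln cd + ln1 * eta.
pose L := (Num.truncn (4 * Q / e)).+1; pose T := (N + L)%N.
have TQ : Q <= T%:R * (e / 4).
  have h := truncnS_gt (4 * Q / e).
  have h1 : 4 * Q / e <= T%:R.
    by apply: le_trans (ltW h) _; rewrite ler_nat leq_addl.
  rewrite ler_pdivrMr// in h1; lra.
(* Adding the cost makes [log_norm L] nonnegative, so that its integral is preserved by the shift;
   the cost is subtracted again inside [f]. *)
pose g (x : E) := log_norm L x + total_cost L x.
have mg : measurable_fun setT g.
  by apply: measurable_funD; [exact: measurable_log_norm|exact: measurable_total_cost].
have g0 x : 0 <= g x by rewrite /g -lerBlDr sub0r /log_norm le_max lexx orbT.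
have ig : nu.-integrable setT (EFin \o g).
  exact: (integrableD measurableT (integrable_log_norm nu_catn d0 int_cost L) (integrable_total_cost nu_catn int_cost L)).
have Ig : (\int[nu]_x (g x)%:E = (mean_log nu L + L%:R * mu)%:E)%E.
  rewrite EFinD -(integral_log_norm nu_catn d0 int_cost) -(integral_total_cost nu_catn int_cost).
  rewrite -integralD_EFin//; [exact: integrable_log_norm|exact: integrable_total_cost].
pose f (x : E) := total_cost T x - g (shiftn N x).
have mgs : measurable_fun setT (fun x : E => g (shiftn N x)).
  by apply: (@measurableT_comp _ _ _ _ _ _ g setT (@shiftn R d N)) => //; exact: measurable_shiftn.
have Igs : (\int[nu]_x (g (shiftn N x))%:E = (mean_log nu L + L%:R * mu)%:E)%E.
  rewrite -Ig -[RHS](integral_shiftn nu_catn N)//; first exact/measurable_EFinP.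
have igs : nu.-integrable setT (EFin \o (fun x : E => g (shiftn N x))).
  apply/integrableP; split; first exact/measurable_EFinP.
  rewrite (eq_integral (fun x => (g (shiftn N x))%:E)); first by rewrite Igs ltry.
  by move=> x _; rewrite /= ger0_norm.
have mf : measurable_fun setT f.
  by apply: measurable_funB => //; exact: measurable_total_cost.
have fE x : f x = total_cost N x - log_norm L (shiftn N x).
  by rewrite /f /g total_costD; ring.
have fT (x y : E) : f (catn T x y) = f x.
  rewrite !fE total_cost_catn ?leq_addr//.
  have e1 k' : (k' < L)%N -> shiftn N (catn T x y) k' = shiftn N x k'.
    by move=> kL; rewrite /shiftn /catn ltn_add2l kL.
  rewrite /log_norm (eq_mprod e1).
  suff -> : total_cost L (shiftn N (catn T x y)) = total_cost L (shiftn N x) by [].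
  by apply: eq_bigr => k' _; rewrite e1.
have itc := integrable_total_cost nu_catn int_cost T.
have intf : nu.-integrable setT (EFin \o f) by exact: (integrableB measurableT itc igs).
pose b := N%:R * mu - mean_log nu L + 1.
have fb : (\int[nu]_x (f x)%:E < b%:E)%E.
  have -> : (\int[nu]_x (f x)%:E = \int[nu]_x (total_cost T x)%:E - \int[nu]_x (g (shiftn N x))%:E)%E.
    by rewrite -integralB_EFin.
  rewrite Igs (integral_total_cost nu_catn int_cost) -EFinB lte_fin /b /T natrD; lra.
have HF := few_fails nu_catn d0 unit_ae c01 spread L B eta0 gK0.
have HS := one_sided_law nu_catn mf fT intf fb.
have e40 : 0 < e / 4 by lra.
have HT := tail_cost nu_catn int_cost e40.
apply: filterS2 (filterI unit_ae HM) (filterI HF (filterI HS HT)).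
move=> x [ux [C2 H2]] [[C3 H3] [[C1 H1] [C4 C40 H4]]].
exists (`|- ln (mxn B) + C1 + 2 * C2 + (2 * M%:R * T%:R + ln1) * C3| + T%:R * `|lam - e / 2| + C4 + T%:R * mu) => n.
set C5 := - ln (mxn B) + _ + _ + _.
pose q := (n %/ T)%N; pose s := (n %% T)%N.
have nE : n = (q * T + s)%N by exact: divn_eq.
have T0 : (0 < T)%N by rewrite /T addnS.
have sT : (s < T)%N by rewrite ltn_mod.
have qn : (q * T <= n)%N by rewrite [leqRHS]nE leq_addr.
have ns : (n - q * T = s)%N by rewrite {1}nE addKn.
have h4 := H4 _ _ qn; rewrite ns in h4.
have h1 := H1 q; have h2 := H2 (q * T)%N; have h3 := H3 q.
have hp : ln (mxn B) + q%:R * ln cd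
    - \sum_(k < q) (total_cost N (shiftn (k * T) x) - log_norm L (shiftn N (shiftn (k * T) x)))
    - 2 * excess M%:R (q * T) x - (2 * M%:R * T%:R + ln1) * fails l c K0 L q B x
  <= ln (mxn (B *m mprod x (q * T))) := period_sum d0 l c01 K0 L q (ler0n R M) ux B0.
have h5 : \sum_(k < q) (total_cost N (shiftn (k * T) x) - log_norm L (shiftn N (shiftn (k * T) x)))
    <= C1 + q%:R * b.
  by apply: le_trans h1; apply: ler_sum => i _; rewrite fE.
have Bq : 0 < mxn (B *m mprod x (q * T)).
  apply: lt_le_trans (mxn_mulmx_mprod (q * T) B ux).
  by rewrite mulr_gt0 ?expR_gt0// mxn_gt0.
have ln10 : 0 <= ln1 by rewrite /ln1 ln_ge0// mxn1_ge1.
(* Half of [e] is spent here: [e / 4] on [Q], [e / 8] on the failing periods and [e / 8] on twice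
   the excess. The other half pays for the incomplete last period. *)
have key : (q * T)%:R * (lam - e / 2) - C5 <= ln (mxn (B *m mprod x (q * T))).
  apply: le_trans hp.
  have hA : 0 <= 2 * M%:R * T%:R + ln1 by rewrite addr_ge0// !mulr_ge0.
  have hF : (2 * M%:R * T%:R + ln1) * fails l c K0 L q B x <=
      (2 * M%:R * T%:R + ln1) * C3 + q%:R * (T%:R * (e / 8)) + q%:R * (ln1 * eta).
    apply: le_trans (ler_wpM2l hA h3) _.
    rewrite mulrDr -addrA lerD2l mulrDl.
    have -> : ln1 * (eta * q%:R) = q%:R * (ln1 * eta) by ring.
    rewrite lerD2r.
    have -> : 2 * M%:R * T%:R * (eta * q%:R) = q%:R * (T%:R * (2 * M%:R * eta)) by ring.
    rewrite ler_wpM2l// ler_wpM2l// /eta mulrA ler_pdivrMr ?mulr_gt0//.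
    have : 0 <= M%:R :> R by []. 
    nra.
  have hL : q%:R * (L%:R * lam) <= q%:R * mean_log nu L.
    by rewrite ler_wpM2l// lyapunov_le.
  have hNl : q%:R * (N%:R * lam) <= q%:R * (N%:R * `|lam|).
    by rewrite !ler_wpM2l// ler_norm.
  have hQ : q%:R * Q <= q%:R * (T%:R * (e / 4)) by rewrite ler_wpM2l.
  have TE : T%:R = N%:R + L%:R :> R by rewrite natrD.
  have hqT : (q * T)%:R = q%:R * N%:R + q%:R * L%:R :> R by rewrite natrM TE mulrDr.
  rewrite /C5; rewrite /b in h5; rewrite /Q in hQ; rewrite TE in hQ hF *; rewrite hqT in h2 *.
  clearbody cd ln1; move: h5 h2 hQ hF hL hNl.
  move: (\sum_(k < q) _) (excess _ _ _) (fails _ _ _ _ _ _ _) => s1 s2 s3.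
  lra.
rewrite {2}nE mprodD mulmxA.
apply: le_trans (mxn_mulmx_mprod s _ (fun k => ux _)).
rewrite -[mxn (B *m mprod x (q * T))](lnK (x := _)) ?posrE// -expRD ler_expR.
have sT' : s%:R <= T%:R :> R by rewrite ler_nat ltnW.
have mu0 : 0 <= mu := mean_cost_ge0 nu.
have h6 : s%:R * mu <= T%:R * mu by rewrite ler_wpM2r.
have h7 : n%:R * (lam - e / 2) - T%:R * `|lam - e / 2| <= (q * T)%:R * (lam - e / 2).
  have -> : (q * T)%:R = n%:R - s%:R :> R by rewrite {1}nE natrD addrK.
  rewrite mulrBl lerD2l lerN2.
  apply: le_trans (_ : s%:R * `|lam - e / 2| <= _); last by rewrite ler_wpM2r.
  by rewrite ler_wpM2l// ler_norm.
have n0 : 0 <= n%:R * e by rewrite mulr_ge0// ltW.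
have := ler_norm C5.
lra.
Qed.

(* The realigning window at the end of the product has length about n times a small
   constant: exponentially small failure probability, cost at most n e / 8. *)
Theorem trace_lower (B : 'M[R]_d) e : B != 0 -> 0 < e ->
  {ae nu, forall x : E, exists n0, forall n, (n0 <= n)%N ->
    expR (n%:R * (lam - e)) <= `|\tr (B *m mprod x n)|}.
Proof.
move=> B0 e0; have mu0 : 0 <= mu := mean_cost_ge0 nu.
have [k [c' [k0 /andP[c'0 c'1] Hk]]] := gap_prob_geometric r01.
(* With [n %/ q] as window parameter, the window has at most [2 l n / q] factors, so its mean cost
   and missed growth are at most [n * (e / 8)]. The summand [l + l] makes the window fit into [n]
   factors, and [.+2] gives [q >= 2]. *)
pose q := ((Num.truncn (16 * l%:R * (mu + `|lam|) / e)).+2 + (l + l))%N.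
have q1 : (1 < q)%N by [].
have lq : (l + l <= q)%N by rewrite leq_addl.
have hq : 16 * l%:R * (mu + `|lam|) <= q%:R * e.
  rewrite -ler_pdivrMr// (le_trans (ltW (truncnS_gt _)))// ler_nat.
  by apply: leq_trans (leq_addr _ _); exact: leqnSn.
clearbody q; pose K n := (n %/ q)%N.
have gapE m : gap m = (m * (l + l))%N by rewrite mulnDr.
have gap_le n : (gap (K n) <= n)%N.
  rewrite gapE; apply: leq_trans (leq_divM n q).
  by rewrite leq_mul2l lq orbT.
pose F n := [set z : E | `|\tr (B *m mprod z (n - gap (K n)) *m mprod (shiftn (n - gap (K n)) z) (gap (K n)))| <
   c * (expR (- total_cost (gap (K n)) (shiftn (n - gap (K n)) z)) * mxn (B *m mprod z (n - gap (K n))))].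
have mF n : measurable (F n).
  apply: (@measurable_trace_small R d l c (K n) _ (fun z => B *m mprod z (n - gap (K n)))).
  by apply: mxmeasurableM; [exact: mxmeasurable_cst|exact: mxmeasurable_mprod].
(* Bernoulli's inequality gives [c' <= c2 ^+ q]: a substitute for the [q]-th root of [c'], turning
   decay in [n %/ q] into geometric decay in [n]. *)
pose c2 := 1 - (1 - c') / q%:R.
have q2 : 2 <= q%:R :> R by rewrite ler_nat.
have qR : 0 < q%:R :> R by lra.
have cq1 : (1 - c') / q%:R <= 2^-1 by rewrite ler_pdivrMr//; lra.
have cq0 : 0 < (1 - c') / q%:R by rewrite divr_gt0// subr_gt0.
have c20 : 0 < c2 by rewrite /c2; lra.
have c21 : c2 < 1 by rewrite /c2; lra.
have c'2 : c' <= c2 ^+ q.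
  have bern p : 1 - p%:R * ((1 - c') / q%:R) <= c2 ^+ p.
    elim: p => [|p IHp]; first by rewrite mul0r subr0 expr0.
    have := ler_wpM2l (ltW c20) IHp; rewrite -exprS -[p.+1%:R]natr1 {1}/c2.
    have := mulr_ge0 (mulr_ge0 (ler0n R p) (ltW cq0)) (ltW cq0).
    lra.
  by have := bern q; rewrite mulrCA mulfV ?gt_eqF// mulr1 subKr.
have HF n : (nu (F n) <= ((k / c2 ^+ q) * c2 ^+ n)%:E)%E.
  have h1 : gap_prob r (K n) <= k / c2 ^+ q * c2 ^+ n.
    apply: le_trans (Hk _) _; rewrite -mulrA ler_wpM2l//.
    rewrite mulrC ler_pdivlMr ?exprn_gt0//.
    apply: le_trans (_ : c2 ^+ (q * K n) * c2 ^+ q <= _).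
      rewrite ler_wpM2r ?exprn_ge0 ?(ltW c20)// exprM lerXn2r ?nnegrE//.
      by rewrite exprn_ge0// ltW.
    rewrite -exprD -mulnSr ler_wiXn2l ?(ltW c20) ?(ltW c21)//.
    by rewrite mulnC ltnW// ltn_ceil// ltnW.
  have g0 : (0 <= (gap_prob r (K n))%:E)%E.
    have [S [_ h _]] := spread (K n) 0; exact: le_trans (measure_ge0 nu S) h.
  apply: le_trans (_ : (gap_prob r (K n))%:E <= _)%E; last by rewrite lee_fin.
  apply: (prob_catn1_le nu_catn (n := (n - gap (K n))%N)) => // x.
  apply: (prob_trace_small unit_ae spread (K := K n) (B := B *m mprod x (n - gap (K n)))).
    rewrite -[X in measurable X]setTI.
    exact: (measurable_catn2 (n - gap (K n)) x measurableT (Y := F n)).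
  move=> y Fy; have : F n (catn (n - gap (K n)) x y) := Fy.
  by rewrite /F [mkset _ _]/= (mprod_catn x y (leqnn _)) shiftn_catn.
have k'0 : 0 <= k / c2 ^+ q by rewrite divr_ge0// exprn_ge0// ltW.
have c2b : 0 <= c2 < 1 by rewrite (ltW c20).
have e80 : 0 < e / 8 by rewrite divr_gt0.
apply: filterS2 (filterI unit_ae (geometric_borel_cantelli mF k'0 c2b HF))
  (filterI (tail_cost nu_catn int_cost e80) (norm_lower B0 e80)).
move=> x [ux [n1 Hn1]] [[C1 C10 H1] [C2 H2]].
exists (maxn n1 (Num.truncn ((C1 + C2 - ln c) * 2 / e)).+1) => n.
rewrite geq_max => /andP[nn1 nn2].
have nF := Hn1 n nn1.
have hn : C1 + C2 - ln c <= n%:R * (e / 2).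
  have h : (C1 + C2 - ln c) * 2 / e <= n%:R.
    by apply: le_trans (ltW (truncnS_gt _)) _; rewrite ler_nat.
  rewrite ler_pdivrMr// in h; lra.
have gn := gap_le n.
have h1 := H1 _ _ (leq_subr (gap (K n)) n); rewrite subKn// in h1.
have h2 := H2 (n - gap (K n))%N.
have [c0 _] := andP c01.
have trE : \tr (B *m mprod x n) = \tr (B *m mprod x (n - gap (K n)) *m mprod (shiftn (n - gap (K n)) x) (gap (K n))).
  by rewrite -mulmxA -mprodD subnK.
move/negP: nF; rewrite -leNgt -trE => h3.
apply: le_trans h3.
apply: le_trans (_ : c * (expR (- total_cost (gap (K n)) (shiftn (n - gap (K n)) x)) *
  expR ((n - gap (K n))%:R * (lam - e / 8) - C2)) <= _); last first.
  by rewrite ler_wpM2l ?(ltW c0)// ler_wpM2l ?expR_ge0.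
rewrite -{1}[c](lnK (x := c)) ?posrE// -!expRD ler_expR natrB//.
have h4 : (gap (K n))%:R * (mu + `|lam|) <= n%:R * (e / 8).
  rewrite gapE natrM natrD.
  have h5 : (K n)%:R * q%:R <= n%:R :> R by rewrite -natrM ler_nat leq_divM.
  have h6 : (K n)%:R * (16 * l%:R * (mu + `|lam|)) <= (K n)%:R * (q%:R * e) by rewrite ler_wpM2l.
  have h7 := ler_wpM2r (ltW e0) h5.
  lra.
have h8 : - `|lam| <= lam by rewrite lerNl -normrN ler_norm.
have g0 : 0 <= (gap (K n))%:R :> R by [].
have h9 : (gap (K n))%:R * lam <= (gap (K n))%:R * `|lam| by rewrite ler_wpM2l// ler_norm.
have h10 : 0 <= (gap (K n))%:R * e by rewrite mulr_ge0// ltW.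
have h11 : 0 <= n%:R * e by rewrite mulr_ge0// ltW.
lra.
Qed.

End LowerGrowthTraces.

(** * Irreducibility and general position *)

Section InvariantCover.
Variables (F : fieldType) (vT : vectType F) (S : 'End(vT) -> Prop) (O : vT -> Prop).
Hypothesis S_inj : forall f, S f -> lker f = 0%VS.
Hypothesis SO : forall f x, S f -> O x -> O (f x).
Local Notation dimT := (\dim {:vT}).

Definition covers (s : seq {vspace vT}) := forall x, O x -> exists2 V, V \in s & x \in V.

(* Among finite covers of [O], minimize the largest dimension [k], then the number of
   members of dimension [k]; intersecting with preimages under [f] cannot
   improve the cover, so [f] permutes these members. *)
Lemma invariant_cover s0 u : O u -> u != 0 -> covers s0 ->
  (forall V : {vspace vT}, V \in s0 -> V != fullv) ->
  exists s : seq {vspace vT}, [/\ s != [::],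
    forall V : {vspace vT}, V \in s -> (0 < \dim V < dimT)%N &
    forall f, S f -> forall V : {vspace vT}, V \in s -> (f @: V)%VS \in s].
Proof.
move=> Ou u0 cov0 proper0.
have dim_lt (V : {vspace vT}) : V != fullv -> (\dim V < dimT)%N.
  move=> Vf; rewrite ltn_neqAle (dimvS (subvf V)) andbT.
  by apply: contra Vf => /eqP e; rewrite eqEdim subvf e leqnn.
pose P k := `[< exists2 s, covers s & forall V : {vspace vT}, V \in s -> (\dim V <= k)%N >].
have dimT0 : (0 < dimT)%N.
  have [V Vs uV] := cov0 _ Ou; exact: leq_ltn_trans (dim_lt _ (proper0 _ Vs)).
have exP : exists k, P k.
  exists dimT.-1; apply/asboolP; exists s0 => // V Vs.
  by rewrite -ltnS prednK// dim_lt// proper0.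
have [k /asboolP[s1 cov1 dim1] kmin] := ex_minnP exP.
have kT : (k < dimT)%N.
  rewrite -(prednK dimT0) ltnS; apply: kmin; apply/asboolP; exists s0 => // V Vs.
  by rewrite -ltnS prednK// dim_lt// proper0.
have k0 : (0 < k)%N.
  have [V Vs uV] := cov1 _ Ou; apply: leq_trans (dim1 _ Vs).
  rewrite lt0n dimv_eq0; apply: contra u0 => /eqP V0.
  by move: uV; rewrite V0 memv0.
pose top (s : seq {vspace vT}) := undup [seq V <- s | \dim V == k].
pose Q N := `[< exists s, [/\ covers s, forall V : {vspace vT}, V \in s -> (\dim V <= k)%N
   & size (top s) = N] >].
have exQ : exists N, Q N by exists (size (top s1)); apply/asboolP; exists s1.
have [N /asboolP[s [cov dims sN]] Nmin] := ex_minnP exQ.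
have memtop s' (V : {vspace vT}) : (V \in top s') = (V \in s') && (\dim V == k).
  by rewrite mem_undup mem_filter andbC.
exists (top s); split.
- apply/eqP => t0; suff /kmin : P k.-1 by case: (k) k0 => // k' _; rewrite ltnn.
  apply/asboolP; exists s => // V Vs; rewrite -ltnS prednK// ltn_neqAle dims// andbT.
  apply/negP => Vk; have : V \in top s by rewrite memtop Vs.
  by rewrite t0.
- by move=> V; rewrite memtop => /andP[_ /eqP ->]; rewrite k0.
move=> f Sf V Vt.
pose t := [seq (A :&: (f @^-1: B))%VS | A <- s, B <- s].
have memt C : C \in t -> exists A B, [/\ A \in s, B \in s & C = (A :&: (f @^-1: B))%VS].
  by move=> /allpairsP[[A B] /= [As Bs ->]]; exists A, B.
have Qt : Q (size (top t)).
  apply/asboolP; exists t; split => //.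
  - move=> x Ox; have [A As xA] := cov _ Ox; have [B Bs fB] := cov _ (SO Sf Ox).
    exists (A :&: (f @^-1: B))%VS; first by apply/allpairsP; exists (A, B).
    by rewrite memv_cap xA -memv_preim.
  - move=> C /memt[A [B [As _ ->]]]; apply: leq_trans (dims _ As).
    exact: (dimvS (capvSl _ _)).
have sub : {subset top t <= top s}.
  move=> C; rewrite !memtop => /andP[/memt[A [B [As _ ->]]] /eqP Ck].
  suff e : A = (A :&: (f @^-1: B))%VS by rewrite -e in Ck *; rewrite As Ck eqxx.
  apply/eqP; rewrite eq_sym eqEdim capvSl Ck; exact: dims.
(* The list [top t] has no repetition, is contained in [top s] and by minimality of [N] is at least
   as long, so the two have the same members. Hence [V] is an intersection of some [A] with a
   preimage of some [B], and the image of [V] fills [B] by dimension. *)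
have [_ eqts] := uniq_min_size (undup_uniq _) sub (leq_trans (eq_leq sN) (Nmin _ Qt)).
move: Vt; rewrite -eqts !memtop => /andP[/memt[A [B [As Bs VE]]] /eqP Vk].
have fVB : (f @: V <= B)%VS.
  apply/subvP => _ /memv_imgP[x xV ->].
  by move: xV; rewrite VE memv_cap memv_preim => /andP[].
have fVk : \dim (f @: V) = k.
  by rewrite -Vk limg_dim_eq// (S_inj Sf) capv0.
rewrite fVk eqxx andbT; suff -> : (f @: V)%VS = B by [].
by apply/eqP; rewrite eqEdim fVB fVk dims.
Qed.
End InvariantCover.

(** A line [v + t u] lying in no member of the list meets each member at most once, since two hits
    would put [u], hence [v], into it. A large integer [t] therefore avoids all of them. *)
Lemma exists_avoiding (K : numFieldType) (vT : vectType K) (V : {vspace vT}) (s : seq {vspace vT}) :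
  (forall U, U \in s -> ~~ (V <= U)%VS) -> exists2 v, v \in V & forall U, U \in s -> v \notin U.
Proof.
elim: s => [|U s IHs] H; first by exists 0; rewrite ?mem0v.
have [v vV Hv] := IHs (fun W Ws => H W (mem_behead (s := U :: s) Ws)).
have [vU|vU] := boolP (v \in U); last first.
  by exists v => // W; rewrite inE => /predU1P[->|]//; exact: Hv.
have [u uV uU] : exists2 u, u \in V & u \notin U.
  apply: contrapT => no; move: (H U (mem_head _ _)) => /negP; apply.
  apply/subvP => u uV; apply: contrapT => /negP uU; apply: no; by exists u.
have [t0 Ht0] : exists t0, forall t : nat, (t0 <= t)%N -> forall W, W \in s -> v + t%:R *: u \notin W.
  elim: s Hv {IHs H} => [|W s IHs] Hv; first by exists 0%N.
  have [t1 H1] := IHs (fun W' Ws => Hv W' (mem_behead (s := W :: s) Ws)).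
  have vW := Hv W (mem_head _ _).
  have [t2 H2] : exists t2, forall t : nat, (t2 <= t)%N -> v + t%:R *: u \notin W.
    apply: contrapT => /forallNP no.
    have bad t2 : exists2 t : nat, (t2 <= t)%N & v + t%:R *: u \in W.
      apply: contrapT => no'; apply: (no t2) => t tt; apply/negP => tW; apply: no'; by exists t.
    have [a _ aW] := bad 0%N; have [b ab bW] := bad a.+1.
    have uW : u \in W.
      have := rpredB bW aW; rewrite opprD addrACA subrr add0r -scalerBl rpredZeq subr_eq0 eqr_nat.
      by rewrite (gtn_eqF ab).
    by move: vW; rewrite -(addrK (a%:R *: u) v) rpredB// rpredZ.
  exists (maxn t1 t2) => t; rewrite geq_max => /andP[tt1 tt2] W'.
  rewrite inE => /predU1P[->|]; [exact: H2|exact: H1].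
exists (v + t0.+1%:R *: u); first by rewrite rpredD// rpredZ.
move=> W; rewrite inE => /predU1P[->|]; last by apply: Ht0.
by rewrite rpredDl// rpredZeq pnatr_eq0/=.
Qed.

Section GeneralPosition.
Variables (F : fieldType) (vT : vectType F) (O : vT -> Prop).
Hypothesis rich : forall s : seq {vspace vT}, (forall V : {vspace vT}, V \in s -> V != fullv) ->
  exists2 x, O x & forall V : {vspace vT}, V \in s -> x \notin V.

(* Each new vector avoids the proper spans of all sublists of the previous ones. *)
Lemma general_position M : exists xs : seq vT, [/\ size xs = M, forall x, x \in xs -> O x &
  forall V : {vspace vT}, V != fullv -> (count (mem V) xs <= \dim V)%N].
Proof.
elim: M => [|M [xs [sxs Oxs Hxs]]]; first by exists [::].
pose spans := [seq <<mask (tval m) xs>>%VS | m : (size xs).-tuple bool].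
have [x Ox Hx] := @rich [seq V <- spans | V != fullv] (fun V => ltac:(by rewrite mem_filter => /andP[])).
exists (x :: xs); split => /=; first by rewrite sxs.
  by move=> y; rewrite inE => /predU1P[->|]//; exact: Oxs.
move=> V Vf; have [xV|xV] := boolP (x \in V); last by rewrite add0n Hxs.
pose W := [seq y <- xs | y \in V]; pose U := <<W>>%VS.
have UV : (U <= V)%VS by apply/span_subvP => y;  rewrite mem_filter => /andP[].
have Uf : U != fullv.
  by apply: contra Vf => /eqP Uf; rewrite eqEsubv subvf -Uf.
have xU : x \notin U.
  apply: Hx; rewrite mem_filter Uf /U /W filter_mask.
  have sz : size (map (mem V) xs) == size xs by rewrite size_map.
  by apply/mapP; exists (Tuple sz) => //; rewrite mem_enum.
have cU : (count (mem V) xs <= count (mem U) xs)%N.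
  have -> : count (mem V) xs = count (mem U) W.
    rewrite -size_filter; apply/esym/eqP; rewrite -all_count; apply/allP => y yW.
    exact: memv_span.
  by rewrite count_filter; apply: sub_count => y /andP[].
(* The previous vectors in [V] span a subspace [U] missing the new vector [x] of [V], so adding [x]
   to the count is paid for by one dimension. *)
have dUV : (\dim U < \dim V)%N.
  rewrite ltn_neqAle (dimvS UV) andbT; apply: contra xU => /eqP e.
  suff <- : V = U by [].
  by apply/eqP; rewrite eq_sym eqEdim UV e leqnn.
by rewrite add1n (leq_ltn_trans cU)// (leq_ltn_trans (Hxs _ Uf)).
Qed.
End GeneralPosition.

(** * Matrices acting on finite families of subspaces *)

Section MatrixSpaces.
Variables (K : numFieldType) (d : nat).
Local Notation V := 'cV[K]_d.

Definition mulfun (M : 'M[K]_d) : 'End(V) := linfun (mulmx M : V -> V).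

Lemma mulfunE M x : mulfun M x = M *m x.
Proof. by rewrite lfunE. Qed.

Lemma dim_colvectors : \dim {:V} = d.
Proof. rewrite dimvf; exact: muln1. Qed.

Lemma lker_mulfun M : M \in unitmx -> lker (mulfun M) = 0%VS.
Proof.
move=> uM; apply/eqP/lker0P => x y; rewrite !mulfunE => e.
by rewrite -(mulKmx uM x) e mulKmx.
Qed.

(** Encoding a subspace by a projection turns membership into a matrix equation. This gives
    annihilators as kernels and makes events about subspaces measurable. *)
Lemma proj_matrix (U : {vspace V}) : exists F : 'M[K]_d, forall x,
  F *m x \in U /\ (x \in U -> F *m x = x).
Proof.
exists (\matrix_(i, j) projv U (delta_mx j 0 : V) i 0) => x.
have -> : (\matrix_(i, j) projv U (delta_mx j 0 : V) i 0) *m x = projv U x.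
  apply/colP => i; rewrite mxE {2}[x]matrix_sum_delta linear_sum summxE.
  apply: eq_bigr => j _; rewrite big_ord1 linearZ/= [in RHS]mxE mxE mulrC.
  by congr (_ * _).
by split; [exact: memv_proj|exact: projv_id].
Qed.

Lemma annihilator (U : {vspace V}) : exists A : {vspace V},
  forall x, (x \in A) <-> (forall z, z \in U -> z^T *m x = 0).
Proof.
have [F HF] := proj_matrix U; exists (lker (mulfun F^T)) => x.
rewrite memv_ker mulfunE; split.
  move=> /eqP Fx z zU; have [_ /(_ zU) <-] := HF z.
  by rewrite trmx_mul -mulmxA Fx mulmx0.
move=> H; apply/eqP/colP => i; rewrite [RHS]mxE.
have [Fd _] := HF (delta_mx i 0); have := H _ Fd.
rewrite trmx_mul -mulmxA trmx_delta -rowE => /matrixP/(_ 0 0).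
by rewrite mxE => ->; rewrite mxE.
Qed.

Lemma dim_gt0P (U : {vspace V}) : reflect (exists2 x, x \in U & x != 0) (0 < \dim U)%N.
Proof.
rewrite lt0n dimv_eq0; apply: (iffP idP).
  move=> U0; exists (vpick U); [exact: memv_pick|by rewrite vpick0].
by move=> [x xU]; apply: contra => /eqP U0; move: xU; rewrite U0 memv0.
Qed.

Lemma dim_ltP (U : {vspace V}) : reflect (exists x, x \notin U) (\dim U < d)%N.
Proof.
apply: (iffP idP) => [Ud|[x xU]].
  apply: contrapT => /forallNP no; move: Ud; rewrite ltnNge -{1}dim_colvectors.
  move=> /negP; apply; apply: dimvS; apply/subvP => x _.
  by apply: contrapT => /negP xU; exact: (no x).
rewrite -[X in (_ < X)%N]dim_colvectors ltnNge; apply: contra xU => le.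
suff -> : U = fullv by exact: memvf.
by apply/eqP; rewrite eqEdim subvf.
Qed.

(** Formulated on the members of the family rather than on their union: a family stable member by
    member has a stable union, so (ii) excludes it. *)
Definition strongly_irreducible (S : 'M[K]_d -> Prop) :=
  forall s : seq {vspace V}, s != [::] -> (forall U, U \in s -> (0 < \dim U < d)%N) ->
  exists2 M, S M & exists2 U, U \in s & (mulfun M @: U)%VS \notin s.

(* Annihilators turn an invariant family for the transposes into one for [S]. *)
Lemma strongly_irreducible_tr S : (forall M, S M -> M \in unitmx) ->
  strongly_irreducible S -> strongly_irreducible (fun M => S M^T).
Proof.
move=> uS irr s s0 dims; apply: contrapT => no.
have inv M U : S M -> U \in s -> (mulfun M^T @: U)%VS \in s.
  move=> SM Us; apply: contrapT => /negP H; apply: no.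
  by exists M^T; [rewrite trmxK|exists U].
pose t := undup s.
(* An injective self-map of a finite family is onto; annihilators reverse the action, so preimages
   within the family are required. *)
have surj M U : S M -> U \in s -> exists2 U', U' \in s & U = (mulfun M^T @: U')%VS.
  move=> SM Us; pose f U := (mulfun M^T @: U)%VS.
  have injf : injective f.
    move=> A B AB; have uM : M^T \in unitmx by rewrite unitmx_tr uS.
    have sub (A' B' : {vspace V}) : f A' = f B' -> (A' <= B')%VS.
      move=> e; apply/subvP => x xA; have : mulfun M^T x \in f B' by rewrite -e memv_img.
      move=> /memv_imgP[y yB]; rewrite !mulfunE => /(congr1 (mulmx (invmx M^T))).
      by rewrite !mulKmx// => ->.
    by apply/eqP; rewrite eqEsubv !sub.
  have sub : {subset map f t <= t}.
    by move=> _ /mapP[A At ->]; rewrite mem_undup; apply: inv => //; rewrite -mem_undup.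
  have ut : uniq (map f t) by rewrite map_inj_uniq// undup_uniq.
  have [_ e] := uniq_min_size ut sub (eq_leq (esym (size_map f t))).
  have : U \in t by rewrite mem_undup.
  by rewrite -e => /mapP[U' U't ->]; exists U' => //; rewrite -mem_undup.
have [ann Hann] := @choice _ _ _ annihilator.
have [||M SM [A]] := irr (map ann s).
- by case: (s) s0.
- move=> _ /mapP[U Us ->]; have /andP[/dim_gt0P[z zU z0] /dim_ltP[y yU]] := dims _ Us.
  apply/andP; split; last first.
    apply/dim_ltP; apply: contrapT => /forallNP no'; move/eqP: z0; apply; apply/colP => i.
    have /negP/negPn/(Hann U) := no' (delta_mx i 0).
    move=> /(_ z zU); rewrite -colE => /matrixP/(_ 0 0).
    by rewrite !mxE.
  have [F HF] := proj_matrix U.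
  apply: contrapT => /negP; rewrite -eqn0Ngt dimv_eq0 => /eqP A0.
  have : kermx F != 0.
    apply/eqP => kF0; move/negP: yU; apply.
    have uF : F \in unitmx by rewrite -row_free_unit -kermx_eq0 kF0.
    by have [] := HF (invmx F *m y); rewrite mulKVmx.
  move=> /rowV0Pn[r /sub_kermxP rF r0].
  have : r^T \in ann U.
    apply/Hann => w wU; have [_ /(_ wU) <-] := HF w.
    by rewrite -trmx_mul mulmxA rF mul0mx trmx0.
  by rewrite A0 memv0 trmx_eq0 (negPf r0).
move=> /mapP[U Us ->] /negP; apply.
have [U' U's ->] := surj _ _ SM Us.
suff -> : (mulfun M @: ann (mulfun M^T @: U'))%VS = ann U' by exact: map_f.
apply/eqP; rewrite eqEsubv; apply/andP; split; apply/subvP => x.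
  move=> /memv_imgP[y /Hann yA ->]; apply/Hann => z zU.
  have := yA (mulfun M^T z) (memv_img _ zU).
  by rewrite !mulfunE trmx_mul trmxK mulmxA.
move=> /Hann xA; apply/memv_imgP; exists (invmx M *m x); last first.
  by rewrite mulfunE mulKVmx ?uS.
apply/Hann => _ /memv_imgP[z zU ->].
by rewrite mulfunE trmx_mul trmxK -mulmxA mulKVmx ?uS// xA.
Qed.

Definition rich (O : V -> Prop) := forall s : seq {vspace V}, (forall U, U \in s -> U != fullv) ->
  exists2 x, O x & forall U, U \in s -> x \notin U.

(** If finitely many proper subspaces covered the stable set [O], a minimal cover would contain a
    family permuted by [S]. *)
Lemma rich_orbit S O u : (forall M, S M -> M \in unitmx) -> strongly_irreducible S ->
  (forall M x, S M -> O x -> O (M *m x)) -> O u -> u != 0 -> rich O.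
Proof.
move=> uS irr SO Ou u0 s0 proper; apply: contrapT => no.
have cov : covers O s0.
  move=> x Ox; apply: contrapT => no'; apply: no; exists x => // U Us.
  by apply/negP => xU; apply: no'; exists U.
pose Sf f := exists2 M, S M & f = mulfun M.
have Sinj f : Sf f -> lker f = 0%VS by case=> M SM ->; rewrite lker_mulfun// uS.
have SfO f x : Sf f -> O x -> O (f x) by case=> M SM -> Ox; rewrite mulfunE; exact: SO.
have [s [sn dims inv]] := invariant_cover Sinj SfO Ou u0 cov proper.
have [U Us|M SM [U Us]] := irr s sn; first by have := dims U Us; rewrite dim_colvectors.
by move/negP; apply; apply: inv => //; exists M.
Qed.

(** Finitely many sets, each covered by finitely many proper subspaces, are covered together by
    finitely many, so one class of a finite partition stays rich. *)
Lemma rich_some (I : finType) (O : V -> Prop) (Oi : I -> V -> Prop) : rich O ->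
  (forall x, O x -> exists i, Oi i x) -> exists i, rich (Oi i).
Proof.
move=> richO OOi; apply: contrapT => /forallNP no.
have /choice[s Hs] : forall i, exists s : seq {vspace V}, (forall U, U \in s -> U != fullv) /\
    forall x, Oi i x -> exists2 U, U \in s & x \in U.
  move=> i; apply: contrapT => /forallNP no'; apply: (no i) => s proper.
  apply: contrapT => no2; apply: (no' s); split => // x Ox.
  apply: contrapT => no3; apply: no2; exists x => // U Us.
  by apply/negP => xU; apply: no3; exists U.
have [U|x Ox Hx] := richO [seq U | i <- enum I, U <- s i].
  by move=> /allpairsPdep[i [U' [_ Us ->]]]; have [+ _] := Hs i; apply.
have [i Oix] := OOi x Ox; have [_ /(_ x Oix)[U Us xU]] := Hs i.
suff /Hx : U \in [seq U | i <- enum I, U <- s i] by rewrite xU.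
by apply/allpairsPdep; exists i, U; rewrite mem_enum.
Qed.

End MatrixSpaces.

(** * Quantitative general position *)

Section SpreadVectors.
Variables (K : realFieldType) (d : nat).
Local Notation V := 'cV[K]_d.

Lemma span_bound (ys : seq V) : <<ys>>%VS = fullv ->
  exists2 C, 0 <= C & forall r : 'rV[K]_d, mxn r <= C * \sum_(y <- ys) mxn (r *m y).
Proof.
move=> full; pose Y := in_tuple ys.
pose co i (j : 'I_d) := coord Y i (delta_mx j 0 : V).
exists (\sum_j \sum_i `|co i j|) => [|r]; first by do 2! apply: sumr_ge0 => ? _.
have -> : mxn r = \sum_j mxn (r *m (delta_mx j 0 : V)).
  rewrite /mxn big_ord1; apply: eq_bigr => j _.
  by rewrite !big_ord1 -colE mxE.
rewrite mulr_suml; apply: ler_sum => j _.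
have -> : delta_mx j 0 = \sum_i co i j *: Y`_i.
  by apply: coord_span; rewrite full memvf.
rewrite mulmx_sumr.
have tri (I : finType) (G : I -> 'M[K]_(1, 1)) : mxn (\sum_i G i) <= \sum_i mxn (G i).
  elim/big_rec2: _ => [|i y x _ le]; first by rewrite mxn0.
  by apply: le_trans (mxnD _ _) _; rewrite lerD2l.
apply: le_trans (tri _ _) _; rewrite mulr_suml; apply: ler_sum => i _.
rewrite -scalemxAr mxnZ ler_wpM2l//.
rewrite (big_nth 0) big_mkord (bigD1 i)//= lerDl.
by apply: sumr_ge0 => ? _; exact: mxn_ge0.
Qed.

(** A spanning sublist controls [mxn r] through the products with its members, and there are
    finitely many sublists, so one [eta] suits them all. The vectors that [r] nearly annihilates
    then do not span, and a proper subspace contains at most [d.-1] of the list. *)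
Lemma spread_vectors (O : V -> Prop) M : (0 < d)%N -> rich O ->
  (forall t x, t != 0 -> O x -> O (t *: x)) ->
  exists xs : 'I_M -> V, (forall i, O (xs i) /\ mxn (xs i) = 1) /\
  exists2 eta, 0 < eta <= 1 & forall r : 'rV[K]_d,
    (\sum_i (mxn (r *m xs i) < eta * mxn r)%R <= d.-1)%N.
Proof.
move=> d0 richO scal.
have richO' : rich (fun x => O x /\ mxn x = 1).
  move=> s proper; have [U|x Ox Hx] := richO (0%VS :: s).
    rewrite inE => /predU1P[->|]; last exact: proper.
    apply/eqP => e; have := dim_colvectors K d; rewrite -e dimv0 => dd.
    by rewrite -dd in d0.
  have x0 : x != 0 by have := Hx 0%VS (mem_head _ _); rewrite memv0.
  have m0 : mxn x != 0 by rewrite mxn_eq0.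
  exists ((mxn x)^-1 *: x).
    by split; [apply: scal => //; rewrite invr_eq0|rewrite mxnZ ger0_norm ?invr_ge0 ?mxn_ge0// mulVf].
  move=> U Us; rewrite rpredZeq invr_eq0 (negPf m0)/=.
  by apply: Hx; rewrite inE Us orbT.
have [xs [sxs Oxs Hxs]] := general_position richO' M.
have /choice[C HC] : forall m : (size xs).-tuple bool, exists C : K, 0 <= C /\
    (<<mask (tval m) xs>>%VS = fullv -> forall r : 'rV[K]_d, mxn r <= C * \sum_(y <- mask m xs) mxn (r *m y)).
  move=> m; have [/eqP full|nfull] := boolP (<<mask (tval m) xs>>%VS == fullv).
    by have [C C0 HC] := span_bound full; exists C.
  by exists 0; split => // full; rewrite full eqxx in nfull.
pose CC := \sum_m C m.
have C0 m : 0 <= C m by have [] := HC m.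
have CC0 : 0 <= CC by apply: sumr_ge0.
have den0 : 0 < 1 + CC * M%:R by rewrite ltr_pwDl// mulr_ge0.
exists (fun i => xs`_i); split=> [i|]; first by apply: Oxs; rewrite mem_nth// sxs.
exists (1 + CC * M%:R)^-1.
  by rewrite invr_gt0 den0/= invf_le1// lerDl mulr_ge0.
move=> r; pose eta := (1 + CC * M%:R)^-1.
pose bad (x : V) := mxn (r *m x) < eta * mxn r.
have -> : (\sum_(i < M) (mxn (r *m xs`_i) < eta * mxn r)%R)%N = count bad xs.
  rewrite -sum1_count (big_nth 0) sxs big_mkord [RHS]big_mkcond/=.
  by apply: eq_bigr => i _; rewrite /bad; case: ifP.
pose B := [seq x <- xs | bad x].
have Bf : <<B>>%VS != fullv.
  apply/negP => /eqP; rewrite /B filter_mask => full.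
  have sz : size (map bad xs) == size xs by rewrite size_map.
  have [_ /(_ full r)/=] := HC (Tuple sz); rewrite -filter_mask -/B => le.
  have [r0|r0] := eqVneq (mxn r) 0.
    have B0 : B = [::].
      rewrite /B -(filter_pred0 xs); apply: eq_filter => x.
      by rewrite /bad r0 mulr0 ltNge mxn_ge0.
    move: full; rewrite -filter_mask -/B B0 span_nil => e.
    by have := dim_colvectors K d; rewrite -e dimv0 => dd; rewrite -dd in d0.
  have rp : 0 < mxn r by rewrite lt_neqAle eq_sym r0 mxn_ge0.
  have sumB : \sum_(y <- B) mxn (r *m y) <= M%:R * (eta * mxn r).
    apply: (@le_trans _ _ (\sum_(y <- B) eta * mxn r)).
      rewrite big_seq [leRHS]big_seq; apply: ler_sum => y.
      by rewrite mem_filter => /andP[/ltW].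
    rewrite big_const_seq count_predT iter_addr_0 -[leLHS]mulr_natl.
    rewrite ler_wpM2r ?mulr_ge0 ?mxn_ge0// ?invr_ge0 ?(ltW den0)// ler_nat.
    by rewrite -sxs size_filter count_size.
  have CM : C (Tuple sz) <= CC.
    by rewrite /CC (bigD1 (Tuple sz))//= lerDl; apply: sumr_ge0.
  have : mxn r <= CC * (M%:R * (eta * mxn r)).
    apply: le_trans le _; apply: ler_pM => //.
    by apply: sumr_ge0 => y _; exact: mxn_ge0.
  rewrite !mulrA ler_pMl// /eta ler_pdivlMr// mul1r.
  by rewrite leNgt ltrDr ltr01.
have -> : count bad xs = count (mem <<B>>%VS) B.
  rewrite -size_filter -/B; apply/esym/eqP; rewrite -all_count; apply/allP => y yB.
  exact: memv_span.
apply: (@leq_trans (count (mem <<B>>%VS) xs)).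
  by rewrite count_filter; apply: sub_count => y /andP[].
apply: leq_trans (Hxs _ Bf) _; rewrite -ltnS prednK//.
rewrite -[X in (_ < X)%N](dim_colvectors K d) ltn_neqAle (dimvS (subvf _)) andbT.
by apply: contra Bf => /eqP e; rewrite eqEdim subvf e leqnn.
Qed.

End SpreadVectors.

(** * Words close to rank-one matrices *)

Section NearRankOne.
Variables (K : realType) (d : nat).
Hypothesis d0 : (0 < d)%N.

Lemma alignedZr eta (A B : 'M[K]_d) (t : K) : t != 0 -> aligned eta A (t *: B) = aligned eta A B.
Proof.
move=> t0; rewrite /aligned -scalemxAr !mxnZ mulrCA ler_pM2l// normr_gt0//.
Qed.

Lemma alignedZl eta (A B : 'M[K]_d) (t : K) : t != 0 -> aligned eta (t *: A) B = aligned eta A B.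
Proof.
move=> t0; rewrite /aligned -scalemxAl !mxnZ mulrCA -[in LHS]mulrA.
by rewrite ler_pM2l// normr_gt0.
Qed.

Lemma aligned_tr eta (A B : 'M[K]_d) : aligned eta A^T B^T = aligned eta B A.
Proof. by rewrite /aligned -trmx_mul !mxn_tr -!mulrA [mxn A * _]mulrC. Qed.

Definition near_rank_one e (x y : 'cV[K]_d) (S : 'M[K]_d) :=
  [&& mxn x == 1, mxn y == 1 & mxn (S - x *m y^T) < e].

Lemma near_rank_one_tr e x y S : near_rank_one e y x S^T = near_rank_one e x y S.
Proof.
rewrite /near_rank_one andbCA; congr [&& _, _ & (_ < _)].
by rewrite -[RHS]mxn_tr linearB/= trmx_mul trmxK.
Qed.

Lemma near_rank_one_norm e x y S : near_rank_one e x y S -> 1 - e <= mxn S <= 1 + e.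
Proof.
move=> /and3P[/eqP x1 /eqP y1 Se].
have xy : mxn (x *m y^T) = 1 by rewrite mxn_col_row mxn_tr x1 y1 mulr1.
have h1 := mxnD (S - x *m y^T) (x *m y^T); rewrite subrK in h1.
have h2 := mxnD (x *m y^T - S) S; rewrite subrK mxnB in h2.
by apply/andP; split; lra.
Qed.

(** The row [r] of [B] is one of largest norm, at least a fraction 1/d of that of [B]. If [r *m x]
    is not small, then [B *m (x *m y^T)] has norm at least [eta / d] times that of [B]; the error
    [e] takes half of this, and [mxn S <= 2] halves it again. *)
Lemma aligned_near_rank_one eta e (B : 'M[K]_d) : 0 < eta <= 1 -> 0 <= e <= eta / (2 * d%:R) ->
  exists r : 'rV[K]_d, forall x y S, near_rank_one e x y S ->
    (mxn (r *m x) < eta * mxn r) || aligned (eta / (4 * d%:R)) B S.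
Proof.
move=> /andP[eta0 eta1] /andP[e0 ee]; have [k Hk] := mxn_row_ge B d0.
exists (row k B) => x y S near; have /andP[_ S1] := near_rank_one_norm near.
have /and3P[/eqP x1 /eqP y1 Se] := near.
case: ltP => //= h; rewrite /aligned.
have dR : 1 <= d%:R :> K by rewrite ler1n.
have dR0 : 0 < d%:R :> K by lra.
have h1 : mxn (B *m (x *m y^T)) <= mxn (B *m S) + e * mxn B.
  have -> : B *m (x *m y^T) = B *m S + B *m (x *m y^T - S) by rewrite -mulmxDr addrC subrK.
  apply: le_trans (mxnD _ _) _; rewrite lerD2l; apply: le_trans (mxnM _ _) _.
  by rewrite mulrC ler_wpM2r ?mxn_ge0// mxnB ltW.
have h2 : eta * (mxn B / d%:R) <= mxn (B *m (x *m y^T)).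
  rewrite mulmxA mxn_col_row mxn_tr y1 mulr1.
  have h1' := mxn_row_le (B *m x) k; rewrite row_mul in h1'.
  apply: (le_trans _ h1'); apply: (le_trans _ h).
  by rewrite ler_wpM2l ?(ltW eta0)// ler_pdivrMr// mulrC.
have B0 := mxn_ge0 B.
have e1 : e <= 1.
  by apply: le_trans ee _; rewrite ler_pdivrMr ?mul1r; lra.
have h3 : e * mxn B <= eta / (2 * d%:R) * mxn B by rewrite ler_wpM2r.
have h4 : eta / (4 * d%:R) * mxn B * mxn S <= eta / (4 * d%:R) * mxn B * 2.
  by rewrite ler_wpM2l; [|rewrite mulr_ge0// divr_ge0 ?(ltW eta0)//; lra|lra].
have h5 : eta / (4 * d%:R) * mxn B * 2 = eta / (2 * d%:R) * mxn B by field; rewrite gt_eqF.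
have h6 : eta * (mxn B / d%:R) = 2 * (eta / (2 * d%:R) * mxn B) by field; rewrite gt_eqF.
lra.
Qed.

Lemma near_rank_one_sandwich e x y x' y' S S' (D : 'M[K]_d) : e <= 1 ->
  near_rank_one e x y S -> near_rank_one e x' y' S' ->
  mxn (S *m D *m S' - x *m y^T *m D *m (x' *m y'^T)) <= 3 * e * mxn D.
Proof.
move=> e1 near near'; have /andP[_ S1] := near_rank_one_norm near.
have /andP[_ S1'] := near_rank_one_norm near'.
have /and3P[/eqP x1 /eqP y1 /ltW Se] := near; have /and3P[/eqP x1' /eqP y1' /ltW Se'] := near'.
have D0 := mxn_ge0 D.
have xy : mxn (x *m y^T) = 1 by rewrite mxn_col_row mxn_tr x1 y1 mulr1.
have -> : S *m D *m S' - x *m y^T *m D *m (x' *m y'^T) =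
  (S - x *m y^T) *m (D *m S') + x *m y^T *m (D *m (S' - x' *m y'^T)).
  by rewrite mulmxBl !mulmxBr -!mulmxA addrA subrK.
apply: le_trans (mxnD _ _) _.
have h1 : mxn ((S - x *m y^T) *m (D *m S')) <= e * (mxn D * 2).
  apply: le_trans (mxnM _ _) _; apply: ler_pM; rewrite ?mxn_ge0//.
  apply: le_trans (mxnM _ _) _; rewrite ler_wpM2l//; lra.
have h2 : mxn (x *m y^T *m (D *m (S' - x' *m y'^T))) <= mxn D * e.
  apply: le_trans (mxnM _ _) _; rewrite xy mul1r.
  by apply: le_trans (mxnM _ _) _; rewrite ler_wpM2l.
lra.
Qed.

(** Alignment gives [S *m D *m S'] norm at least [eta ^+ 2 / 4] times that of [D], as [S] and [S']
    have norm at least 1/2. Half survives the passage to the rank-one models, where the norm is the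
    absolute value of the bilinear coefficient. *)
Lemma bilinear_lower eta e x y x' y' S S' (D : 'M[K]_d) : 0 < eta <= 1 -> 24 * e <= eta ^+ 2 ->
  near_rank_one e x y S -> near_rank_one e x' y' S' ->
  aligned eta S D -> aligned eta (S *m D) S' ->
  eta ^+ 2 / 8 * mxn D <= `|(y^T *m D *m x') 0 0|.
Proof.
move=> /andP[eta0 eta1] ee near near' al al'.
have q1 : eta ^+ 2 <= 1 by rewrite expr_le1// ltW.
have q0 : 0 < eta ^+ 2 by rewrite exprn_gt0.
have e1 : e <= 1 / 24 by lra.
have e1' : e <= 1 by lra.
have /andP[S1 _] := near_rank_one_norm near; have /andP[S1' _] := near_rank_one_norm near'.
have /and3P[/eqP x1 /eqP y1 _] := near; have /and3P[/eqP x1' /eqP y1' _] := near'.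
have D0 := mxn_ge0 D.
have h1 := near_rank_one_sandwich D e1' near near'.
have h2 : eta ^+ 2 / 4 * mxn D <= mxn (S *m D *m S').
  apply: (le_trans _ al'); apply: (@le_trans _ _ (eta * (eta * (1 / 2) * mxn D) * (1 / 2))).
    by rewrite expr2; lra.
  apply: ler_pM; [|lra| |lra].
    by rewrite !mulr_ge0// ltW.
  rewrite ler_wpM2l ?(ltW eta0)//; apply: (le_trans _ al).
  rewrite ler_wpM2r// ler_wpM2l ?(ltW eta0)//; lra.
have h3 : mxn (x *m y^T *m D *m (x' *m y'^T)) = `|(y^T *m D *m x') 0 0|.
  have -> : x *m y^T *m D *m (x' *m y'^T) = x *m (y^T *m D *m x' *m y'^T) by rewrite !mulmxA.
  rewrite mxn_col_row x1 mul1r [y^T *m D *m x']mx11_scalar mul_scalar_mx mxnZ mxn_tr y1' mulr1.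
  by rewrite [in RHS]mxE mulr1n.
rewrite -h3.
have h4 := mxnD (S *m D *m S' - x *m y^T *m D *m (x' *m y'^T)) (x *m y^T *m D *m (x' *m y'^T)).
rewrite subrK in h4.
have h5 : 3 * e * mxn D <= eta ^+ 2 / 8 * mxn D by rewrite ler_wpM2r//; lra.
lra.
Qed.

(** With [S] and [S'] replaced by rank-one models, the trace is the product of two bilinear
    coefficients, one for each arc of the cycle, hence at least [eta ^+ 4 / 64]. The approximation
    error takes half of it, and [mxn S * mxn S' <= 4] turns 1/128 into 1/512. *)
Lemma aligned_trace_near eta e x y x' y' S S' (D Q : 'M[K]_d) : 0 < eta <= 1 ->
  0 <= e -> 384 * e <= eta ^+ 4 ->
  near_rank_one e x y S -> near_rank_one e x' y' S' ->
  aligned eta S D -> aligned eta (S *m D) S' -> aligned eta S' Q -> aligned eta (S' *m Q) S ->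
  eta ^+ 4 / 512 * (mxn S * mxn D * mxn S' * mxn Q) <= `|\tr (S *m D *m S' *m Q)|.
Proof.
move=> eta01 e0 ee near near' a1 a2 a3 a4; have /andP[eta0 eta1] := eta01.
have q2 : eta ^+ 4 = eta ^+ 2 * eta ^+ 2 by rewrite -exprD.
have q1 : eta ^+ 2 <= 1 by rewrite expr_le1// ltW.
have q0 : 0 < eta ^+ 2 by rewrite exprn_gt0.
have q41 : eta ^+ 4 <= eta ^+ 2 by rewrite q2 ler_piMr// ltW.
have ee2 : 24 * e <= eta ^+ 2 by lra.
have e1 : e <= 1 by lra.
have /andP[_ S1] := near_rank_one_norm near; have /andP[_ S1'] := near_rank_one_norm near'.
have D0 := mxn_ge0 D; have Q0 := mxn_ge0 Q.
have b1 := bilinear_lower eta01 ee2 near near' a1 a2.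
have b2 := bilinear_lower eta01 ee2 near' near a3 a4.
have DQ0 : 0 <= mxn D * mxn Q by rewrite mulr_ge0.
have trE : `|\tr (x *m y^T *m D *m (x' *m y'^T) *m Q)| =
    `|(y^T *m D *m x') 0 0| * `|(y'^T *m Q *m x) 0 0|.
  have -> : x *m y^T *m D *m (x' *m y'^T) *m Q = x *m ((y^T *m D *m x') *m (y'^T *m Q)) by rewrite !mulmxA.
  rewrite mxtrace_mulC [y^T *m D *m x']mx11_scalar mul_scalar_mx -scalemxAl mxtraceZ normrM.
  by rewrite /mxtrace big_ord1 [in RHS]mxE mulr1n.
have h1 : eta ^+ 4 / 64 * (mxn D * mxn Q) <= `|\tr (x *m y^T *m D *m (x' *m y'^T) *m Q)|.
  rewrite trE; have -> : eta ^+ 4 / 64 * (mxn D * mxn Q) = eta ^+ 2 / 8 * mxn D * (eta ^+ 2 / 8 * mxn Q).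
    by rewrite q2; field.
  by apply: ler_pM => //; rewrite mulr_ge0// divr_ge0// ltW.
have h2 : `|\tr (x *m y^T *m D *m (x' *m y'^T) *m Q)| <= `|\tr (S *m D *m S' *m Q)| + 3 * e * (mxn D * mxn Q).
  have -> : x *m y^T *m D *m (x' *m y'^T) *m Q = S *m D *m S' *m Q
     - (S *m D *m S' - x *m y^T *m D *m (x' *m y'^T)) *m Q.
    by rewrite mulmxBl subKr.
  rewrite linearB/=; apply: le_trans (ler_normB _ _) _; rewrite lerD2l.
  apply: le_trans (mxn_trace _) _; apply: le_trans (mxnM _ _) _; rewrite mulrA ler_wpM2r//.
  exact: near_rank_one_sandwich.
have h3 : eta ^+ 4 / 512 * (mxn S * mxn D * mxn S' * mxn Q) <= eta ^+ 4 / 512 * (4 * (mxn D * mxn Q)).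
  have c0 : 0 <= eta ^+ 4 / 512 by move: q2 q0; set t := eta ^+ 4; set r := eta ^+ 2 => -> r0; nra.
  apply: (ler_wpM2l c0).
  have -> : mxn S * mxn D * mxn S' * mxn Q = mxn S * mxn S' * (mxn D * mxn Q) by ring.
  rewrite ler_wpM2r//; have -> : 4 = 2 * 2 :> K by ring.
  by apply: ler_pM; rewrite ?mxn_ge0//; lra.
have h4 : 3 * e * (mxn D * mxn Q) <= eta ^+ 4 / 128 * (mxn D * mxn Q) by rewrite ler_wpM2r//; lra.
lra.
Qed.

End NearRankOne.

Lemma rational_matrix_approx (R : realType) m n (M : 'M[R]_(m, n)) e : 0 < e ->
  exists Q : 'M[rat]_(m, n), mxn (map_mx ratr Q - M) < e.
Proof.
move=> e0; pose e' := e / (m%:R * n%:R + 1).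
have mn0 : 0 <= m%:R * n%:R :> R by rewrite mulr_ge0.
have den : 0 < m%:R * n%:R + 1 :> R by lra.
have e'0 : 0 < e' by rewrite divr_gt0.
have /choice[q Hq] : forall p : 'I_m * 'I_n, exists q : rat, `|ratr q - M p.1 p.2| <= e'.
  move=> [i j]; have : M i j - e' < M i j + e' by lra.
  move=> /rat_in_itvoo[q]; rewrite in_itv/= => /andP[h1 h2].
  by exists q; rewrite ler_norml; apply/andP; split; lra.
exists (\matrix_(i, j) q (i, j)).
apply: (@le_lt_trans _ _ (\sum_(i < m) \sum_(j < n) e')).
  by apply: ler_sum => i _; apply: ler_sum => j _; rewrite !mxE; exact: (Hq (i, j)).
rewrite (eq_bigr (fun=> n%:R * e')) => [|i _]; last by rewrite sumr_const card_ord mulr_natl.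
rewrite sumr_const card_ord -[_ *+ m]mulr_natl /e' !mulrA ltr_pdivrMr// mulrC.
by rewrite ltr_pM2l// ltrDl.
Qed.

(** * Letters and words in the support of the law *)

Section Support.
Variables (R : realType) (d : nat) (nu : probability (mseq R d) R).
Hypothesis nu_catn : forall n A, measurable A ->
  nu A = (nu \x nu)%E ((fun p : mseq R d * mseq R d => catn n p.1 p.2) @^-1` A).
Local Notation E := (mseq R d).
Hypothesis unit_ae : {ae nu, forall x : E, forall k, x k \in unitmx}.

Definition ball_event n (M : 'M[R]_d) e := [set x : E | mxn (mprod x n - M) < e].

Lemma measurable_ball_event n M e : measurable (ball_event n M e).
Proof.
apply: measurable_set_ltr; last exact: measurable_cst.
apply: measurable_mxn; have -> : (fun x : E => mprod x n - M) = (fun x => mprod x n + (- M)) by [].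
by apply: mxmeasurableD; [exact: mxmeasurable_mprod|exact: mxmeasurable_cst].
Qed.

Lemma mprod1 (x : nat -> 'M[R]_d) : mprod x 1 = x 0%N.
Proof. by rewrite mprod_recr mprod0 mul1mx. Qed.

(* The invertible points of the support of the law of one factor. *)
Definition letter (M : 'M[R]_d) :=
  M \in unitmx /\ forall e, 0 < e -> (0 < nu (ball_event 1 M e))%E.

(** A point outside the support lies in a null ball with rational centre and radius the inverse of a
    positive integer, and there are countably many of these. *)
Lemma ae_letter0 : {ae nu, forall x : E, forall e, 0 < e -> (0 < nu (ball_event 1 (x 0%N) e))%E}.
Proof.
pose B (i : 'M[rat]_d * nat) := ball_event 1 (map_mx ratr i.1) i.2.+1%:R^-1.
pose F (k : nat) : set E := if pickle_inv k is Some i then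
  if `[< nu (B i) = 0%E >] then B i else set0 else set0.
have mF k : measurable (F k).
  rewrite /F; case: pickle_inv => [i|]; last exact: measurable0.
  by case: ifP => _; [exact: measurable_ball_event|exact: measurable0].
have nF k : nu.-negligible (F k).
  apply/negligibleP => //; rewrite /F; case: pickle_inv => [i|]; last exact: measure0.
  by case: asboolP => // _; exact: measure0.
apply: (negligibleS _ (negligible_bigcup nF)) => x /=.
move=> /existsNP[e /not_implyP[e0 xe]].
pose p := Num.truncn (2 / e).
have pe : p.+1%:R^-1 < e / 2.
  have h : 2 / e < p.+1%:R by exact: truncnS_gt.
  rewrite invf_plt ?posrE ?divr_gt0//. by rewrite invf_div.
have p0 : 0 < p.+1%:R^-1 :> R by rewrite invr_gt0.
have [Q HQ] := rational_matrix_approx (x 0%N) p0.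
exists (pickle (Q, p)) => //; rewrite /F pickleK_inv.
have -> : nu (B (Q, p)) = 0%E.
  apply/eqP; rewrite eq_le measure_ge0 andbT.
  apply: le_trans (_ : nu (ball_event 1 (x 0%N) e) <= _)%E; last by rewrite leNgt; apply/negP.
  apply: le_measure; rewrite ?inE; [exact: measurable_ball_event|exact: measurable_ball_event|].
  move=> y; rewrite /B /ball_event/= => h.
  have -> : mprod y 1 - x 0%N = (mprod y 1 - map_mx ratr Q) + (map_mx ratr Q - x 0%N).
    by rewrite addrA subrK.
  apply: le_lt_trans (mxnD _ _) _; rewrite [e]splitr.
  by apply: ltrD; [exact: lt_trans h pe|exact: lt_trans HQ pe].
by case: asboolP => // _; rewrite /B /ball_event/= mprod1 mxnB.
Qed.

Lemma ae_letter : {ae nu, forall x : E, forall k, letter (x k)}.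
Proof.
have [N [mN nuN HN]] := ae_letter0.
suff H : {ae nu, forall x : E, forall k e, 0 < e -> (0 < nu (ball_event 1 (x k) e))%E}.
  by apply: filterS2 unit_ae H => x ux Hx k; split; [exact: ux|exact: Hx].
apply: ae_foralln => k; exists [set x : E | N (shiftn k x)].
have mNk : measurable [set x : E | N (shiftn k x)].
  by rewrite -[X in measurable X]setTI; apply: measurable_shiftn.
split => //; first exact: (etrans (prob_shiftn nu_catn k mN) nuN).
move=> x /= nx; apply: HN => /= Hx; apply: nx.
by move: Hx; rewrite /shiftn addn0.
Qed.

Lemma ae_exists (A : set E) (Q : E -> Prop) : measurable A -> (0 < nu A)%E ->
  {ae nu, forall x, Q x} -> exists2 x, A x & Q x.
Proof.
move=> mA A0 [N [mN nuN HN]]; apply: contrapT => no.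
move: A0; rewrite ltNge => /negP; apply.
suff : (nu A <= nu N)%E by move/le_trans; apply; rewrite le_eqVlt; apply/orP; left; apply/eqP.
apply: le_measure; rewrite ?inE// => x Ax; apply: HN => /= Qx; apply: no; by exists x.
Qed.

(** Multiplication is continuous, and the last factor is independent of the previous ones. *)
Lemma ball_event_gt0 n (y : nat -> 'M[R]_d) e : (forall k, letter (y k)) -> 0 < e ->
  (0 < nu (ball_event n (mprod y n) e))%E.
Proof.
move=> ly; elim: n e => [|n IHn] e e0.
  have -> : ball_event 0 (mprod y 0) e = setT.
    by apply/seteqP; split => // x _; rewrite /ball_event/= !mprod0 subrr mxn0.
  by rewrite [nu _]probability_setT.
pose A := mprod y n; pose C := y n; pose t := Num.min 1 (e / (mxn A + mxn C + 2)).
have A0 := mxn_ge0 A; have C0 := mxn_ge0 C.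
have den : 0 < mxn A + mxn C + 2 by lra.
have t0 : 0 < t by rewrite lt_min ltr01 divr_gt0.
have t1 : t <= 1 by rewrite ge_min lexx.
have te : t * (mxn A + mxn C + 2) <= e.
  by rewrite -ler_pdivlMr// ge_min lexx orbT.
rewrite (nu_catn n); last exact: measurable_ball_event.
apply: (@lt_le_trans _ _ ((nu \x nu)%E (ball_event n A t `*` ball_event 1 C t))).
  rewrite product_measure1E; [|exact: measurable_ball_event|exact: measurable_ball_event].
  by apply: mule_gt0; [exact: IHn|have [_] := ly n; exact].
apply: le_measure; rewrite ?inE.
- by apply: measurableX; exact: measurable_ball_event.
- rewrite -[X in measurable X]setTI; apply: measurable_catn => //; exact: measurable_ball_event.
move=> [x z] [/=]; rewrite /ball_event/= mprod1 => hx hz.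
rewrite !mprod_recr mprod_catn// /catn ltnn subnn -/A -/C.
have -> : mprod x n *m z 0%N - A *m C = (mprod x n - A) *m (z 0%N - C) + (mprod x n - A) *m C + A *m (z 0%N - C).
  by rewrite -mulmxDr subrK mulmxBl mulmxBr addrA subrK.
have h1 : mxn ((mprod x n - A) *m (z 0%N - C)) <= t * 1.
  apply: le_trans (mxnM _ _) _; apply: ler_pM; rewrite ?mxn_ge0//; first exact: ltW.
  exact: le_trans (ltW hz) t1.
have h2 : mxn ((mprod x n - A) *m C) <= t * mxn C.
  by apply: le_trans (mxnM _ _) _; rewrite ler_wpM2r// ltW.
have h3 : mxn (A *m (z 0%N - C)) <= mxn A * t.
  by apply: le_trans (mxnM _ _) _; rewrite ler_wpM2l// ltW.
have h4 := mxnD ((mprod x n - A) *m (z 0%N - C) + (mprod x n - A) *m C) (A *m (z 0%N - C)).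
have h5 := mxnD ((mprod x n - A) *m (z 0%N - C)) ((mprod x n - A) *m C).
lra.
Qed.

Definition word n (M : 'M[R]_d) := exists2 y : nat -> 'M[R]_d, forall k, letter (y k) & M = mprod y n.

Lemma wordM n m A B : word n A -> word m B -> word (n + m) (A *m B).
Proof.
move=> [y ly ->] [z lz ->]; exists (catn n y z); last first.
  by rewrite mprodD mprod_catn// shiftn_catn.
by move=> k; rewrite /catn; case: ifP => _; [exact: ly|exact: lz].
Qed.

Lemma letter_word M : letter M -> word 1 M.
Proof. by move=> lM; exists (fun=> M) => //; rewrite mprod1. Qed.

Lemma word1 : word 0 1%:M.
Proof.
have T0 : (0 < nu setT)%E by rewrite [nu _]probability_setT.
have [x _ lx] := ae_exists measurableT T0 ae_letter.
by exists x => //; rewrite mprod0.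
Qed.

Lemma word_gt0 n M e : word n M -> 0 < e -> (0 < nu (ball_event n M e))%E.
Proof. by move=> [y ly ->]; exact: ball_event_gt0. Qed.

Lemma measurable_maps_into (P Q : 'M[R]_d) :
  measurable [set x : E | Q *m (x 0%N *m P) = x 0%N *m P].
Proof.
have -> : [set x : E | Q *m (x 0%N *m P) = x 0%N *m P] =
  [set x : E | forall i j, (Q *m (x 0%N *m P)) i j = (x 0%N *m P) i j].
  by apply/seteqP; split => x /=; [move=> -> |move=> H; apply/matrixP].
have mxP : mxmeasurable (fun x : E => x 0%N *m P).
  by apply: mxmeasurableM; [exact: mxmeasurable_coord|exact: mxmeasurable_cst].
apply: measurable_forall => i; apply: measurable_forall => j.
apply: measurable_set_eqr => //.
by apply: mxmeasurableM => //; exact: mxmeasurable_cst.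
Qed.

Hypothesis irr : forall (N : nat) (V : 'I_N -> {vspace 'cV[R]_d}), (1 <= N)%N ->
  (forall k, (0 < \dim (V k))%N /\ (\dim (V k) < d)%N) ->
  (nu [set x : E | forall v : 'cV[R]_d, (exists k, v \in V k) -> exists k, x 0%N *m v \in V k] < 1)%E.

(** The complement of the event in (ii) has positive probability, so it contains a trajectory made
    of letters. The event is measurable because a subspace inside a finite union lies in one member,
    which a projection turns into matrix equations. *)
Lemma letter_irreducible : strongly_irreducible letter.
Proof.
move=> s s0 dims.
have N1 : (1 <= size s)%N by case: (s) s0.
pose V (k : 'I_(size s)) := nth 0%VS s k.
have Vs k : V k \in s by rewrite mem_nth.
have VP (U : {vspace 'cV[R]_d}) : U \in s -> exists k, U = V k.
  move=> Us; have Ui : (index U s < size s)%N by rewrite index_mem.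
  by exists (Ordinal Ui); rewrite /V/= nth_index.
have dV k : (0 < \dim (V k))%N /\ (\dim (V k) < d)%N by apply/andP; exact: dims.
have := irr N1 dV; set A := [set x | _] => A1.
have /choice[P HP] := @proj_matrix R d.
have mA : measurable A.
  have -> : A = [set x : E | forall k, exists j, P (V j) *m (x 0%N *m P (V k)) = x 0%N *m P (V k)].
    apply/seteqP; split => x /= Ax.
      move=> k; apply: contrapT => /forallNP no.
      have [U Us|v vV Hv] := @exists_avoiding _ _ (mulfun (x 0%N) @: V k)%VS s.
        have [j ->] := VP _ Us; apply/negP => /subvP sub; apply: (no j).
        apply/matrixP => a b.
        have := congr1 (fun M : 'cV[R]_d => M a 0) ((HP (V j) (col b (x 0%N *m P (V k)))).2 _).
        have cE (C D : 'M[R]_d) : C *m col b D = col b (C *m D) by rewrite !colE mulmxA.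
        rewrite cE ![col _ _ _ _]mxE; apply.
        rewrite -cE -mulfunE; apply: sub; apply: memv_img.
        by rewrite colE; have [] := HP (V k) (delta_mx b 0).
      move: vV => /memv_imgP[u uV vE]; have [j] := Ax u (ex_intro _ k uV).
      by rewrite -mulfunE -vE => /negPn; rewrite Hv.
    move=> v [k vV]; have [j Hj] := Ax k; exists j.
    have [_ /(_ vV) <-] := HP (V k) v; rewrite mulmxA -Hj -!mulmxA.
    by have [] := HP (V j) (x 0%N *m (P (V k) *m v)).
  by apply: measurable_forall => k; apply: measurable_exists => j; exact: measurable_maps_into.
have A0 : (0 < nu (~` A))%E by rewrite probability_setC// sube_gt0.
have [x Ax lx] := ae_exists (measurableC mA) A0 ae_letter.
exists (x 0%N) => //; apply: contrapT => no; apply: Ax => v [k vV].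
have xV : (mulfun (x 0%N) @: V k)%VS \in s.
  by apply: contrapT => /negP H; apply: no; exists (V k).
have [j Vj] := VP _ xV; exists j; rewrite -Vj -mulfunE; exact: memv_img.
Qed.

End Support.

(** Through [minors_negligible] the spectral gap is a measurable event; having positive probability,
    it meets the almost sure set of trajectories made of letters. *)
Lemma proximal_word (R : realType) (n : nat) (nu : probability (mseq R n.+2) R)
    (nu_catn : forall n' A, measurable A ->
      nu A = (nu \x nu)%E ((fun p : mseq R n.+2 * mseq R n.+2 => catn n' p.1 p.2) @^-1` A))
    (unit_ae : {ae nu, forall x : mseq R n.+2, forall k, x k \in unitmx}) m :
  (0 < nu [set x : mseq R n.+2 | (rho (mprod x m) 1 < rho (mprod x m) 0)%R])%E ->
  exists2 M, word nu m M & rho M 1 < rho M 0.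
Proof.
have mX k : mxmeasurable (fun x : mseq R n.+2 => mprod x m ^+ k).
  elim: k => [|k IHk]; first exact: mxmeasurable_cst.
  have -> : (fun x : mseq R n.+2 => mprod x m ^+ k.+1) = (fun x => mprod x m *m (mprod x m ^+ k)).
    by apply/funext => x; rewrite exprS.
  by apply: mxmeasurableM => //; exact: mxmeasurable_mprod.
have mA : measurable [set x : mseq R n.+2 | rho (mprod x m) 1 < rho (mprod x m) 0].
  have -> : [set x : mseq R n.+2 | rho (mprod x m) 1 < rho (mprod x m) 0] =
      [set x | minors_negligible (mprod x m)].
    by apply/seteqP; split => x /=; [exact: proximal_minors|exact: minors_proximal].
  apply: measurable_forall => p; apply: measurable_exists => m0; apply: measurable_forall => k.
  apply: measurable_imply => _; do 4! apply: measurable_forall => ?.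
  apply: measurable_set_ltr; last first.
    by apply: measurable_funX; exact: measurable_mxtrace.
  apply: measurable_funM; last exact: measurable_cst.
  apply: measurableT_comp => //; rewrite /minor2.
  by apply: measurable_funB; apply: measurable_funM; exact: mX.
move=> A0; have [x Ax lx] := ae_exists mA A0 (ae_letter nu_catn unit_ae).
by exists (mprod x m) => //; exists x.
Qed.

(** * Weights concentrated on rank-one models *)

Section RankOneWeights.
Variables (R : realType) (d : nat) (nu : probability (mseq R d) R).
Hypothesis nu_catn : forall n A, measurable A ->
  nu A = (nu \x nu)%E ((fun p : mseq R d * mseq R d => catn n p.1 p.2) @^-1` A).
Local Notation E := (mseq R d).
Hypothesis d0 : (0 < d)%N.
Local Notation M := (80 * d)%N.
Variables (l : nat) (x y : 'I_M -> 'cV[R]_d) (kappa : 'I_M -> R) (eta0 e : R).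
Hypothesis kappa0 : forall i, kappa i != 0.
Hypothesis eta01 : 0 < eta0 <= 1.
Local Notation eta := (eta0 / (4 * d%:R)).
Hypotheses (e0 : 0 <= e) (ee : 384 * e <= eta ^+ 4).
Hypothesis few_x : forall r : 'rV[R]_d, (\sum_i (mxn (r *m x i) < eta0 * mxn r)%R <= d.-1)%N.
Hypothesis few_y : forall r : 'rV[R]_d, (\sum_i (mxn (r *m y i) < eta0 * mxn r)%R <= d.-1)%N.
Definition near_word i (S : 'M[R]_d) := near_rank_one e (x i) (y i) (kappa i *: S).
Local Notation alpha i := (fine (nu [set z : E | near_word i (mprod z l)])).
Hypothesis near_pos : forall i, (0 < nu [set z : E | near_word i (mprod z l)])%E.

(* [weight] is the conditional distribution given that the word is near its [i]-th
   model, mixed uniformly over [i]; as at most d - 1 of the 80 d models are badly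
   placed for a given matrix, misalignment has mass at most a / 80. *)
Let a : R := (\sum_i (alpha i)^-1)^-1.
Let weight (S : 'M[R]_d) : R := \sum_i a / (alpha i * M%:R) * (near_word i S)%:R.

Lemma measurable_near_word i (F : E -> 'M[R]_d) : mxmeasurable F ->
  measurable_fun setT (fun z => near_word i (F z)).
Proof.
move=> mF; rewrite /near_word /near_rank_one.
apply: measurable_and; first exact: measurable_cst.
apply: measurable_and; first exact: measurable_cst.
apply: measurable_fun_ltr; last exact: measurable_cst.
apply: measurable_mxn.
have -> : (fun z => kappa i *: F z - x i *m (y i)^T) = (fun z => kappa i *: F z + - (x i *m (y i)^T)) by [].
apply: mxmeasurableD; last exact: mxmeasurable_cst.
by apply: mxmeasurableZ => //; exact: measurable_cst.
Qed.

Let mnear i : measurable [set z : E | near_word i (mprod z l)].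
Proof.
have := measurable_near_word i (@mxmeasurable_mprod R d l).
by move=> /(_ measurableT [set true]); rewrite setTI; apply.
Qed.

Let alphaE i : (nu [set z : E | near_word i (mprod z l)] = (alpha i)%:E)%E.
Proof. by rewrite fineK// fin_num_measure. Qed.

Let alpha0 i : 0 < alpha i.
Proof. by rewrite -lte_fin -alphaE. Qed.

Let i0 : 'I_M.
Proof. by exists 0%N; rewrite muln_gt0. Qed.

Let d_neq0 : d%:R != 0 :> R. Proof. by rewrite pnatr_eq0 -lt0n. Qed.

Let sum0 : 0 < \sum_i (alpha i)^-1.
Proof.
rewrite (bigD1 i0)//= ltr_pwDl ?invr_gt0// sumr_ge0// => i _.
by rewrite invr_ge0 ltW.
Qed.

Let a0 : 0 < a. Proof. by rewrite invr_gt0. Qed.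

Let M0 : 0 < M%:R :> R. Proof. by rewrite ltr0n muln_gt0. Qed.

(** The harmonic form of [a] places it below every [alpha i]; this keeps the weight in [0, 1]. *)
Let a_alpha i : 0 <= a / alpha i <= 1.
Proof.
rewrite divr_ge0 ?(ltW a0) ?(ltW (alpha0 i))//=.
rewrite ler_pdivrMr// mul1r /a -[leRHS]invrK lef_pV2 ?posrE ?invr_gt0//.
rewrite (bigD1 i)//= lerDl sumr_ge0// => j _.
by rewrite invr_ge0 ltW.
Qed.

Let coef0 i : 0 <= a / (alpha i * M%:R).
Proof. by rewrite divr_ge0 ?(ltW a0)// mulr_ge0// ltW. Qed.

Let weight01 (S : 'M[R]_d) : 0 <= weight S <= 1.
Proof.
apply/andP; split; first by apply: sumr_ge0 => i _; rewrite mulr_ge0.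
apply: (@le_trans _ _ (\sum_(i < M) M%:R^-1)).
  apply: ler_sum => i _; apply: (@le_trans _ _ (a / (alpha i * M%:R))).
    by rewrite ler_piMr// lern1 leq_b1.
  rewrite invfM mulrA ler_piMl ?invr_ge0//; have /andP[] := a_alpha i => //.
by rewrite sumr_const card_ord -[leLHS]mulr_natl mulfV// gt_eqF.
Qed.

Let measurable_weight (F : E -> 'M[R]_d) : mxmeasurable F ->
  measurable_fun setT (fun z => weight (F z)).
Proof.
move=> mF; apply: measurable_sum => i; apply: measurable_funM => //.
by apply: measurable_natr_bool; exact: measurable_near_word.
Qed.

Let integral_near (b : 'I_M -> R) : (forall i, 0 <= b i) ->
  (\int[nu]_z (\sum_i b i * (near_word i (mprod z l))%:R)%:E = (\sum_i b i * alpha i)%:E)%E.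
Proof.
move=> b0.
under eq_integral do rewrite -sumEFin.
have mn i : measurable_fun setT (fun z : E => (near_word i (mprod z l))%:R : R).
  by apply: measurable_natr_bool; apply: measurable_near_word; exact: mxmeasurable_mprod.
rewrite ge0_integral_sum//; last 2 first.
- by move=> i; apply/measurable_EFinP; apply: measurable_funM.
- by move=> i z _; rewrite lee_fin mulr_ge0.
rewrite -sumEFin; apply: eq_bigr => i _.
under eq_integral do rewrite EFinM.
rewrite ge0_integralZl//; [|exact/measurable_EFinP|by rewrite lee_fin].
rewrite EFinM; congr (_ * _)%E; rewrite -alphaE.
rewrite -[X in (_ = nu X)%E]setIT -integral_indic//.
by apply: eq_integral => z _; rewrite indicE mem_setE.
Qed.

Let few_bound (bad : 'I_M -> bool) (Q : E -> bool) : measurable_fun setT Q ->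
  (\sum_i bad i <= d.-1)%N ->
  (forall z i, near_word i (mprod z l) -> bad i || Q z) ->
  (\int[nu]_z (weight (mprod z l) * (~~ Q z)%:R)%:E <= (a / 80)%:E)%E.
Proof.
move=> mQ few H.
have mw : measurable_fun setT (fun z : E => weight (mprod z l)).
  by apply: measurable_weight; exact: mxmeasurable_mprod.
have b0 i : 0 <= a / (alpha i * M%:R) * (bad i)%:R by rewrite mulr_ge0.
apply: (@le_trans _ _ (\int[nu]_z (\sum_i a / (alpha i * M%:R) * (bad i)%:R * (near_word i (mprod z l))%:R)%:E)%E).
  apply: ge0_le_integral => //.
  - by move=> z _; rewrite lee_fin mulr_ge0//; have /andP[] := weight01 (mprod z l).
  - apply/measurable_EFinP; apply: measurable_funM => //; apply: measurable_natr_bool.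
    exact: measurable_neg.
  - apply/measurable_EFinP; apply: measurable_sum => i; apply: measurable_funM => //.
    by apply: measurable_natr_bool; apply: measurable_near_word; exact: mxmeasurable_mprod.
  - move=> z _; rewrite lee_fin mulr_suml; apply: ler_sum => i _.
    rewrite -[leLHS]mulrA -[leRHS]mulrA ler_wpM2l// -!natrM ler_nat.
    by have := H z i; case: near_word; case: (bad i); case: (Q z) => // /(_ isT).
rewrite (integral_near b0) lee_fin.
have aE i : a / (alpha i * M%:R) * (bad i)%:R * alpha i = a / M%:R * (bad i)%:R.
  by field; rewrite d_neq0 gt_eqF.
rewrite (eq_bigr _ (fun i _ => aE i)) -mulr_sumr -natr_sum.
rewrite -mulrA ler_wpM2l ?(ltW a0)// mulrC ler_pdivrMr// natrM mulrA mulVf ?mul1r ?pnatr_eq0//.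
by rewrite ler_nat (leq_trans few)// leq_pred.
Qed.

Let eta_bounds : 0 < eta <= 1 /\ e <= eta0 / (2 * d%:R).
Proof.
have dR : 1 <= d%:R :> R by rewrite ler1n.
have /andP[h0 h1] := eta01.
have dR4 : 0 < 4 * d%:R :> R by lra.
have q0 : 0 < eta by rewrite divr_gt0.
have q1 : eta <= 1 by rewrite ler_pdivrMr// mul1r; lra.
have q4 : eta ^+ 4 <= eta by rewrite -[leRHS]expr1 ler_wiXn2l// ltW.
split; first by rewrite q0.
have -> : eta0 / (2 * d%:R) = 2 * eta by field; rewrite d_neq0.
move: ee q0 q4; set t := eta; clearbody t; lra.
Qed.

Let measurable_aligned (F G : E -> 'M[R]_d) : mxmeasurable F -> mxmeasurable G ->
  measurable_fun setT (fun z => aligned eta (F z) (G z)).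
Proof.
move=> mF mG; apply: measurable_fun_ler.
  by apply: measurable_funM; [apply: measurable_funM => //|]; exact: measurable_mxn.
by apply: measurable_mxn; exact: mxmeasurableM.
Qed.

Let weight_right (B : 'M[R]_d) :
  (\int[nu]_z (weight (mprod z l) * (~~ aligned eta B (mprod z l))%:R)%:E <= (a / 80)%:E)%E.
Proof.
have [_ ebound] := eta_bounds.
have eb : 0 <= e <= eta0 / (2 * d%:R) by rewrite e0.
have [r Hr] := aligned_near_rank_one d0 B eta01 eb.
apply: (few_bound (bad := fun i => mxn (r *m x i) < eta0 * mxn r)) => //.
  by apply: measurable_aligned; [exact: mxmeasurable_cst|exact: mxmeasurable_mprod].
by move=> z i /Hr; rewrite alignedZr.
Qed.

Let weight_left (B : 'M[R]_d) :
  (\int[nu]_z (weight (mprod z l) * (~~ aligned eta (mprod z l) B)%:R)%:E <= (a / 80)%:E)%E.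
Proof.
have [_ ebound] := eta_bounds.
have eb : 0 <= e <= eta0 / (2 * d%:R) by rewrite e0.
have [r Hr] := aligned_near_rank_one d0 B^T eta01 eb.
apply: (few_bound (bad := fun i => mxn (r *m y i) < eta0 * mxn r)) => //.
  by apply: measurable_aligned; [exact: mxmeasurable_mprod|exact: mxmeasurable_cst].
by move=> z i; rewrite /near_word -near_rank_one_tr => /Hr; rewrite aligned_tr alignedZl.
Qed.

Let weight_near (S : 'M[R]_d) : 0 < weight S -> exists i, near_word i S.
Proof.
move=> w0; apply: contrapT => /forallNP no; move: w0.
by rewrite /weight big1 ?ltxx// => i _; rewrite (negPf (introN idP (no i))) mulr0.
Qed.

Let weight_trace (S S' D Q : 'M[R]_d) : 0 < weight S -> 0 < weight S' ->
  aligned eta S D -> aligned eta (S *m D) S' ->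
  aligned eta S' Q -> aligned eta (S' *m Q) S ->
  eta ^+ 4 / 512 * (mxn S * mxn D * mxn S' * mxn Q) <= `|\tr (S *m D *m S' *m Q)|.
Proof.
move=> /weight_near[i near] /weight_near[j near'] a1 a2 a3 a4.
have [eta1 _] := eta_bounds.
have ki := kappa0 i; have kj := kappa0 j.
have := @aligned_trace_near R d eta e _ _ _ _ _ _ D Q eta1 e0 ee near near'.
rewrite -!scalemxAl !alignedZl// !alignedZr// -!scalemxAr -!scalemxAl !mxtraceZ !mxnZ !normrM.
move=> /(_ a1 a2 a3 a4) h.
rewrite -(@ler_pM2l _ (`|kappa i| * `|kappa j|)) ?mulr_gt0 ?normr_gt0//.
rewrite -[leRHS]mulrA; apply: le_trans h.
by rewrite le_eqVlt; apply/orP; left; apply/eqP; ring.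
Qed.

Lemma spread_of_rank_one_words : exists c r, [/\ 0 < c <= 1, 0 < r < 1 &
  forall K (B : 'M[R]_d), exists S : set E, [/\ measurable S,
    (nu S <= (gap_prob r K)%:E)%E &
    forall z : E, (forall k, z k \in unitmx) -> ~ S z ->
      c * (expR (- total_cost (K * l + K * l) z) * mxn B)
        <= `|\tr (B *m mprod z (K * l + K * l))|]].
Proof.
have [/andP[eta1 eta2] _] := eta_bounds.
have int_w : (\int[nu]_z (weight (mprod z l))%:E = a%:E)%E.
  rewrite (integral_near coef0); congr _%:E.
  have aE i : a / (alpha i * M%:R) * alpha i = a / M%:R by field; rewrite d_neq0 gt_eqF.
  rewrite (eq_bigr _ (fun i _ => aE i)) sumr_const card_ord -[LHS]mulr_natl mulrCA mulfV ?mulr1//.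
  by rewrite gt_eqF.
have eta4 : 0 < eta ^+ 4 <= 1.
  by rewrite exprn_gt0//= exprn_ile1// ltW.
have c01 : 0 < eta ^+ 4 / 512 <= 1.
  by move: eta4; set t := eta ^+ 4; clearbody t => /andP[t0 t1]; apply/andP; split; lra.
have [c0 _] := andP c01.
exists (eta ^+ 4 / 512), (decay_rate a); split.
- exact: c01.
- by rewrite expR_gt0/= -expR0 ltr_expR oppr_lt0 divr_gt0.
move=> K B; exists (bad l weight eta a K B); split.
- exact: measurable_bad.
- exact: (prob_bad nu_catn measurable_weight weight01 int_w a0 weight_right weight_left).
- exact: (trace_lower_bound d0 weight01 a0 c0 weight_trace).
Qed.

End RankOneWeights.

(** * Construction of the words of common length *)

Section SpreadExists.
Variables (R : realType) (n : nat) (nu : probability (mseq R n.+2) R).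
Local Notation d := n.+2.
Hypothesis nu_catn : forall n A, measurable A ->
  nu A = (nu \x nu)%E ((fun p : mseq R d * mseq R d => catn n p.1 p.2) @^-1` A).
Local Notation E := (mseq R d).
Hypothesis unit_ae : {ae nu, forall x : E, forall k, x k \in unitmx}.
Hypothesis irr : forall (N : nat) (V : 'I_N -> {vspace 'cV[R]_d}), (1 <= N)%N ->
  (forall k, (0 < \dim (V k))%N /\ (\dim (V k) < d)%N) ->
  (nu [set x : E | forall v : 'cV[R]_d, (exists k, v \in V k) -> exists k, x 0%N *m v \in V k] < 1)%E.
Hypothesis prox : exists m, (1 <= m)%N /\
  (0 < nu [set x : E | (rho (mprod x m) 1 < rho (mprod x m) 0)%R])%E.

Let unit_letter (M : 'M[R]_d) : letter nu M -> M \in unitmx. Proof. by case. Qed.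

(* Fixing the length of the words modulo [m] lets powers of a word of length [m] pad
   them to a common length. *)
Lemma spread_orbit M m (u : 'cV[R]_d) : (0 < m)%N -> u != 0 ->
  exists (x : 'I_M -> 'cV[R]_d) (r : 'I_m) (eta : R), [/\ 0 < eta <= 1,
    forall i, mxn (x i) = 1 /\ exists t A s, [/\ word nu t A, (t %% m)%N = r, s != 0 & x i = s *: (A *m u)] &
    forall q : 'rV[R]_d, (\sum_i (mxn (q *m x i) < eta * mxn q)%R <= d.-1)%N].
Proof.
move=> m0 u0.
pose O (x : 'cV[R]_d) := exists t A s, [/\ word nu t A, s != 0 & x = s *: (A *m u)].
have richO : rich O.
  apply: (rich_orbit (S := letter nu) (u := u)) => //.
  - exact: letter_irreducible nu_catn unit_ae irr.
  - move=> M' x lM [t [A [s [wA s0 ->]]]]; exists (1 + t)%N, (M' *m A), s; split => //.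
      by apply: wordM => //; exact: letter_word.
    by rewrite -scalemxAr mulmxA.
  - exists 0%N, 1%:M, 1; split; [exact: word1|exact: oner_neq0|by rewrite mul1mx scale1r].
have [x [t [A [s [wA s0 ->]]]]|r richr] := rich_some (Oi := fun (r : 'I_m) x => exists t A s,
    [/\ word nu t A, (t %% m)%N = r, s != 0 & x = s *: (A *m u)]) richO.
  by exists (Ordinal (ltn_pmod t m0)), t, A, s.
have [a x a0 [t [A [s [wA tr s0 ->]]]]|x [Hx [eta eta01 few]]] := spread_vectors M (ltn0Sn _) richr.
  by exists t, A, (a * s); split => //; [rewrite mulf_neq0|rewrite scalerA].
by exists x, r, eta; split => // i; have [] := Hx i.
Qed.

(** On columns, multiplication by a transposed letter amounts to appending the letter on the right
    of the word, so rows are handled by the transposed semigroup. *)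
Lemma spread_orbit_tr M m (v : 'rV[R]_d) : (0 < m)%N -> v != 0 ->
  exists (y : 'I_M -> 'cV[R]_d) (r : 'I_m) (eta : R), [/\ 0 < eta <= 1,
    forall i, mxn (y i) = 1 /\ exists t B s, [/\ word nu t B, (t %% m)%N = r, s != 0 & (y i)^T = s *: (v *m B)] &
    forall q : 'rV[R]_d, (\sum_i (mxn (q *m y i) < eta * mxn q)%R <= d.-1)%N].
Proof.
move=> m0 v0.
pose O (y : 'cV[R]_d) := exists t B s, [/\ word nu t B, s != 0 & y^T = s *: (v *m B)].
have richO : rich O.
  apply: (rich_orbit (S := fun M => letter nu M^T) (u := v^T)).
  - by move=> M' /unit_letter; rewrite unitmx_tr.
  - exact: strongly_irreducible_tr unit_letter (letter_irreducible nu_catn unit_ae irr).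
  - move=> M' y lM [t [B [s [wB s0 yE]]]]; exists (t + 1)%N, (B *m M'^T), s; split => //.
      by apply: wordM => //; exact: letter_word.
    by rewrite trmx_mul yE -scalemxAl mulmxA.
  - exists 0%N, 1%:M, 1; rewrite trmxK; split; [exact: word1|exact: oner_neq0|by rewrite mulmx1 scale1r].
  - by rewrite trmx_eq0.
have [y [t [B [s [wB s0 yE]]]]|r richr] := rich_some (Oi := fun (r : 'I_m) y => exists t B s,
    [/\ word nu t B, (t %% m)%N = r, s != 0 & y^T = s *: (v *m B)]) richO.
  by exists (Ordinal (ltn_pmod t m0)), t, B, s.
have [a y a0 [t [B [s [wB tr s0 yE]]]]|y [Hy [eta eta01 few]]] := spread_vectors M (ltn0Sn _) richr.
  exists t, B, (a * s); split => //; first by rewrite mulf_neq0.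
  by rewrite linearZ/= yE scalerA.
by exists y, r, eta; split => // i; have [] := Hy i.
Qed.

(** If [A *m u] is proportional to [x i] and [v *m B] to [(y i)^T], then [A *m h ^+ j *m B],
    rescaled, tends to [x i *m (y i)^T]. The exponent [j] also serves to equalize the lengths. *)
Theorem exists_spread : exists l c r, [/\ 0 < c <= 1, 0 < r < 1 &
  forall K (B : 'M[R]_d), exists S : set E, [/\ measurable S,
    (nu S <= (gap_prob r K)%:E)%E &
    forall z : E, (forall k, z k \in unitmx) -> ~ S z ->
      c * (expR (- total_cost (K * l + K * l) z) * mxn B)
        <= `|\tr (B *m mprod z (K * l + K * l))|]].
Proof.
have [m [m0 Hp]] := prox.
have [h wh hp] := proximal_word nu_catn unit_ae Hp.
have [lam [u [v [lam0 vu [k [c [k0 c01 Hk]]]]]]] := proximal_power_limit hp.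
have u0 : u != 0.
  apply/eqP => u0; move: vu; rewrite u0 mulmx0 => /matrixP/(_ 0 0)/eqP.
  by rewrite !mxE/= eq_sym oner_eq0.
have v0 : v != 0.
  apply/eqP => v0; move: vu; rewrite v0 mul0mx => /matrixP/(_ 0 0)/eqP.
  by rewrite !mxE/= eq_sym oner_eq0.
pose M := (80 * d)%N.
have [x [r1 [eta1 [/andP[eta10 eta11] Hx few_x]]]] := spread_orbit M m0 u0.
have [y [r2 [eta2 [/andP[eta20 eta21] Hy few_y]]]] := spread_orbit_tr M m0 v0.
pose eta0 := Num.min eta1 eta2.
have eta01 : 0 < eta0 <= 1 by rewrite lt_min eta10 eta20/= ge_min eta11.
pose eta := eta0 / (4 * d%:R).
have eta_gt0 : 0 < eta by rewrite divr_gt0//; have /andP[] := eta01.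
(* Any constant above 384, the requirement of the trace estimate, would do. Half of [e] is left for
   the distance from a word to its model, half for the ball around the word. *)
pose e := eta ^+ 4 / 400.
have eta4 : 0 < eta ^+ 4 by rewrite exprn_gt0.
have e_gt0 : 0 < e by move: eta4; rewrite /e; set t := eta ^+ 4; clearbody t; lra.
have ee : 384 * e <= eta ^+ 4.
  by move: eta4; rewrite /e; lra.
clearbody e.
have few' (z : 'I_M -> 'cV[R]_d) eta' : eta0 <= eta' ->
    (forall q : 'rV[R]_d, (\sum_i (mxn (q *m z i) < eta' * mxn q)%R <= d.-1)%N) ->
    forall q : 'rV[R]_d, (\sum_i (mxn (q *m z i) < eta0 * mxn q)%R <= d.-1)%N.
  move=> le few q; apply: leq_trans (few q); apply: leq_sum => i _.
  have le' : eta0 * mxn q <= eta' * mxn q by rewrite ler_wpM2r// mxn_ge0.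
  by case: (ltP _ (eta0 * _)) => //= lt; rewrite (lt_le_trans lt le').
have wX j : word nu (j * m) (h ^+ j).
  elim: j => [|j IHj]; first exact: word1.
  by rewrite mulSn exprS; exact: wordM.
have Hex : forall i : 'I_M, exists f : nat * 'M[R]_d * (nat * 'M[R]_d) * R * nat,
    let A := f.1.1.1 in let B := f.1.1.2 in
    [/\ word nu (A.1 * m + r1) A.2, word nu (B.1 * m + r2) B.2, f.1.2 != 0 &
     forall j, (f.2 <= j)%N -> mxn ((f.1.2 * lam ^- j) *: (A.2 *m h ^+ j *m B.2) - x i *m (y i)^T) < e / 2].
  move=> i; have [_ [t [A [s [wA tr s0 xE]]]]] := Hx i.
  have [_ [t' [B [s' [wB tr' s0' yE]]]]] := Hy i.
  have e20 : 0 < e / 2 by rewrite divr_gt0.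
  have [j0 Hj0] := geometric_lt (`|s * s'| * mxn A * mxn B * k) c01 e20.
  exists ((t %/ m)%N, A, ((t' %/ m)%N, B), s * s', j0) => /=; split.
  - by rewrite -tr -divn_eq.
  - by rewrite -tr' -divn_eq.
  - by rewrite mulf_neq0.
  move=> j /Hj0; apply: le_lt_trans.
  have -> : (s * s' * lam ^- j) *: (A *m h ^+ j *m B) - x i *m (y i)^T =
      (s * s') *: (A *m (lam ^- j *: h ^+ j - u *m v) *m B).
    rewrite xE yE mulmxBr mulmxBl scalerBr -!scalemxAl -!scalemxAr -!scalemxAl !scalerA.
    by rewrite !mulmxA.
  rewrite mxnZ -!mulrA ler_wpM2l//.
  apply: le_trans (mxnM _ _) _; apply: (@le_trans _ _ (mxn A * (k * c ^+ j) * mxn B)).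
    rewrite ler_wpM2r ?mxn_ge0//; apply: le_trans (mxnM _ _) _.
    by rewrite ler_wpM2l ?mxn_ge0.
  by rewrite le_eqVlt; apply/orP; left; apply/eqP; ring.
have [f Hf] := choice Hex.
pose qA i := (f i).1.1.1.1; pose qB i := (f i).1.1.2.1; pose j0 i := (f i).2.
(* The residues [r1] and [r2] do not depend on [i], so the lengths differ by multiples of [m] only.
   A common [N] above all [qA i + qB i + j0 i] makes every exponent [j i] at least [j0 i] and every
   length equal to [l]. *)
pose N := (\sum_i (qA i + qB i + j0 i))%N.
have HN i : (qA i + qB i + j0 i <= N)%N by rewrite /N (bigD1 i)//= leq_addr.
pose j i := (N - (qA i + qB i))%N.
have jge i : (j0 i <= j i)%N by rewrite leq_subRL ?(leq_trans (leq_addr _ _) (HN i))// HN.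
pose l := (r1 + r2 + N * m)%N.
pose kappa i := (f i).1.2 * lam ^- (j i).
pose S i := (f i).1.1.1.2 *m h ^+ (j i) *m (f i).1.1.2.2.
have wS i : word nu l (S i).
  have [wA wB _ _] := Hf i.
  have := wordM (wordM wA (wX (j i))) wB.
  have -> // : ((f i).1.1.1.1 * m + r1 + j i * m + ((f i).1.1.2.1 * m + r2) = l)%N.
  rewrite -/(qA i) -/(qB i) /l -(subnK (leq_trans (leq_addr _ _) (HN i))) -/(j i) !mulnDl.
  move: (qA i * m)%N (qB i * m)%N (j i * m)%N => a1 a2 a3.
  by clear; lia.
have kappa0 i : kappa i != 0.
  by have [_ _ s0 _] := Hf i; rewrite mulf_neq0// invr_eq0 expf_neq0.
have near_pos i : (0 < nu [set z : E | near_word x y kappa e i (mprod z l)])%E.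
  have k0' : 0 < `|kappa i| by rewrite normr_gt0.
  have t0 : 0 < e / 2 / `|kappa i| by rewrite !divr_gt0.
  apply: lt_le_trans (word_gt0 nu_catn (wS i) t0) _.
  apply: le_measure; rewrite ?inE; first exact: measurable_ball_event.
    have := measurable_near_word x y kappa e i (@mxmeasurable_mprod R d l).
    by move=> /(_ measurableT [set true]); rewrite setTI; apply.
  move=> z; rewrite /ball_event /near_word /near_rank_one/= => hz.
  rewrite (Hx i).1 (Hy i).1 !eqxx/=.
  have -> : kappa i *: mprod z l - x i *m (y i)^T =
      kappa i *: (mprod z l - S i) + (kappa i *: S i - x i *m (y i)^T).
    by rewrite scalerBr addrA subrK.
  apply: le_lt_trans (mxnD _ _) _; rewrite [e]splitr mxnZ; apply: ltrD.
    by rewrite mulrC -ltr_pdivlMr.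
  by have [_ _ _ H] := Hf i; exact: H (jge i).
exists l.
apply: (spread_of_rank_one_words nu_catn _ kappa0 eta01 (ltW e_gt0) ee _ _ near_pos) => //.
- by apply: few' few_x; rewrite ge_min lexx.
- by apply: few' few_y; rewrite ge_min lexx orbT.
Qed.

End SpreadExists.

(** * Moments and conclusion *)

Section OperatorNorm.
Variables (R : realType) (d : nat).

Lemma vnorm_le_mxn (x : 'cV[R]_d) : vnorm x <= mxn x.
Proof.
have m0 : 0 <= mxn x by exact: mxn_ge0.
rewrite /vnorm -(ger0_norm m0) -sqrtr_sqr ler_sqrt ?sqr_ge0//.
have -> : mxn x ^+ 2 = \sum_i `|x i 0| * mxn x.
  by rewrite expr2 {1}/mxn mulr_suml; apply: eq_bigr => i _; rewrite big_ord1.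
apply: ler_sum => i _; rewrite -(real_normK (num_real (x i 0))) expr2.
by rewrite ler_wpM2l// le_mxn.
Qed.

Lemma coord_le_vnorm (x : 'cV[R]_d) i : `|x i 0| <= vnorm x.
Proof.
rewrite -sqrtr_sqr ler_sqrt; last by apply: sumr_ge0 => j _; exact: sqr_ge0.
by rewrite (bigD1 i)//= lerDl; apply: sumr_ge0 => j _; exact: sqr_ge0.
Qed.

Lemma entry_le_opnorm (A : 'M[R]_d) i j : `|A i j| <= opnorm A.
Proof.
have hs : has_sup [set y : R | exists2 x : 'cV[R]_d, vnorm x = 1 & y = vnorm (A *m x)].
  have v1 : vnorm (delta_mx j 0 : 'cV[R]_d) = 1.
    rewrite /vnorm (bigD1 j)//= mxE !eqxx expr1n big1 ?addr0 ?sqrtr1// => k kj.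
    by rewrite mxE (negPf kj) expr0n.
  split; first by exists (vnorm (A *m delta_mx j 0)), (delta_mx j 0).
  exists (mxn A * d%:R) => _ [x x1 ->].
  apply: le_trans (vnorm_le_mxn _) _; apply: le_trans (mxnM _ _) _.
  rewrite ler_wpM2l ?mxn_ge0// /mxn -[d in leRHS]card_ord -[leRHS]mulr1 mulr_natl -sumr_const.
  by apply: ler_sum => k _; rewrite big_ord1 -x1; exact: coord_le_vnorm.
apply: le_trans (_ : vnorm (A *m (delta_mx j 0 : 'cV[R]_d)) <= _).
  by apply: le_trans (coord_le_vnorm _ i); rewrite -colE mxE.
apply: sup_upper_bound => //; exists (delta_mx j 0) => //.
rewrite /vnorm (bigD1 j)//= mxE !eqxx expr1n big1 ?addr0 ?sqrtr1// => k kj.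
by rewrite mxE (negPf kj) expr0n.
Qed.

Lemma mxn_le_opnorm (A : 'M[R]_d) : mxn A <= (d * d)%:R * opnorm A.
Proof.
rewrite natrM -mulrA; apply: (@le_trans _ _ (\sum_(i < d) \sum_(j < d) opnorm A)).
  by apply: ler_sum => i _; apply: ler_sum => j _; exact: entry_le_opnorm.
rewrite (eq_bigr (fun=> d%:R * opnorm A)) => [|i _]; last by rewrite sumr_const card_ord mulr_natl.
by rewrite sumr_const card_ord -[leLHS]mulr_natl.
Qed.

Lemma logp_ge0 (x : R) : 0 <= logp x.
Proof. by rewrite /logp le_max lexx orbT. Qed.

Lemma le_expR_logp (x : R) : x <= expR (logp x).
Proof.
have [x0|x0] := leP x 0; first exact: le_trans x0 (expR_ge0 _).
by rewrite -{1}(lnK (x := x)) ?posrE// ler_expR /logp le_max lexx.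
Qed.

Lemma le_logp (x y : R) : x <= y -> logp x <= logp y.
Proof.
move=> xy; rewrite {1}/logp ge_max logp_ge0 andbT.
have [x0|x0] := leP x 0; first by rewrite ln0// logp_ge0.
by rewrite /logp le_max ler_ln ?posrE ?xy// (lt_le_trans x0).
Qed.

(** The three summands in the cost are each at most [d * d] times the product of the exponentials of
    the two [logp] terms. Division by [d * d] puts these terms below the ones of the moment
    assumptions, by [mxn_le_opnorm]. *)
Lemma cost_le_logp (M : 'M[R]_d) : (0 < d)%N ->
  cost M <= ln (3 * (d * d)%:R) + logp (mxn M / (d * d)%:R) + logp (mxn (invmx M) / (d * d)%:R).
Proof.
move=> d0; set D : R := (d * d)%:R; set p := mxn M / D; set q := mxn (invmx M) / D.
have D1 : 1 <= D by rewrite ler1n muln_gt0 d0.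
have D0 : 0 < D by lra.
have hp := le_expR_logp p; have hq := le_expR_logp q.
have ep : 1 <= expR (logp p) by rewrite -expR0 ler_expR logp_ge0.
have eq : 1 <= expR (logp q) by rewrite -expR0 ler_expR logp_ge0.
rewrite /cost -ler_expR lnK ?posrE; last by rewrite -addrA ltr_pwDl// addr_ge0// mxn_ge0.
rewrite !expRD lnK ?posrE ?mulr_gt0//.
have -> : mxn M = D * p by rewrite mulrC divfK// gt_eqF.
have -> : mxn (invmx M) = D * q by rewrite mulrC divfK// gt_eqF.
set a := expR (logp p) in hp ep *; set b := expR (logp q) in hq eq *.
have h1 : D * p <= D * (a * b).
  by rewrite ler_wpM2l ?(ltW D0)// (le_trans hp)// ler_peMr// (le_trans ler01).
have h2 : D * q <= D * (a * b).
  by rewrite ler_wpM2l ?(ltW D0)// (le_trans hq)// ler_peMl// (le_trans ler01).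
have h3 : 1 <= D * (a * b).
  by rewrite -[leLHS]mulr1 ler_pM// -[leLHS]mulr1 ler_pM.
lra.
Qed.

End OperatorNorm.

(* No measurability of [g] is needed, as the integral is a supremum over simple
   functions; it is used for [logp (opnorm _)]. *)
Lemma ge0_integral_le (dT : measure_display) (T : measurableType dT) (R : realType)
    (P : {measure set T -> \bar R}) (f g : T -> \bar R) :
  (forall x, 0 <= f x)%E -> (forall x, f x <= g x)%E -> (\int[P]_x f x <= \int[P]_x g x)%E.
Proof.
move=> f0 fg; rewrite !ge0_integralTE//; last by move=> x; exact: le_trans (f0 x) (fg x).
apply: le_ereal_sup => _ [h hf <-]; exists h => // x.
exact: le_trans (hf x) (fg x).
Qed.

(** Bounding [s n] by exponentials includes its positivity for large [n], which its logarithm alone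
    would not show, since [ln] is 0 on nonpositive reals. *)
Definition growth_rate (R : realType) (s : nat -> R) (lam : R) := forall e, 0 < e ->
  exists n0, forall n, (n0 <= n)%N -> expR (n%:R * (lam - e)) <= s n <= expR (n%:R * (lam + e)).

Lemma growth_rate_cvg (R : realType) (s : nat -> R) lam : growth_rate s lam ->
  (ln (s n) / n%:R) @[n --> \oo] --> lam.
Proof.
move=> H; apply/cvgrPdist_le => e e0.
have [n0 Hn0] := H e e0; exists n0.+1 => // n /= nn.
have /andP[h1 h2] := Hn0 n (ltnW nn).
have n_gt0 : 0 < n%:R :> R by rewrite ltr0n (leq_ltn_trans _ nn).
have s0 : 0 < s n by exact: lt_le_trans (expR_gt0 _) h1.
move: h1 h2; rewrite -{1 2}(lnK (x := s n)) ?posrE// !ler_expR mulrC => h1; rewrite mulrC => h2.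
rewrite distrC ler_distl; apply/andP; split.
  by rewrite ler_pdivlMr.
by rewrite ler_pdivrMr.
Qed.

(** * Transfer between the sample space and the law of trajectories *)

Section LawOfTrajectories.
Variables (R : realType) (d : nat) (dT : measure_display) (T : measurableType dT)
  (P : probability T R) (g : nat -> T -> 'M[R]_d).
Hypothesis Hiid : iid_matrices P g.
Hypothesis Hinv : forall n w, g n w \in unitmx.
Local Notation E := (mseq R d).
Local Notation nu := (law Hiid).

Lemma ae_law (Q : E -> Prop) : {ae nu, forall x, Q x} -> {ae P, forall w, Q (traj g w)}.
Proof.
move=> [N [mN nuN HN]]; exists (traj g @^-1` N); split.
- by rewrite -[X in measurable X]setTI; exact: (measurable_traj Hiid).
- exact: nuN.
- by move=> w; exact: HN.
Qed.

Lemma unit_ae_law : {ae nu, forall x : E, forall k, x k \in unitmx}.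
Proof.
have mU : measurable [set x : E | forall k, x k \in unitmx].
  apply: measurable_forall => k.
  have := measurable_unitmx (@mxmeasurable_coord R d k).
  by move=> /(_ measurableT [set true]); rewrite setTI; apply.
exists (~` [set x : E | forall k, x k \in unitmx]); split => //; first exact: measurableC.
have e0 : traj g @^-1` (~` [set x : E | forall k, x k \in unitmx]) = set0.
  by apply/seteqP; split => // w /= nu'; apply: nu' => k; exact: Hinv.
by have := measure0 P; rewrite -e0.
Qed.

Lemma integrable_cost_law : (0 < d)%N ->
  (\int[P]_w (logp (opnorm (g 0%N w)))%:E < +oo)%E ->
  (\int[P]_w (logp (opnorm (invmx (g 0%N w))))%:E < +oo)%E ->
  nu.-integrable setT (fun x : E => (cost (x 0%N))%:E).
Proof.
move=> d0 Hm Hm'; pose D : R := (d * d)%:R.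
have D0 : 0 < D by rewrite ltr0n muln_gt0 d0.
pose f1 (x : E) := logp (mxn (x 0%N) / D); pose f2 (x : E) := logp (mxn (invmx (x 0%N)) / D).
have mlogp (F : E -> 'M[R]_d) : mxmeasurable F -> measurable_fun setT (fun x => logp (mxn (F x) / D)).
  move=> mF; apply: measurable_maxr; last exact: measurable_cst.
  apply: (measurableT_comp (@measurable_ln R)); apply: measurable_funM; last exact: measurable_cst.
  exact: measurable_mxn.
have mf1 : measurable_fun setT f1 by apply: mlogp; exact: mxmeasurable_coord.
have mf2 : measurable_fun setT f2.
  by apply: mlogp; apply: mxmeasurable_invmx; exact: mxmeasurable_coord.
have le_op (A : 'M[R]_d) : logp (mxn A / D) <= logp (opnorm A).
  by apply: le_logp; rewrite ler_pdivrMr// mulrC mxn_le_opnorm.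
have If1 : (\int[nu]_x (f1 x)%:E < +oo)%E.
  rewrite ge0_integral_distribution; [|exact/measurable_EFinP|by move=> x; rewrite lee_fin logp_ge0].
  apply: le_lt_trans Hm; apply: ge0_integral_le => w /=; rewrite lee_fin ?logp_ge0//.
  exact: le_op.
have If2 : (\int[nu]_x (f2 x)%:E < +oo)%E.
  rewrite ge0_integral_distribution; [|exact/measurable_EFinP|by move=> x; rewrite lee_fin logp_ge0].
  apply: le_lt_trans Hm'; apply: ge0_integral_le => w /=; rewrite lee_fin ?logp_ge0//.
  exact: le_op.
have D1 : 1 <= D by rewrite ler1n muln_gt0 d0.
have c0 : 0 <= ln (3 * D) by rewrite ln_ge0//; lra.
apply/integrableP; split; first by apply/measurable_EFinP; exact: measurable_cost.
apply: (@le_lt_trans _ _ (\int[nu]_x ((ln (3 * D))%:E + ((f1 x)%:E + (f2 x)%:E)))%E).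
  apply: ge0_le_integral => //.
  - by apply: measurableT_comp => //; apply/measurable_EFinP; exact: measurable_cost.
  - by apply: emeasurable_funD; [exact: measurable_cst|apply: emeasurable_funD; exact/measurable_EFinP].
  - move=> x _; rewrite -!EFinD lee_fin ger0_norm ?cost_ge0// addrA.
    exact: cost_le_logp.
rewrite ge0_integralD//; last 2 first.
- by move=> x _; rewrite -EFinD lee_fin addr_ge0// logp_ge0.
- by apply: emeasurable_funD; exact/measurable_EFinP.
have -> : (\int[nu]_x (ln (3 * D))%:E = (ln (3 * D))%:E)%E by exact: (integral_cst_prob nu _).
apply: lte_add_pinfty; first exact: ltry.
have f0 (f : E -> R) : (forall x, 0 <= f x) -> forall x, setT x -> (0 <= (f x)%:E)%E.
  by move=> f0 x _; rewrite lee_fin.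
have f10 : forall x, 0 <= f1 x by move=> x; exact: logp_ge0.
have f20 : forall x, 0 <= f2 x by move=> x; exact: logp_ge0.
have mE1 : measurable_fun setT (fun x => (f1 x)%:E) by exact/measurable_EFinP.
have mE2 : measurable_fun setT (fun x => (f2 x)%:E) by exact/measurable_EFinP.
have -> : (\int[nu]_x ((f1 x)%:E + (f2 x)%:E) = \int[nu]_x (f1 x)%:E + \int[nu]_x (f2 x)%:E)%E.
  exact: (ge0_integralD nu measurableT (f0 _ f10) mE1 (f0 _ f20) mE2).
exact: lte_add_pinfty.
Qed.

End LawOfTrajectories.

Theorem theoremA (R : realType) (d : nat) (hd : (2 <= d)%N)
  (dT : measure_display) (T : measurableType dT) (P : probability T R)
  (g : nat -> T -> 'M[R]_d)
  (Hiid : iid_matrices P g)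
  (Hinv : forall n w, g n w \in unitmx)
  (Hmom : (\int[P]_w (logp (opnorm (g 0%N w)))%:E < +oo)%E)
  (Hmom' : (\int[P]_w (logp (opnorm (invmx (g 0%N w))))%:E < +oo)%E)
  (Hirr : forall (N : nat) (V : 'I_N -> {vspace 'cV[R]_d}), (1 <= N)%N ->
     (forall k, (0 < \dim (V k))%N /\ (\dim (V k) < d)%N) ->
     (P [set w | forall v : 'cV[R]_d, (exists k, v \in V k) ->
                   exists k, g 0%N w *m v \in V k] < 1)%E)
  (Hprox : exists n, (1 <= n)%N /\
     (0 < P [set w | (rho (mprod (g ^~ w) n) 1 < rho (mprod (g ^~ w) n) 0)%R])%E) :
  exists lambda1 : R, forall i j : 'I_d,
    {ae P, forall w,
       (\forall n \near \oo, mprod (g ^~ w) n i j != 0) /\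
       (ln `|mprod (g ^~ w) n i j| / n%:R) @[n --> \oo] --> lambda1 /\
       (ln (rho (mprod (g ^~ w) n) 0) / n%:R) @[n --> \oo] --> lambda1}.
Proof.
case: d hd g Hiid Hinv Hmom Hmom' Hirr Hprox => [|[|d]]// _ g Hiid Hinv Hmom Hmom' Hirr Hprox.
pose nu := law Hiid.
have nu_catn : forall n A, measurable A ->
    nu A = (nu \x nu)%E ((fun p : mseq R d.+2 * mseq R d.+2 => catn n p.1 p.2) @^-1` A).
  exact: law_catn.
have unit_ae : {ae nu, forall x : mseq R d.+2, forall k, x k \in unitmx} by exact: unit_ae_law.
have int_cost : nu.-integrable setT (fun x : mseq R d.+2 => (cost (x 0%N))%:E).
  exact: integrable_cost_law.
have d0 : (0 < d.+2)%N by [].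
have [l [c [r [c01 r01 spread]]]] := @exists_spread R d nu nu_catn unit_ae Hirr Hprox.
pose lam := lyapunov nu; exists lam => i j.
(* A sequence tending to 0 reduces all precisions to a countable intersection of almost sure
   events. *)
pose eps k : R := k.+1%:R^-1.
have eps0 k : 0 < eps k by rewrite invr_gt0.
have Bij : (delta_mx j i : 'M[R]_d.+2) != 0.
  by apply/eqP => /matrixP/(_ j i)/eqP; rewrite !mxE !eqxx oner_eq0.
have B1 : (1%:M : 'M[R]_d.+2) != 0 by rewrite oner_neq0.
have Hup := ae_foralln (fun k => norm_upper nu_catn d0 unit_ae int_cost (eps0 k)).
have Hij := ae_foralln (fun k => trace_lower nu_catn d0 unit_ae int_cost c01 r01 spread Bij (eps0 k)).
have Htr := ae_foralln (fun k => trace_lower nu_catn d0 unit_ae int_cost c01 r01 spread B1 (eps0 k)).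
apply: filterS3 (ae_law Hup) (ae_law Hij) (ae_law Htr) => w.
rewrite -/lam; set x := traj g w => up low_ij low_tr.
(* The factor [D] absorbs the loss between trace and [s]: 1 for an entry, the dimension for the
   spectral radius. *)
have growth (s : nat -> R) (D : R) : 0 < D -> (forall n, s n <= mxn (mprod x n)) ->
    (forall k, exists n0, forall n, (n0 <= n)%N -> expR (n%:R * (lam - eps k)) <= D * s n) ->
    growth_rate s lam.
  move=> D0 s_up s_low e e0.
  have [k ke] : exists k, eps k <= e / 2.
    exists (Num.truncn (2 / e)).
    rewrite /eps invf_ple ?posrE ?divr_gt0// invf_div.
    exact: ltW (truncnS_gt _).
  have [C HC] := up k; have [n0 Hn0] := s_low k.
  exists (maxn n0 (Num.truncn (2 * (`|C| + `|ln D|) / e)).+1) => n.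
  rewrite geq_max => /andP[nn0 nn1].
  have hn : `|C| + `|ln D| <= n%:R * (e / 2).
    have h : 2 * (`|C| + `|ln D|) / e <= n%:R.
      by apply: le_trans (ltW (truncnS_gt _)) _; rewrite ler_nat.
    rewrite ler_pdivrMr// in h; lra.
  have hk : n%:R * eps k <= n%:R * (e / 2) by rewrite ler_wpM2l.
  have hC := ler_norm C; have hD := ler_norm (ln D).
  have aC := normr_ge0 C; have aD := normr_ge0 (ln D).
  apply/andP; split.
    rewrite -(ler_pM2l D0); apply: le_trans (Hn0 n nn0).
    rewrite -[D in leLHS](lnK (x := D)) ?posrE// -expRD ler_expR; lra.
  apply: le_trans (s_up n) (le_trans (HC n) _).
  rewrite ler_expR; lra.
have traceE n : \tr ((delta_mx j i : 'M[R]_d.+2) *m mprod x n) = mprod x n i j.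
  rewrite -(mul_delta_mx (0 : 'I_1)) -mulmxA mxtrace_mulC -rowE -colE /mxtrace big_ord1.
  by rewrite !mxE.
have gij : growth_rate (fun n => `|mprod x n i j|) lam.
  apply: (growth _ 1) => // [n|k]; first exact: le_mxn.
  by have [n0 H] := low_ij k; exists n0 => n /H; rewrite traceE mul1r.
have grho : growth_rate (fun n => rho (mprod x n) 0) lam.
  apply: (growth _ d.+2%:R) => // [n|k]; first exact: rho0_le_mxn.
  have [n0 H] := low_tr k; exists n0 => n /H/le_trans; apply.
  by rewrite mul1mx trace_le_rho0.
split; last by split; exact: growth_rate_cvg.
have [n0 Hn0] := gij 1 ltr01; exists n0 => // n /= /Hn0/andP[h _].
by rewrite -normr_gt0 (lt_le_trans _ h)// expR_gt0.
Qed.
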